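(* Suppose that $\mathcal{R}$ is an ergodic, probability measure-preserving, discrete equivalence relation on a standard probability space $(X,\mu)$. The following are equivalent: (i) $\mathcal{R}$ is strongly ergodic; (ii) if $((\mathcal{H}_x)_{x\in X},\pi)$ is a unitary representation of $\mathcal{R}$ and $L^2(X)$ is weakly equivalent to $\mathcal{H}:=\int_X^{\oplus}\mathcal{H}_x\,d\mu(x)$ as representations of $\mathcal{R}$, then $L^2(X)$ embeds into $\mathcal{H}$ as a representation of $\mathcal{R}$.
   Context: An equivalence relation over a standard probability space $(X,\mu)$ is a Borel subset $\mathcal{R}\subseteq X\times X$ that is an equivalence relation on $X$, with classes $[x]_{\mathcal{R}}$. It is discrete if almost every class is countable; then $\mu_{\mathcal{R}}(E)=\int_X|\{y:(x,y)\in E\}|\,d\mu(x)$ is a $\sigma$-finite measure on $\mathcal{R}$, and $\mathcal{R}$ is probability measure-preserving if $(x,y)\mapsto(y,x)$ preserves $\mu_{\mathcal{R}}$ and $\mu$ is a probability measure. $[\mathcal{R}]$ is the group of bimeasurable bijections $\gamma$ of $X$ with $\gamma(x)\in[x]_{\mathcal{R}}$ a.e., modulo a.e. equality. $\mathcal{R}$ is ergodic if every measurable $E$ with $\mu(\gamma E\Delta E)=0$ for all $\gamma\in[\mathcal{R}]$ has $\mu(E)\in\{0,1\}$; it is strongly ergodic if for every sequence $(E_n)_n$ of measurable sets with $\mu(\gamma E_n\Delta E_n)\to0$ for all $\gamma\in[\mathcal{R}]$ one has $\mu(E_n)(1-\mu(E_n))\to0$. A measurable field of Hilbert spaces over $X$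 is a family $(\mathcal{H}_x)_{x\in X}$ of separable Hilbert spaces with a set $\mathrm{Meas}((\mathcal{H}_x)_x)\subseteq\prod_x\mathcal{H}_x$ such that: $x\mapsto\langle\xi_x,\eta_x\rangle$ is measurable for all $\xi,\eta$ in this set; any $\eta\in\prod_x\mathcal{H}_x$ with $x\mapsto\langle\xi_x,\eta_x\rangle$ measurable for all $\xi$ in this set lies in it; it contains a sequence $\xi^{(n)}$ with $\mathcal{H}_x=\overline{\mathrm{span}}\{\xi^{(n)}_x:n\}$ for a.e. $x$. The direct integral $\int_X^{\oplus}\mathcal{H}_x\,d\mu(x)$ is the Hilbert space of square-integrable measurable sections modulo a.e. equality. A unitary representation of $\mathcal{R}$ is a measurable field $(\mathcal{H}_x)_x$ with unitaries $\pi(x,y)\in\mathcal{U}(\mathcal{H}_y,\mathcal{H}_x)$ for $(x,y)\in\mathcal{R}$, such that $(x,y)\mapsto\langle\pi(x,y)\xi_y,\eta_x\rangle$ is measurable for all measurable sections $\xi,\eta$, and for a.e. $x$, $\pi(x,y)\pi(y,z)=\pi(x,z)$ for all $y,z\in[x]_{\mathcal{R}}$. On $\mathcal{H}$ one sets $(\pi(f)\xi)_x=f(x)\xi_x$ for $f\in L^\infty(X)$ and $(\pi(\gamma)\xi)_x=\pi(x,\gamma^{-1}(x))\xi_{\gamma^{-1}(x)}$ for $\gamma\in[\mathcal{R}]$. $L^2(X)=\int_X^\oplus\mathbb{C}\,d\mu(x)$ carries the representation $\alpha(x,y)=\mathrm{id}_{\mathbb{C}}$, so $\alpha(f)\xi=f\xi$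 and $(\alpha(\gamma)\xi)(x)=\xi(\gamma^{-1}(x))$. ''$L^2(X)$ embeds into $\mathcal{H}$'' means there is a linear isometry $V:L^2(X)\to\mathcal{H}$ with $V\alpha(f)\alpha(\gamma)=\pi(f)\pi(\gamma)V$ for all $f\in L^\infty(X)$, $\gamma\in[\mathcal{R}]$. Weak containment: $\pi\preceq\rho$ for unitary representations $((\mathcal{H}_x)_x,\pi)$, $((\mathcal{K}_x)_x,\rho)$ of $\mathcal{R}$ if for all measurable $Q\subseteq\mathcal{R}$ with $\mu_{\mathcal{R}}(Q)<\infty$, all measurable sections $\xi$ of $(\mathcal{H}_x)_x$ and all $\varepsilon>0$, there are measurable sections $\zeta_1,\dots,\zeta_k$ of $(\mathcal{K}_x)_x$ with $\mu_{\mathcal{R}}(\{(x,y)\in Q:|\langle\pi(x,y)\xi_y,\xi_x\rangle-\sum_{i=1}^k\langle\rho(x,y)\zeta_{i,y},\zeta_{i,x}\rangle|>\varepsilon\})<\varepsilon$. Weakly equivalent means $\pi\preceq\rho$ and $\rho\preceq\pi$. *)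

(* Defs.v *)
From HB Require Import structures.
From Corelib Require Export RelationClasses.
From mathcomp Require Export all_boot all_order all_algebra complex.
From mathcomp Require Export all_classical all_reals all_analysis.
From mathcomp Require Import measurable_realfun.

Set Implicit Arguments.
Unset Strict Implicit.
Unset Printing Implicit Defensive.

Import Order.TTheory GRing.Theory Num.Theory.
Import numFieldNormedType.Exports.

Local Open Scope classical_set_scope.
Local Open Scope complex_scope.
Local Open Scope ring_scope.

Section ComplexNumbers.
Variable R : realType.

Lemma normC_le_ReIm (z : R[i]) :
  `|z| <= (`|complex.Re z| + `|complex.Im z|)%:C.
Proof.
rewrite normc_def lecR -(ger0_norm (addr_ge0 (normr_ge0 _) (normr_ge0 _))).
rewrite -sqrtr_sqr ler_sqrt ?sqr_ge0// sqrrD !real_normK ?num_real//.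
by rewrite addrAC lerDl mulrn_wge0// mulr_ge0.
Qed.

Lemma ReC_le (z : R[i]) : `|complex.Re z|%:C <= `|z|.
Proof. exact: normc_ge_Re. Qed.

Lemma ImC_le (z : R[i]) : `|complex.Im z|%:C <= `|z|.
Proof.
by rewrite normc_def lecR -sqrtr_sqr ler_sqrt ?lerDr ?addr_ge0 ?sqr_ge0.
Qed.

Lemma gt0C (e : R[i]) : 0 < e -> 0 < complex.Re e /\ e = (complex.Re e)%:C.
Proof. by case: e => a b; rewrite ltcE /= => /andP[/eqP -> ->]. Qed.

Lemma complex_complete (F : set_system R[i]^o) :
  ProperFilter F -> cauchy F -> cvg F.
Proof.
move=> FF Fb.
have Fc' (e : R) : 0 < e -> exists z, F (ball (z : R[i]^o) e%:C).
  by move=> e0; apply: ((cauchyP F).1 Fb); rewrite ltcR.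
have cRe : cvg (@complex.Re R @ F).
  apply: cauchy_cvg; apply: cauchy_exP => e e0.
  have [z Fz] := Fc' e e0; exists (complex.Re z).
  change (F (@complex.Re R @^-1` ball (complex.Re z) e)).
  apply: filterS Fz => w; rewrite /= -!ball_normE /= => zw.
  rewrite -ltcR; apply: le_lt_trans zw.
  by have := ReC_le (z - w); rewrite raddfB.
have cIm : cvg (@complex.Im R @ F).
  apply: cauchy_cvg; apply: cauchy_exP => e e0.
  have [z Fz] := Fc' e e0; exists (complex.Im z).
  change (F (@complex.Im R @^-1` ball (complex.Im z) e)).
  apply: filterS Fz => w; rewrite /= -!ball_normE /= => zw.
  rewrite -ltcR; apply: le_lt_trans zw.
  by have := ImC_le (z - w); rewrite raddfB.
apply/cvg_ex; exists (lim (@complex.Re R @ F) +i* lim (@complex.Im R @ F)).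
apply/cvg_ballP => e /gt0C[e0 ->].
have e2 : 0 < complex.Re e / 2 by rewrite divr_gt0.
have nR : \forall w \near F, `|lim (@complex.Re R @ F) - complex.Re w| < complex.Re e / 2.
  by have /cvgr_dist_lt := cRe; apply.
have nI : \forall w \near F, `|lim (@complex.Im R @ F) - complex.Im w| < complex.Re e / 2.
  by have /cvgr_dist_lt := cIm; apply.
near=> w.
rewrite -ball_normE /=; apply: le_lt_trans (normC_le_ReIm _) _.
by rewrite ltcR [ltRHS]splitr !raddfB /= ltrD//; near: w.
Unshelve. all: by end_near. Qed.

End ComplexNumbers.

(* [R[i]^o] cannot itself be declared complete: the library already uses the
   head symbol [GRing.regular] for the completeness of [R^o]. *)
Definition scalar_line (R : realType) : Type := R[i]^o.
HB.instance Definition _ (R : realType) :=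
  NormedModule.copy (scalar_line R) R[i]^o.
HB.instance Definition _ (R : realType) := isPointed.Build (scalar_line R) 0.
HB.instance Definition _ (R : realType) :=
  Uniform_isComplete.Build (scalar_line R) (@complex_complete R).

Section Hilbert.
Variable R : realType.

(* The inner product is linear on the left, conjugate-linear on the right. *)
Record hilbert := Hilbert {
  hilbert_sort :> completeNormedModType R[i];
  inner : {dot hilbert_sort for Num.conj};
  inner_norm : forall u, `|u| ^+ 2 = inner u u;
  hilbert_separable : exists2 D : set hilbert_sort, countable D & dense D }.

Definition lin_span (H : hilbert) (u : nat -> H) : set H :=
  [set v | exists n (c : 'I_n -> R[i]), v = \sum_(i < n) c i *: u i].

Definition unitary (H K : hilbert) (U : H -> K) :=
  [/\ linear U,
      forall u v, inner K (U u) (U v) = inner H u v &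
      forall w, exists v, U v = w].

End Hilbert.
Arguments inner {R} h.

Section ScalarHilbert.
Variable R : realType.
Local Notation C1 := (scalar_line R).

Definition scalar_inner (u v : C1) : R[i] := (u : R[i]) * Num.conj (v : R[i]).

Lemma scalar_inner_bilinear :
  bilinear_for ( *%R ) (Num.conj \; *%R) scalar_inner.
Proof.
split=> [v a u w|u a v w]; rewrite /scalar_inner/=.
  by rewrite mulrDl -mulrA.
by rewrite rmorphD rmorphM /= mulrDr mulrCA.
Qed.

HB.instance Definition _ := bilinear_isBilinear.Build R[i] C1 C1 R[i]
  ( *%R ) (Num.conj \; *%R) scalar_inner scalar_inner_bilinear.

Lemma scalar_inner_hermitian (u v : C1) :
  scalar_inner u v = (-1) ^+ false * Num.conj (scalar_inner v u).
Proof. by rewrite /scalar_inner expr0 mul1r rmorphM /= conjCK mulrC. Qed.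

HB.instance Definition _ := isHermitianSesquilinear.Build R[i] C1 false
  (Num.conj) scalar_inner scalar_inner_hermitian.

Lemma scalar_inner_gt0 (u : C1) : u != 0 -> 0 < scalar_inner u u.
Proof. by rewrite /scalar_inner mul_conjC_gt0. Qed.

HB.instance Definition _ :=
  isDotProduct.Build R[i] C1 scalar_inner scalar_inner_gt0.

Lemma scalar_inner_norm (u : C1) : `|u| ^+ 2 = scalar_inner u u.
Proof. exact: normCK. Qed.

Lemma scalar_separable : exists2 D : set C1, countable D & dense D.
Proof.
exists (range (fun q : rat * rat => ratr q.1 +i* ratr q.2 : C1)).
  exact: (card_le_trans (card_image_le _ _) (countableP _)).
move=> O [z Oz] Oo.
have /nbhs_ballP[e /gt0C[e0 ->] eO] : nbhs z O by exact: open_nbhs_nbhs.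
have e2 : 0 < complex.Re e / 2 by rewrite divr_gt0.
have rd (a : R) : exists q : rat, `|a - ratr q| < complex.Re e / 2.
  have /rat_in_itvoo[q] : a - complex.Re e / 2 < a + complex.Re e / 2.
    by rewrite ltrD2l gtrN.
  by rewrite in_itv /= => aq; exists q; rewrite distrC ltr_distl.
have [p zp] := rd (complex.Re z); have [q zq] := rd (complex.Im z).
exists (ratr p +i* ratr q); split; last by exists (p, q).
apply: eO; rewrite -ball_normE /=.
apply: le_lt_trans (normC_le_ReIm _) _.
by rewrite ltcR [ltRHS]splitr !raddfB /= ltrD.
Qed.

Definition scalar_hilbert : hilbert R :=
  @Hilbert R C1 scalar_inner scalar_inner_norm scalar_separable.

End ScalarHilbert.

Section ComplexMeasurable.
Context {R : realType} {d : measure_display} {T : measurableType d}.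
Implicit Types (D : set T) (f g : T -> R[i]).

Definition cmeasurable D f :=
  measurable_fun D (fun x => complex.Re (f x)) /\
  measurable_fun D (fun x => complex.Im (f x)).

Lemma cmeasurable_mul_conj D f g : cmeasurable D f -> cmeasurable D g ->
  cmeasurable D (fun x => f x * Num.conj (g x)).
Proof.
move=> [fr fi] [gr gi]; split.
- rewrite (_ : (fun x => _) = fun x => complex.Re (f x) * complex.Re (g x) +
      complex.Im (f x) * complex.Im (g x)); last first.
    by apply/funext => x; case: (f x) (g x) => [a b] [a' b'] /=;
      rewrite mulrN opprK.
  by apply: measurable_funD; apply: measurable_funM.
- rewrite (_ : (fun x => _) = fun x => complex.Im (f x) * complex.Re (g x) -
      complex.Re (f x) * complex.Im (g x)); last first.
    by apply/funext => x; case: (f x) (g x) => [a b] [a' b'] /=;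
      rewrite mulrN addrC.
  by apply: measurable_funB; apply: measurable_funM.
Qed.

End ComplexMeasurable.

Definition standard_borel (R : realType) (d : measure_display)
    (X : measurableType d) :=
  exists (P : completePseudoMetricType R) (f : X -> P),
    [/\ hausdorff_space P,
        exists2 D : set P, countable D & dense D,
        bijective f &
        forall A : set X, measurable A <-> <<s [set U : set P | open U] >> (f @` A)].

Section EquivalenceRelations.
Context {R : realType} {d : measure_display} {X : measurableType d}.
Variables (mu : probability X R) (Rel : set (X * X)).
Local Open Scope ereal_scope.

Definition borel_equivalence :=
  measurable Rel /\ Equivalence (fun x y => Rel (x, y)).

Definition discrete := {ae mu, forall x, countable (xsection Rel x)}.

(* Only used on measurable subsets of [Rel]. When [Rel] is discrete, the
   integrand agrees almost everywhere with a measurable function. *)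
Definition mu_rel (E : set (X * X)) : \bar R :=
  \int[mu]_x counting (xsection E x).

Definition measure_preserving := forall E : set (X * X),
  measurable E -> E `<=` Rel -> mu_rel [set p | E (p.2, p.1)] = mu_rel E.

Record full_group := FullGroup {
  fg_fun :> X -> X;
  fg_inv : X -> X;
  fg_funK : cancel fg_fun fg_inv;
  fg_invK : cancel fg_inv fg_fun;
  fg_fun_measurable : measurable_fun setT fg_fun;
  fg_inv_measurable : measurable_fun setT fg_inv;
  fg_rel : {ae mu, forall x, Rel (x, fg_fun x)} }.

Definition ergodic := forall E : set X, measurable E ->
  (forall g : full_group, mu ((g @` E) `+` E) = 0) -> mu E = 0 \/ mu E = 1.

Definition strongly_ergodic := forall E : nat -> set X,
  (forall n, measurable (E n)) ->
  (forall g : full_group, mu ((g @` E n) `+` E n) @[n --> \oo] --> 0) ->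
  mu (E n) * (1 - mu (E n)) @[n --> \oo] --> 0.

End EquivalenceRelations.

Section Representations.
Context {R : realType} {d : measure_display} {X : measurableType d}.
Variables (mu : probability X R) (Rel : set (X * X)).

Record measurable_field := MeasurableField {
  fiber :> X -> hilbert R;
  meas : set (forall x, fiber x);
  meas_inner : forall xi eta, meas xi -> meas eta ->
    cmeasurable setT (fun x => inner (fiber x) (xi x) (eta x));
  meas_max : forall eta,
    (forall xi, meas xi ->
      cmeasurable setT (fun x => inner (fiber x) (xi x) (eta x))) ->
    meas eta;
  meas_total : exists2 xi : nat -> forall x, fiber x,
    forall n, meas (xi n) &
    {ae mu, forall x, closure (lin_span (fun n => xi n x)) = setT} }.

(* [rep_map x y] is constrained only for [(x, y)] in [Rel]. *)
Record unitary_rep := UnitaryRep {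
  rep_field :> measurable_field;
  rep_map : forall x y, rep_field y -> rep_field x;
  rep_unitary : forall x y, Rel (x, y) -> unitary (@rep_map x y);
  rep_measurable : forall xi eta, meas xi -> meas eta ->
    cmeasurable Rel (fun p : X * X =>
      inner (rep_field p.1) (rep_map p.1 (xi p.2)) (eta p.1));
  rep_cocycle : {ae mu, forall x, forall y z, Rel (x, y) -> Rel (x, z) ->
    forall v : rep_field z,
      rep_map x (rep_map y v) = rep_map x v :> rep_field x} }.

Arguments rep_map : clear implicits.

Definition rep_coef (pi : unitary_rep) (xi : forall x, pi x) (p : X * X) :
    R[i] :=
  inner (pi p.1) (rep_map pi p.1 p.2 (xi p.2)) (xi p.1).

Arguments rep_coef : clear implicits.

Definition weakly_contained (pi rho : unitary_rep) :=
  forall Q : set (X * X), measurable Q -> Q `<=` Rel ->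
  (mu_rel mu Q < +oo)%E ->
  forall xi : forall x, pi x, meas xi ->
  forall e : R, 0 < e ->
  exists k (zeta : 'I_k -> forall x, rho x),
    (forall i, meas (zeta i)) /\
    (mu_rel mu [set p | Q p /\
       (e%:C < `|rep_coef pi xi p -
                 \sum_(i < k) rep_coef rho (zeta i) p|)%R] < e%:E)%E.

Definition weakly_equivalent (pi rho : unitary_rep) :=
  weakly_contained pi rho /\ weakly_contained rho pi.

Definition L2norm_sqr (H : measurable_field) (xi : forall x, H x) : \bar R :=
  (\int[mu]_x (complex.Re (inner (H x) (xi x) (xi x)))%:E)%E.

(* Representatives of the elements of the direct integral; elements of the
   direct integral are identified up to [ae_eq_section]. *)
Definition direct_integral (H : measurable_field) : set (forall x, H x) :=
  [set xi | meas xi /\ (L2norm_sqr xi < +oo)%E].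

Definition ae_eq_section (H : measurable_field) (xi eta : forall x, H x) :=
  {ae mu, forall x, xi x = eta x}.

Definition Linfty (f : X -> R[i]) :=
  cmeasurable setT f /\ exists M : R, {ae mu, forall x, `|f x| <= M%:C}.

Definition Linfty_act (H : measurable_field) (f : X -> R[i])
    (xi : forall x, H x) : forall x, H x :=
  fun x => f x *: xi x.

(* Meaningful for almost every [x], namely when [(x, fg_inv g x)] is in [Rel]. *)
Definition full_group_act (pi : unitary_rep) (g : full_group mu Rel)
    (xi : forall x, pi x) : forall x, pi x :=
  fun x => rep_map pi x (fg_inv g x) (xi (fg_inv g x)).

(* A linear isometry between direct integrals, given on representatives. *)
Definition linear_isometry (H K : measurable_field)
    (V : (forall x, H x) -> forall x, K x) :=
  [/\ forall xi, direct_integral xi -> direct_integral (V xi),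
      forall xi eta, direct_integral xi -> direct_integral eta ->
        ae_eq_section xi eta -> ae_eq_section (V xi) (V eta),
      forall (c : R[i]) xi eta, direct_integral xi -> direct_integral eta ->
        ae_eq_section (V (fun x => c *: xi x + eta x))
                      (fun x => c *: V xi x + V eta x) &
      forall xi, direct_integral xi -> L2norm_sqr (V xi) = L2norm_sqr xi].

Definition embeds (pi rho : unitary_rep) :=
  exists2 V : (forall x, pi x) -> forall x, rho x,
    linear_isometry V &
    forall f g xi, Linfty f -> direct_integral xi ->
      ae_eq_section (V (Linfty_act f (full_group_act g xi)))
                    (Linfty_act f (full_group_act g (V xi))).

End Representations.

Section TrivialRepresentation.
Context {R : realType} {d : measure_display} {X : measurableType d}.
Variables (mu : probability X R) (Rel : set (X * X)).

Let C_ (x : X) : hilbert R := scalar_hilbert R.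
Let measC : set (forall x, C_ x) := [set xi | cmeasurable setT xi].

Let measC_inner xi eta : measC xi -> measC eta ->
  cmeasurable setT (fun x => inner (C_ x) (xi x) (eta x)).
Proof. exact: cmeasurable_mul_conj. Qed.

Let measC1 : measC (fun=> 1 : R[i]).
Proof. by split; apply: measurable_cst. Qed.

Let measC_max eta :
  (forall xi, measC xi ->
    cmeasurable setT (fun x => inner (C_ x) (xi x) (eta x))) -> measC eta.
Proof.
move=> /(_ _ measC1) h.
have := cmeasurable_mul_conj measC1 h; rewrite /measC /=.
congr cmeasurable; apply/funext => x.
by rewrite /inner /= /scalar_inner !mul1r conjCK.
Qed.

Let measC_total : exists2 xi : nat -> forall x, C_ x,
  forall n, measC (xi n) &
  {ae mu, forall x, closure (lin_span (fun n => xi n x)) = setT}.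
Proof.
exists (fun _ _ => 1 : R[i]) => //.
apply: aeW => x; apply/seteqP; split=> // v _; apply: subset_closure.
exists 1%N, (fun=> v); rewrite big_ord1.
by rewrite -[LHS](mulr1 (v : R[i])).
Qed.

Definition L2_field : measurable_field mu :=
  MeasurableField measC_inner measC_max measC_total.

Let alpha (x y : X) (v : L2_field y) : L2_field x := v.

Let alpha_unitary x y : Rel (x, y) -> unitary (@alpha x y).
Proof. by move=> _; split=> // w; exists w. Qed.

Let alpha_measurable (xi eta : forall x, L2_field x) : meas xi -> meas eta ->
  cmeasurable Rel (fun p : X * X =>
    inner (L2_field p.1) (alpha p.1 (xi p.2)) (eta p.1)).
Proof.
move=> [xr xm] [er em]; apply: cmeasurable_mul_conj; split;
  apply: measurable_funS (@measurableT _ _) (@subsetT _ _) _;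
  apply: (@measurableT_comp _ _ _ _ _ _ (fun x => _ (_ x))) => //.
Qed.

Let alpha_cocycle : {ae mu, forall x, forall y z, Rel (x, y) -> Rel (x, z) ->
  forall v : L2_field z, alpha x (alpha y v) = alpha x v}.
Proof. exact: aeW. Qed.

Definition L2_rep : unitary_rep mu Rel :=
  UnitaryRep alpha_unitary alpha_measurable alpha_cocycle.

End TrivialRepresentation.

(* Main.v *)
From HB Require Import structures.
Require Import Defs.
From mathcomp Require Import all_boot all_order all_algebra complex.
From mathcomp Require Import all_classical all_reals all_analysis.
From mathcomp Require Import measurable_realfun.
From mathcomp Require finmap.
From mathcomp Require Import ring lra zify.

Set Implicit Arguments.
Unset Strict Implicit.
Unset Printing Implicit Defensive.

Import Order.TTheory GRing.Theory Num.Theory.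
Import numFieldNormedType.Exports.

Local Open Scope classical_set_scope.
Local Open Scope complex_scope.
Local Open Scope ring_scope.

(** Both implications compare [Rel] with countably many maps: almost every class
    is exhausted by a sequence of elements [g i] of the full group
    ([full_group_cover]). This rests on a Lusin-Novikov theorem up to null sets
    ([uniformization_ae]).

    Rigidity implies strong ergodicity ([rigid_strongly_ergodic]). If [Rel] is
    not strongly ergodic, there are sets [E k] of measure bounded away from 0
    and 1 which the maps [g i] move so little that, by Borel-Cantelli, the bits
    [F k x = (x in E k)] of two related points differ at finitely many [k] only.
    The natural numbers under bitwise addition form a countable amenable group
    [Gamma], and the difference of the bits of [x] and [y] is an element of it;
    let it act by translation on [l2 Gamma] ([xor_rep]). This representation is
    weakly equivalent to [L2(X)]: almost invariant vectors come from amenability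
    ([L2_contained_xor]), and on pairs whose bits agree from the [N]-th on, the
    translation is the coboundary of a function of the first [N] bits
    ([xor_contained_L2]). An embedding of [L2(X)] would give a nonzero invariant
    section, and ergodicity then forces [F] to be constant on a set [A] of
    positive measure ([embedding_atom]). So each [E k] contains [A] or is
    disjoint from it; finitely many translates of [A] cover almost all of [X]
    ([translates_cover]), and for large [k] the set [E k] is nearly invariant
    under them, hence nearly null or conull: a contradiction.

    Strong ergodicity implies rigidity ([strongly_ergodic_rigid]). Let [pi] be
    weakly equivalent to [L2(X)]. Since [L2(X)] is weakly contained in [pi],
    there is a finite family of sections [z j] with pointwise total square norm
    about 1 and almost invariant under any prescribed finitely many [g i]. If
    such a family is positively correlated with all of its translates, averaging
    it in the sense of least energy in the convex hull of the translates gives a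
    nonzero invariant section ([invariant_section]); its norm is constant by
    ergodicity, and multiplication by it embeds [L2(X)]
    ([invariant_embeds]). Otherwise some [g] of the full group brings
    the correlation below 1/4. Weak containment of [pi] in [L2(X)] then replaces
    the family by finitely many real functions with the same correlations. A
    suitable signed sum of them ([sign_choice]) and a suitable superlevel set of
    this sum ([threshold]) give a set that the [g i] hardly move but that [g]
    moves by a fixed amount, so that its measure stays away from 0 and 1
    ([dichotomy]). Strong ergodicity excludes such sets for large families. *)

(** * Closed covers of standard Borel spaces *)

Lemma countable_enum (T : Type) (A : set T) : countable A -> A !=set0 ->
  exists e : nat -> T, forall a, A a -> exists n, e n = a.
Proof.
move=> /countable_injP[f fI] [a0 Aa0].
have /choice[e eP] : forall n, exists a, (exists2 b, A b & f b = n) ->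
    A a /\ f a = n.
  move=> n; have [[b Ab fb]|nb] := pselect (exists2 b, A b & f b = n).
    by exists b.
  by exists a0.
exists e => a Aa; exists (f a).
have [Ae fe] := eP (f a) (ex_intro2 _ _ a Aa erefl).
by apply: fI => //; rewrite inE.
Qed.

(** What the descriptive set theory below needs of a standard Borel space [X]: the
    family [cl] of closed sets, and at each level [n] a countable cover by closed
    cells [C n k] of small diameter. Completeness is phrased through closed sets
    and cells that meet finitely at a time, so that no metric on [X] appears. *)
Record closed_scheme (d : measure_display) (X : measurableType d)
    (cl : set (set X)) (C : nat -> nat -> set X) : Prop := ClosedScheme {
  cs_cell : forall n k, cl (C n k);
  cs_cover : forall n x, exists k, C n k x;
  cs_separated : forall (k l : nat -> nat) x y,
    (forall n, C n (k n) x) -> (forall n, C n (l n) y) ->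
    (forall n, C n (k n) `&` C n (l n) !=set0) -> x = y;
  cs_complete : forall (Z : nat -> set X) (k : nat -> nat),
    (forall n, cl (Z n)) ->
    (forall n, exists x, forall m, (m < n)%N -> Z m x /\ C m (k m) x) ->
    exists x, forall n, Z n x /\ C n (k n) x;
  cs_measurable : forall Z, cl Z -> measurable Z;
  cs_generated : forall P : set (set X), sigma_algebra setT P ->
    (forall Z, cl Z -> P Z) -> forall A, measurable A -> P A;
  cs_compl : forall Z, cl Z -> exists Y : nat -> set X,
    (forall n, cl (Y n)) /\ ~` Z = \bigcup_n Y n;
  cs_setT : cl setT }.

Section StandardScheme.
Context {R : realType} {d : measure_display} {X : measurableType d}.

(** The cells are the preimages of the closures of balls of radius [2 ^- n] around
    a countable dense set of the Polish space that [X] is isomorphic to. *)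
Lemma standard_borel_scheme : standard_borel R X ->
  exists cl C, @closed_scheme d X cl C.
Proof.
move=> [P [f [hP [D Dc Dd] [g gK fK] fM]]].
have [p0 Dp0] : D !=set0.
  have [|q [_ Dq]] := Dd setT _ openT; last by exists q.
  by exists (f point).
have [e eP] := countable_enum Dc (ex_intro _ p0 Dp0).
have [r [r0 rsmall]] : exists r : nat -> R, (forall n, 0 < r n) /\
    (forall eps : R, 0 < eps -> exists N, forall n, (N <= n)%N -> r n * 8 < eps).
  exists (fun n => 2 ^- n); split=> [n|eps e0]; first by rewrite invr_gt0 exprn_gt0.
  have e8 : 0 < eps / 8 by rewrite divr_gt0.
  have : (fun n => 2 ^- n) @ \oo --> (0 : R).
    under eq_fun do rewrite -exprVn.
    by apply: cvg_expr; rewrite ger0_norm ?invf_lt1 ?invr_ge0// ltr1n.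
  move=> /cvgrPdist_lt/(_ _ e8)[N _ HN]; exists N => n Nn.
  have := HN n Nn; rewrite /= sub0r normrN gtr0_norm ?invr_gt0 ?exprn_gt0// => h.
  by rewrite -ltr_pdivlMr.
have imf (Z : set P) : f @` (f @^-1` Z) = Z.
  apply/seteqP; split=> [_ [x Zx <-]//|p Zp].
  by exists (g p) => //=; rewrite fK.
pose B n k : set P := closure (ball (e k) (r n)).
have Bball n k p : B n k p -> ball (e k) (r n + r n) p.
  move=> /(_ (ball p (r n))) /(_ (nbhsx_ballx _ _ (r0 n))) [q [q1 q2]].
  by apply: ball_triangle q1 _; exact: ball_sym.
have BB n k p q : B n k p -> B n k q -> ball p ((r n + r n) + (r n + r n)) q.
  move=> /Bball/ball_sym Bp /Bball Bq.
  exact: ball_triangle Bp Bq.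
have Bcov n p : exists k, B n k p.
  have [|q [pq Dq]] := Dd (interior (ball p (r n))) _ (@open_interior _ _).
    by exists p; exact: nbhsx_ballx.
  have [k kq] := eP _ Dq; exists k; apply: subset_closure.
  by rewrite kq; apply: ball_sym; exact: interior_subset pq.
have haus (p q : P) : (forall eps : R, 0 < eps -> ball p eps q) -> p = q.
  move=> pq; apply: hP => U V /nbhs_ballP[a /= a0 aU] /nbhs_ballP[b /= b0 bV].
  exists q; split; [exact/aU/pq|exact/bV/ballxx].
exists [set Z | exists2 W : set P, closed W & Z = f @^-1` W].
exists (fun n k => f @^-1` B n k); split.
- by move=> n k; exists (B n k); first exact: closed_closure.
- by move=> n x; exact: Bcov.
- move=> k l x y Hx Hy Hxy; rewrite -(gK x) -(gK y); congr g.
  apply: haus => eps /rsmall[N /(_ N (leqnn N)) HN].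
  have [z [z1 z2]] := Hxy N.
  have := ball_triangle (BB _ _ _ _ (Hx N) z1) (BB _ _ _ _ z2 (Hy N)).
  by apply: le_ball; apply: ltW; apply: le_lt_trans HN; have := r0 N; lra.
- move=> Z k Zc H.
  have /choice[W WP] : forall n, exists W : set P, closed W /\ Z n = f @^-1` W.
    by move=> n; have [W Wc ->] := Zc n; exists W.
  have /choice[y yP] := H.
  have yB m n : (m < n)%N -> W m (f (y n)) /\ B m (k m) (f (y n)).
    by move=> mn; have [] := yP n m mn; rewrite (WP m).2.
  have yc : cvg ((fun n => f (y n)) @ \oo).
    apply: cauchy_cvg; apply: cauchy_exP => eps /rsmall[N /(_ N (leqnn N)) HN].
    exists (f (y N.+1)); exists N.+1 => // n /= Nn.
    apply: le_ball (BB N (k N) _ _ _ _); first by apply: ltW; apply: le_lt_trans HN; have := r0 N; lra.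
      by have [] := yB N N.+1 (ltnSn N).
    by have [] := yB N n Nn.
  exists (g (lim ((fun n => f (y n)) @ \oo))) => n; rewrite (WP n).2 /= fK.
  split.
    apply: (closed_cvg _ (WP n).1 _ _ yc).
    by exists n.+1 => // m /= nm; have [] := yB n m nm.
  apply: (@closed_cvg _ _ _ _ _ (B n (k n)) _ _ _ yc); first exact: closed_closure.
  by exists n.+1 => // m /= nm; have [] := yB n m nm.
- move=> Z [W Wc ->]; apply/fM; rewrite imf -(setCK W).
  have sa := smallest_sigma_algebra setT [set U : set P | open U].
  have [_ sD _] := sa; rewrite -setTD; apply: sD.
  by apply: sub_sigma_algebra; exact: closed_openC.
- move=> Q sQ clQ A /fM.
  suff H : <<s [set U : set P | open U] >> `<=` [set V | Q (f @^-1` V)].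
    move=> /H /=; congr Q; apply/seteqP; split=> [x [z Az /(can_inj gK) <-]//|x Ax].
    by exists x.
  have [Q0 QD QU] := sQ.
  apply: smallest_sub.
    split => /=; first by rewrite preimage_set0.
      by move=> V QV; exact: (QD _ QV).
    by move=> F QF; rewrite preimage_bigcup; exact: QU.
  move=> U /= Uo; rewrite -(setCK (f @^-1` U)) -setTD.
  apply: QD; apply: clQ; exists (~` U); first exact: open_closedC.
  by rewrite preimage_setC.
- move=> Z [W Wc ->].
  pose Y i : set X := if unpickle i is Some (n, k) then
    (if `[< B n k `<=` ~` W >] then f @^-1` B n k else f @^-1` set0) else f @^-1` set0.
  exists Y; split.
    move=> i; rewrite /Y; case: (unpickle i) => [[n k]|].
      case: ifP => _; first by exists (B n k); first exact: closed_closure.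
      by exists set0; first exact: closed0.
    by exists set0; first exact: closed0.
  apply/seteqP; split=> [x /= Wx|x [i _]].
    have /nbhs_ballP[eps /= e0 eW] : nbhs (f x) (~` W).
      by apply: open_nbhs_nbhs; split => //; exact: closed_openC.
    have [N /(_ N (leqnn N)) HN] := rsmall _ e0.
    have [k Bk] := Bcov N (f x).
    exists (pickle (N, k)) => //; rewrite /Y pickleK; case: ifPn => // /negP; case.
    apply/asboolP => q Bq; apply: eW; apply: le_ball (BB _ _ _ _ Bk Bq).
    by apply: ltW; apply: le_lt_trans HN; have := r0 N; lra.
  rewrite /Y; case: (unpickle i) => [[n k]|//].
  by case: ifPn => [/asboolP BW /BW|].
- by exists setT => //; exact: closedT.
Qed.

End StandardScheme.

(** * Measurable sets, probabilities and hulls *)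

Section MeasurableSets.
Context {d : measure_display} {X : measurableType d}.

Lemma measurable_exists (I : countType) (F : I -> set X) :
  (forall i, measurable (F i)) -> measurable [set x | exists i, F i x].
Proof.
move=> mF; rewrite (_ : [set x | _] = \bigcup_i F i).
  exact: countable_bigcupT_measurable.
by apply/seteqP; split=> [x [i Fi]|x [i _ Fi]]; exists i.
Qed.

Lemma measurable_forall (I : countType) (F : I -> set X) :
  (forall i, measurable (F i)) -> measurable [set x | forall i, F i x].
Proof.
move=> mF; rewrite (_ : [set x | _] = ~` [set x | exists i, (~` F i) x]).
  by apply: measurableC; apply: measurable_exists => i; exact: measurableC.
apply/seteqP; split=> x /= H; first by case=> i; apply; exact: H.
by move=> i; apply: contrapT => Fi; apply: H; exists i.
Qed.

Lemma measurable_imply (P : Prop) (A : set X) :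
  measurable A -> measurable [set x | P -> A x].
Proof.
move=> mA; have [p|np] := pselect P.
  rewrite (_ : [set x | _] = A)//.
  by apply/seteqP; split=> [x /(_ p)//|x Ax _].
rewrite (_ : [set x | _] = setT)//.
by apply/seteqP; split=> // x _ /np.
Qed.

Lemma measurable_fiber (T : countType) (f : X -> T) (P : set T) :
  (forall t, measurable [set x | f x = t]) -> measurable [set x | P (f x)].
Proof.
move=> mf; rewrite (_ : [set x | _] =
    [set x | exists t, ([set x | f x = t] `&` [set x | P t]) x]).
  apply: measurable_exists => t; apply: measurableI; first exact: mf.
  by have [p|p] := pselect (P t);
    [rewrite (_ : [set x | _] = setT)|rewrite (_ : [set x | _] = set0)];
    rewrite ?measurableT//; apply/seteqP; split.
by apply/seteqP; split=> [x /= Pf|x /= [t [-> //]]]; exists (f x).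
Qed.

(** Countable choice is measurable: take the first index that works. *)
Lemma measurable_select (T : countType) (t0 : T) (S : T -> set X) :
  (forall t, measurable (S t)) ->
  exists f : X -> T, (forall t, measurable [set x | f x = t]) /\
    forall x, (exists t, S t x) -> S (f x) x.
Proof.
move=> mS.
pose first t x := S t x /\ forall u, (pickle u < pickle t)%N -> ~ S u x.
have mfirst t : measurable (first t).
  rewrite (_ : first t = S t `&` [set x | forall u,
      [set x | (pickle u < pickle t)%N -> (~` S u) x] x])//.
  apply: measurableI => //; apply: measurable_forall => u.
  by apply: measurable_imply; exact: measurableC.
have first_uniq t u x : first t x -> first u x -> t = u.
  move=> [St Ht] [Su Hu].
  suff /(congr1 (@unpickle T)) : pickle t = pickle u by rewrite !pickleK => -[].
  have [tu|ut|//] := ltngtP (pickle t) (pickle u); first by case: (Hu t tu).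
  by case: (Ht u ut).
have first_ex x : (exists t, S t x) -> exists t, first t x.
  move=> [t St].
  have ex : exists n, `[< exists2 t, S t x & pickle t = n >].
    by exists (pickle t); apply/asboolP; exists t.
  case: (ex_minnP ex) => n /asboolP[u Su un] nmin.
  exists u; split=> // v vu Sv.
  have := nmin (pickle v); rewrite leqNgt -un vu => /(_ _)/negP; apply.
    by apply/asboolP; exists v.
  by [].
have /choice[f fP] : forall x, exists t,
    (first t x) \/ (~ (exists t, S t x) /\ t = t0).
  move=> x; have [/first_ex[t Ht]|n] := pselect (exists t, S t x).
    by exists t; left.
  by exists t0; right.
exists f; split=> [t|x [t St]]; last first.
  by case: (fP x) => [[]//|[]]; case; exists t.
rewrite (_ : [set x | _] = first t `|`
    (~` [set x | exists t, S t x] `&` [set x | t = t0])).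
  apply: measurableU => //; apply: measurableI.
    by apply: measurableC; exact: measurable_exists.
  have [->|tt] := eqVneq t t0.
    by rewrite (_ : [set x | _] = setT)//; apply/seteqP; split.
  by rewrite (_ : [set x | _] = set0)//; apply/seteqP; split=> // x /eqP; rewrite (negbTE tt).
apply/seteqP; split=> [x /= <-|x /=]; first by case: (fP x) => [|[]]; [left|right].
case=> [Ft|[nS tt]]; case: (fP x) => [Fx|[nS' fx]].
- exact: first_uniq Fx Ft.
- by case: nS'; case: Ft => St _; exists t.
- by case: nS; case: Fx => St _; exists (f x).
- by rewrite fx.
Qed.

End MeasurableSets.

Section RealProbability.
Context {R : realType} {d : measure_display} {X : measurableType d}.
Variable mu : probability X R.

Definition pr (A : set X) : R := fine (mu A).

Lemma prE A : measurable A -> mu A = (pr A)%:E.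
Proof. by move=> mA; rewrite /pr fineK// fin_num_measure. Qed.

Lemma pr_ge0 A : 0 <= pr A. Proof. by rewrite fine_ge0. Qed.

Lemma pr_le A B : measurable A -> measurable B -> A `<=` B -> pr A <= pr B.
Proof. by move=> mA mB AB; rewrite -lee_fin -!prE// le_measure ?inE. Qed.

Lemma prT : pr setT = 1. Proof. by rewrite /pr probability_setT. Qed.

Lemma pr0 : pr set0 = 0. Proof. by rewrite /pr measure0. Qed.

Lemma pr_le1 A : measurable A -> pr A <= 1.
Proof. by move=> mA; rewrite -prT; exact: pr_le. Qed.

Lemma prDI A B : measurable A -> measurable B ->
  pr A = pr (A `\` B) + pr (A `&` B).
Proof.
move=> mA mB; apply: EFin_inj; rewrite EFinD -!prE//; first exact: measureDI.
  exact: measurableI.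
exact: measurableD.
Qed.

Lemma prC A : measurable A -> pr (~` A) = 1 - pr A.
Proof.
move=> mA; rewrite -prT (prDI measurableT mA) setTD setTI; ring.
Qed.

Lemma pr_setU A B : measurable A -> measurable B ->
  pr (A `|` B) <= pr A + pr B.
Proof.
move=> mA mB; rewrite -lee_fin EFinD -!prE//; last exact: measurableU.
exact: measureU2.
Qed.

Lemma pr_eq0 A : measurable A -> pr A = 0 -> mu A = 0%E.
Proof. by move=> mA; rewrite prE// => ->. Qed.

Lemma ae_null A : measurable A -> mu A = 0%E -> {ae mu, forall x, ~ A x}.
Proof. by move=> mA A0; exists A; split=> // x /= /contrapT. Qed.

Lemma ae_pr0 A : measurable A -> pr A = 0 -> {ae mu, forall x, ~ A x}.
Proof. by move=> mA A0; apply: ae_null => //; exact: pr_eq0. Qed.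

Lemma pr_ae0 A : measurable A -> {ae mu, forall x, ~ A x} -> pr A = 0.
Proof.
move=> mA [N [mN N0 AN]]; rewrite /pr (_ : mu A = 0%E)//.
by apply: (subset_measure0 mA mN) => // x Ax; apply: AN => /=; apply.
Qed.

Lemma ae_forall_count (I : countType) (P : I -> X -> Prop) :
  (forall i, {ae mu, forall x, P i x}) -> {ae mu, forall x, forall i, P i x}.
Proof.
move=> H; have : {ae mu, forall x, forall n : nat,
    if unpickle n is Some i then P i x else True}.
  apply: ae_foralln => n; case: (unpickle n) => [i|]; first exact: H.
  exact: aeW.
by apply: filterS => x H' i; have := H' (pickle i); rewrite pickleK.
Qed.

Lemma pr_pos_ex A (P : X -> Prop) : measurable A -> 0 < pr A ->
  {ae mu, forall x, P x} -> exists2 x, A x & P x.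
Proof.
move=> mA A0 HP; apply: contrapT => nA; move: A0; rewrite pr_ae0// ?ltxx//.
by apply: filterS HP => x Px Ax; apply: nA; exists x.
Qed.

Lemma ae_set (P : X -> Prop) : {ae mu, forall x, P x} ->
  exists N, [/\ measurable N, pr N = 0 & forall x, ~ N x -> P x].
Proof.
move=> [N [mN N0 PN]]; exists N; split=> //; first by rewrite /pr N0.
by move=> x Nx; apply: contrapT => Px; exact/Nx/PN.
Qed.

(** The measurable hull of an arbitrary set, minimal up to null sets. *)
Definition is_hull (D H : set X) := [/\ measurable H, D `<=` H &
  forall B, measurable B -> D `<=` B -> {ae mu, forall x, H x -> B x}].

Definition outer (D : set X) : R :=
  inf [set pr B | B in [set B | measurable B /\ D `<=` B]].

Let has_inf_outer D : has_inf [set pr B | B in [set B | measurable B /\ D `<=` B]].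
Proof.
split; first by exists (pr setT), setT.
by exists 0 => _ [B _ <-]; exact: pr_ge0.
Qed.

Lemma outer_le D B : measurable B -> D `<=` B -> outer D <= pr B.
Proof. by move=> mB DB; apply: ge_inf; [exact: (has_inf_outer D).2|exists B]. Qed.

Lemma outer_mono D D' : D `<=` D' -> outer D <= outer D'.
Proof.
move=> DD'; apply: lb_le_inf; first exact: (has_inf_outer D').1.
by move=> _ [B [mB DB] <-]; apply: outer_le => //; exact: subset_trans DB.
Qed.

Lemma hull_exists D : exists H, is_hull D H /\ pr H = outer D.
Proof.
have /choice[B BP] : forall n, exists B, [/\ measurable B, D `<=` B &
    pr B < outer D + n.+1%:R^-1].
  move=> n; have n0 : 0 < n.+1%:R^-1 :> R by rewrite invr_gt0.
  by have [_ [B [mB DB] <-] lt] := inf_adherent n0 (has_inf_outer D); exists B.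
pose H := [set x | forall n, B n x].
have mH : measurable H by apply: measurable_forall => n; have [] := BP n.
have DH : D `<=` H by move=> x Dx n; have [_ DB _] := BP n; exact: DB.
have HE : pr H = outer D.
  apply/eqP; rewrite eq_le outer_le// andbT; apply/ler_addgt0Pr => e e0.
  have [n _ ne] : \forall n \near \oo, n.+1%:R^-1 < e :> R.
    by apply: (near_infty_natSinv_lt (PosNum e0)).
  have [mB _ lt] := BP n.
  apply: le_trans (pr_le mH mB _) _; first by move=> x; apply.
  by apply: (le_trans (ltW lt)); rewrite lerD2l ltW// ne/=.
exists H; split=> //; split=> // C mC DC.
have DHC : outer D <= pr (H `&` C).
  by apply: outer_le; [exact: measurableI|move=> x Dx; split; auto].
have := prDI mH mC; rewrite HE => E.
have : pr (H `\` C) = 0.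
  by apply/eqP; rewrite eq_le pr_ge0 andbT; lra.
move=> /ae_pr0; move=> /(_ (measurableD mH mC)); apply: filterS => x nHC Hx.
by apply: contrapT => nC; apply: nHC.
Qed.

End RealProbability.

(** * Souslin sets of the square *)

Lemma mkseqS_head (T : Type) (z : nat -> T) n :
  mkseq z n.+1 = z 0%N :: mkseq (fun m => z m.+1) n.
Proof. by rewrite /mkseq /= -[iota 1 n]/(iota (1 + 0) n) iotaDl -map_comp. Qed.

Lemma take_mkseq (T : Type) (z : nat -> T) m n : (m <= n)%N ->
  take m (mkseq z n) = mkseq z m.
Proof. by move=> mn; rewrite /mkseq -map_take take_iota (minn_idPl mn). Qed.

Lemma unbounded_injective (f : nat -> nat) : injective f ->
  forall B, exists n, (B <= f n)%N.
Proof.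
move=> fI B; apply: contrapT => H.
have lt n : (f n < B)%N by rewrite ltnNge; apply/negP => h; apply: H; exists n.
pose h (i : 'I_B.+1) : 'I_B := Ordinal (lt i).
have hI : injective h by move=> i j /(congr1 val) /fI /val_inj.
by have := leq_card _ hI; rewrite !card_ord ltnn.
Qed.

Section Souslin.
Context {d : measure_display} {X : measurableType d}.
Variables (cl : set (set X)) (C : nat -> nat -> set X).
Hypothesis CS : closed_scheme cl C.

(** The first factor is tested on measurable sets and the second one on closed sets.
    Completeness arguments are run in the second factor only, at a fixed first
    coordinate. *)
Definition souslin (E : set (X * X)) :=
  exists (A Z : seq nat -> set X),
    [/\ forall s, measurable (A s), forall s, cl (Z s) &
        forall p, E p <->
          exists z, forall n, A (mkseq z n) p.1 /\ Z (mkseq z n) p.2].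

Lemma souslin_rect A Z : measurable A -> cl Z -> souslin (A `*` Z).
Proof.
move=> mA cZ; exists (fun=> A), (fun=> Z); split=> // -[x y].
split=> [[Ax Zy]|[z /(_ 0%N)[]//]].
by exists (fun=> 0%N).
Qed.

Lemma souslin_bigcup (E : nat -> set (X * X)) :
  (forall i, souslin (E i)) -> souslin (\bigcup_i E i).
Proof.
move=> /choice[A /choice[Z H]].
exists (fun s => if s is i :: s' then A i s' else setT).
exists (fun s => if s is i :: s' then Z i s' else setT).
split.
- by case=> [|i s]; [exact: measurableT|case: (H i)].
- by case=> [|i s]; [exact: cs_setT CS|case: (H i)].
move=> p; split=> [[i _ /(proj1 (let: And3 _ _ h := H i in h p))[z Hz]]|[z Hz]].
  exists (fun m => if m is m'.+1 then z m' else i) => -[|n] //.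
  by rewrite mkseqS_head; exact: Hz.
exists (z 0%N) => //; have [_ _ h] := H (z 0%N); apply/h.
exists (fun m => z m.+1) => n.
by have := Hz n.+1; rewrite mkseqS_head.
Qed.

(** One code interleaves countably many codes. Level [M] of the interleaved
    scheme tests at most one condition, the one that [M] encodes, and only once
    the finite part of the code that this condition reads is available: thus no
    intersection of closed sets has to be formed. *)
Lemma souslin_bigcap (E : nat -> set (X * X)) :
  (forall i, souslin (E i)) -> souslin (\bigcap_i E i).
Proof.
move=> /choice[A /choice[Z H]].
pose part (s : seq nat) (i n : nat) := mkseq (fun j => nth 0%N s (pickle (i, j))) n.
pose ready (M i n : nat) := [forall j : 'I_n, (pickle (i, val j) < M)%N].
pose lift (F : nat -> seq nat -> set X) (s : seq nat) : set X :=
  if (unpickle (size s) : option (nat * nat * nat)) is Some (i, n, _) then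
    (if ready (size s) i n then F i (part s i n) else setT) else setT.
pose slice (z : nat -> nat) (i j : nat) := z (pickle (i, j)).
have partE z M i n : ready M i n -> part (mkseq z M) i n = mkseq (slice z i) n.
  move=> /forallP r; apply: (@eq_from_nth _ 0%N); rewrite !size_mkseq// => j jn.
  by rewrite !nth_mkseq//; exact: (r (Ordinal jn)).
have liftP (F : nat -> seq nat -> set X) z x :
    (forall M, lift F (mkseq z M) x) <-> forall i n, F i (mkseq (slice z i) n) x.
  split=> [Hl i n|HF M].
    have [K HK] : exists K : nat, (\max_(j < n) (pickle (i, val j)).+1 <=
        pickle (i, n, K))%N.
      have inj : injective (fun K : nat => pickle (i, n, K)).
        move=> K K'.
        by move=> /(congr1 (@unpickle (nat * nat * nat)%type)); rewrite !pickleK => -[].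
      exact: unbounded_injective inj _.
    have rdy : ready (pickle (i, n, K)) i n.
      apply/forallP => j; apply: leq_trans HK.
      by rewrite (bigD1 j)//= leq_maxl.
    have := Hl (pickle (i, n, K)).
    by rewrite /lift size_mkseq pickleK rdy partE.
  rewrite /lift size_mkseq; case: (unpickle M) => [[[i n] K]|//].
  by case: ifPn => // r; rewrite partE.
exists (lift A), (lift Z); split.
- move=> s; rewrite /lift; case: (unpickle _) => [[[i n] K]|//].
  by case: ifP => _; [case: (H i)|exact: measurableT].
- move=> s; rewrite /lift; case: (unpickle _) => [[[i n] K]|]; last exact: cs_setT CS.
  by case: ifP => _; [case: (H i)|exact: cs_setT CS].
move=> p; split=> [Ep|[z Hz] i _].
  have /choice[w Hw] : forall i, exists z, forall n,
      A i (mkseq z n) p.1 /\ Z i (mkseq z n) p.2.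
    by move=> i; have [_ _ h] := H i; apply/h; exact: Ep.
  pose z N := if (unpickle N : option (nat * nat)) is Some (i, j) then w i j else 0%N.
  have sz i : slice z i = w i by apply/funext => j; rewrite /slice /z pickleK.
  by exists z => n; split; move: n; apply/liftP => i n; rewrite sz; case: (Hw i n).
have [_ _ h] := H i; apply/h; exists (slice z i) => n; split.
  by have /liftP := fun M => (Hz M).1; apply.
by have /liftP := fun M => (Hz M).2; apply.
Qed.

(** The sets that are Souslin together with their complement form a sigma-algebra.
    It contains the rectangles: the complement of a closed set is a countable union
    of closed sets. *)
Lemma souslin_measurable (E : set (X * X)) : measurable E -> souslin E.
Proof.
pose S E := souslin E /\ souslin (~` E).
have S_sigma : sigma_algebra setT S.
  have S0 : souslin set0.
    rewrite (_ : set0 = set0 `*` setT); last by rewrite set0X.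
    by apply: souslin_rect => //; exact: cs_setT CS.
  have ST : souslin setT.
    rewrite -setXTT; apply: souslin_rect; [exact: measurableT|exact: cs_setT CS].
  split; first by split; rewrite ?setC0.
    by move=> B [B1 B2]; rewrite setTD; split=> //; rewrite setCK.
  move=> F SF; split; first by apply: souslin_bigcup => i; case: (SF i).
  by rewrite setC_bigcup; apply: souslin_bigcap => i; case: (SF i).
suff : g_sigma_preimageU (@fst X X) (@snd X X) `<=` S by move=> /(_ E) h /h[].
apply: smallest_sub => // B [[A mA <-]|[A mA <-]]; rewrite setTI.
  have e (A' : set X) : fst @^-1` A' = A' `*` (setT : set X).
    by apply/seteqP; split=> [] [x y] //= [].
  split; first by rewrite e; apply: souslin_rect => //; exact: cs_setT CS.
  by rewrite preimage_setC e; apply: souslin_rect; [exact: measurableC|exact: cs_setT CS].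
apply: (cs_generated CS (P := [set A | S (snd @^-1` A)])) mA.
  have [s0 sD sU] := S_sigma; split => /=; first by rewrite preimage_set0.
    by move=> V SV; exact: (sD _ SV).
  by move=> F SF; rewrite preimage_bigcup; exact: sU.
have e (A' : set X) : snd @^-1` A' = (setT : set X) `*` A'.
  by apply/seteqP; split=> [] [x y] //= [].
move=> Z cZ /=; split; first by rewrite e; exact: souslin_rect.
have [Y [cY YE]] := cs_compl CS cZ.
rewrite preimage_setC YE preimage_bigcup; apply: souslin_bigcup => i.
by rewrite e; exact: souslin_rect.
Qed.

End Souslin.

(** * Uniformization of sets with countable sections *)

Lemma chain_branch (T : Type) (t : nat -> seq T) :
  (forall n, exists2 u, u <> [::] & t n.+1 = t n ++ u) ->
  exists z : nat -> T, forall n,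
    (n <= size (t n))%N /\ t n = mkseq z (size (t n)).
Proof.
move=> step.
have size_gt n : (n <= size (t n))%N.
  elim: n => // n IH; have [u u0 ->] := step n; rewrite size_cat.
  by case: u u0 => // a u _ /=; rewrite addnS ltnS (leq_trans IH)// leq_addr.
have prefix m n : (m <= n)%N -> exists u, t n = t m ++ u.
  elim: n => [|n IH]; first by rewrite leqn0 => /eqP ->; exists [::]; rewrite cats0.
  rewrite leq_eqVlt => /predU1P[->|]; first by exists [::]; rewrite cats0.
  rewrite ltnS => /IH[u tu]; have [v _ ->] := step n.
  by exists (u ++ v); rewrite tu catA.
have [a _] : exists a : T, True.
  have [u u0 _] := step 0%N.
  by case: u u0 => // a u _; exists a.
exists (fun i => nth a (t i.+1) i) => n; split=> //.
apply: (@eq_from_nth _ a); first by rewrite size_mkseq.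
move=> i it.
rewrite nth_mkseq//; have [ni|ni] := leqP n i.+1.
  by have [u ->] := prefix _ _ ni; rewrite nth_cat it.
by have [u ->] := prefix _ _ (ltnW ni); rewrite nth_cat size_gt.
Qed.

Section Uniformization.
Context {R : realType} {d : measure_display} {X : measurableType d}.
Variables (mu : probability X R) (cl : set (set X)) (C : nat -> nat -> set X).
Hypothesis CS : closed_scheme cl C.
Variables A Z : seq nat -> set X.
Hypothesis mA : forall s, measurable (A s).
Hypothesis cZ : forall s, cl (Z s).

Local Notation node := (seq (nat * nat)).
Local Notation fsts := (map (@fst nat nat)).

(** A code of [(x, y)] records a branch of the Souslin scheme through the pair and
    the cells that locate [y]. The prefix of length [n] is tested, hence a node [s]
    tests its proper prefixes as well. *)
Definition codes (x y : X) (z : nat -> nat * nat) := forall n,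
  [/\ A (fsts (mkseq z n)) x, Z (fsts (mkseq z n)) y & C n (z n).2 y].

(** The first coordinates at which the maps [G i] fail to exhaust the points
    coded through the node [s]. *)
Definition missed (G : nat -> X -> X) (s : node) : set X :=
  [set x | exists z y, [/\ mkseq z (size s) = s, codes x y z &
                           forall i, G i x <> y]].

Definition conflict (s t : node) := exists n,
  [/\ (n < size s)%N, (n < size t)%N &
      C n (nth (0, 0)%N s n).2 `&` C n (nth (0, 0)%N t n).2 = set0].

Lemma missed_cat G s u : missed G (s ++ u) `<=` missed G s.
Proof.
move=> x [z [y [zs W Gy]]]; exists z, y; split=> //.
have /(congr1 (take (size s))) := zs.
by rewrite take_mkseq ?size_cat ?leq_addr// take_size_cat.
Qed.

Lemma missed_sub G s n : missed G s `<=` A (fsts (take n s)).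
Proof.
move=> x [z [y [<- W _]]].
have [ns|/ltnW ns] := leqP n (size s).
  by rewrite take_mkseq//; case: (W n).
by rewrite take_oversize ?size_mkseq//; case: (W (size s)).
Qed.

Lemma missed_rcons G s x : missed G s x -> exists a, missed G (rcons s a) x.
Proof.
move=> [z [y [zs W Gy]]]; exists (z (size s)), z, y; split=> //.
by rewrite size_rcons mkseqS zs.
Qed.

Lemma missed_closed G s x : missed G s x -> exists y, forall n,
  Z (fsts (take n s)) y /\ ((n < size s)%N -> C n (nth (0, 0)%N s n).2 y).
Proof.
move=> [z [y [<- W _]]]; exists y => n; split=> [|ns].
  have [ns|/ltnW ns] := leqP n (size s).
    by rewrite take_mkseq//; case: (W n).
  by rewrite take_oversize ?size_mkseq//; case: (W (size s)).
rewrite size_mkseq in ns.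
by rewrite nth_mkseq//; case: (W n).
Qed.

Definition refines (G G' : nat -> X -> X) := forall i, exists j, G i = G' j.

Lemma missed_refines G G' s : refines G G' -> missed G' s `<=` missed G s.
Proof.
move=> GG' x [z [y [zs W Gy]]]; exists z, y; split=> // i.
by have [j ->] := GG' i; exact: Gy.
Qed.

Local Notation mfuns G := (forall i, measurable_fun setT (G i : X -> X)).

(** Countably many minimising families can be merged into one, since enlarging the
    family only shrinks the missed sets. *)
Lemma minimal_missed : exists2 G : nat -> X -> X, mfuns G &
  forall s G', mfuns G' -> refines G G' ->
    outer mu (missed G s) <= outer mu (missed G' s).
Proof.
pose V s := [set outer mu (missed G s) | G in [set G | mfuns G]].
have infV s : has_inf (V s).
  split; first by exists (outer mu (missed (fun=> id) s)), (fun=> id).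
  exists 0 => _ [G _ <-]; have [H [_ <-]] := hull_exists mu (missed G s).
  exact: pr_ge0.
have /choice[F FP] : forall sk : node * nat, exists G : nat -> X -> X, mfuns G /\
    outer mu (missed G sk.1) < inf (V sk.1) + sk.2.+1%:R^-1.
  move=> [s k] /=; have k0 : 0 < k.+1%:R^-1 :> R by rewrite invr_gt0.
  by have [_ [G mG <-] lt] := inf_adherent k0 (infV s); exists G.
pose G n : X -> X := if (unpickle n : option (node * nat * nat)) is Some (sk, j)
  then F sk j else id.
exists G; first by move=> i; rewrite /G; case: unpickle => [[sk j]|];
  [exact: (FP sk).1|exact: measurable_id].
move=> s G' mG' _; apply: (@le_trans _ _ (inf (V s))); last first.
  by apply: ge_inf; [exact: (infV s).2|exists G'].
apply/ler_addgt0Pr => e e0.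
have [n _ ne] : \forall n \near \oo, n.+1%:R^-1 < e :> R.
  by apply: (near_infty_natSinv_lt (PosNum e0)).
apply: (@le_trans _ _ (outer mu (missed (F (s, n)) s))).
  apply: outer_mono; apply: missed_refines => j; exists (pickle (s, n, j)).
  by rewrite /G pickleK.
by apply: (le_trans (ltW (FP (s, n)).2)); rewrite lerD2l ltW// ne/=.
Qed.

(** An infinite branch through the tree of hulls codes a point: the closed sets and
    cells along the branch have the finite intersection property, because every
    node of the branch is missed by [G] somewhere, though not necessarily over
    [x]. *)
Lemma branch_point (H : node -> set X) G x z n0 :
  (forall s n, H s x -> A (fsts (take n s)) x) ->
  (forall s, H s x -> missed G s !=set0) ->
  (forall n, (n0 <= n)%N -> H (mkseq z n) x) -> exists y, codes x y z.
Proof.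
move=> HA Hne Hz.
have Ax n : A (fsts (mkseq z n)) x.
  have := HA _ n (Hz (maxn n0 n) (leq_maxl _ _)).
  by rewrite take_mkseq// leq_maxr.
have [y Hy] : exists y, forall n, Z (fsts (mkseq z n)) y /\ C n (z n).2 y.
  apply: (cs_complete CS) => n; first exact: cZ.
  have [x' Hx'] := Hne _ (Hz (maxn n0 n) (leq_maxl _ _)).
  have [y Hy] := missed_closed Hx'; exists y => m mn.
  have mM : (m < maxn n0 n)%N by rewrite (leq_trans mn)// leq_maxr.
  have := Hy m; rewrite size_mkseq take_mkseq ?(ltnW mM)// nth_mkseq//.
  by case=> ? /(_ mM).
by exists y => n; have [] := Hy n.
Qed.

Lemma codes_conflict x x' y y' z z' : codes x y z -> codes x' y' z' -> y <> y' ->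
  exists n, C n (z n).2 `&` C n (z' n).2 = set0.
Proof.
move=> W W' yy'; apply: contrapT => H; apply: yy'.
apply: (cs_separated CS (k := fun n => (z n).2) (l := fun n => (z' n).2)).
- by move=> n; case: (W n).
- by move=> n; case: (W' n).
by move=> n; apply/set0P/eqP => e; apply: H; exists n.
Qed.

(** Below almost every node of the tree of hulls there are two conflicting
    nodes: otherwise, on a set of positive measure, all branches below [s] code
    one and the same point, which depends measurably on [x]; adding this map to
    the family [G] would decrease the hull. *)
Lemma hull_splits G (H : node -> set X) : mfuns G ->
  (forall s G', mfuns G' -> refines G G' ->
    outer mu (missed G s) <= outer mu (missed G' s)) ->
  (forall s, is_hull mu (missed G s) (H s) /\ pr mu (H s) = outer mu (missed G s)) ->
  {ae mu, forall x, [/\ forall s u, H (s ++ u) x -> H s x,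
    forall s n, H s x -> A (fsts (take n s)) x,
    forall s, H s x -> missed G s !=set0 &
    forall s, H s x -> exists a, H (rcons s a) x]} ->
  forall s, {ae mu, forall x, H s x -> exists t u,
    [/\ t <> [::], u <> [::], H (s ++ t) x, H (s ++ u) x &
        conflict (s ++ t) (s ++ u)]}.
Proof.
move=> mG Gmin HH /ae_set[N [mN N0 good]] s.
have mH t : measurable (H t) by have [[]] := HH t.
have HD t : missed G t `<=` H t by have [[]] := HH t.
pose B := H s `&` ~` N `&` [set x | forall tu : node * node,
  [set x | [/\ tu.1 <> [::], tu.2 <> [::] & conflict (s ++ tu.1) (s ++ tu.2)] ->
    (~` (H (s ++ tu.1) `&` H (s ++ tu.2))) x] x].
have mB : measurable B.
  apply: measurableI; first by apply: measurableI => //; exact: measurableC.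
  apply: measurable_forall => tu; apply: measurable_imply.
  by apply: measurableC; exact: measurableI.
suff B0 : pr mu B = 0.
  have := ae_pr0 mB B0; have := ae_pr0 mN N0.
  apply: filterS2 => x Nx Bx Hx; apply: contrapT => nt; apply: Bx.
  split=> // -[t u] [/= t0 u0 tu] [Ht Hu]; apply: nt.
  by exists t, u.
apply/eqP; rewrite eq_le pr_ge0 andbT leNgt; apply/negP => Bpos.
(* Following the first child that is available over [x] leads to a branch below
   [s], hence to a point [y x] of the section. Over [B] any two branches below [s]
   are free of conflicts, so [y x] is the only missed point below [s]. *)
have /choice[next nextP] : forall t : node, exists f : X -> nat * nat,
    (forall a, measurable [set x | f x = a]) /\
    forall x, (exists a, H (rcons t a) x) -> H (rcons t (f x)) x.
  by move=> t; apply: (measurable_select (0, 0)%N (S := fun a => H (rcons t a))).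
pose fix nd (x : X) (n : nat) : node :=
  if n is m.+1 then rcons (nd x m) (next (nd x m) x) else s.
have mnd n t : measurable [set x | nd x n = t].
  elim: n t => [|n IH] t.
    have [->|st] := eqVneq t s.
      rewrite (_ : [set x | _] = setT)//.
      by apply/seteqP; split.
    rewrite (_ : [set x | _] = set0)//; apply/seteqP; split=> // x /= st'.
    by rewrite -st' eqxx in st.
  rewrite (_ : [set x | _] = [set x | exists t', ([set x | nd x n = t'] `&`
     [set x | (fun a => rcons t' a = t) (next t' x)]) x]).
    apply: measurable_exists => t'; apply: measurableI => //.
    exact: (measurable_fiber (fun a => rcons t' a = t) (nextP t').1).
  apply/seteqP; split=> [x /= <-|x /= [t' [-> //]]].
  by exists (nd x n).
have Hnd x n : B x -> H (nd x n) x.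
  move=> [[Hs Nx] _]; have [_ _ _ Hr] := good _ Nx.
  elim: n => //= n IH; apply: (nextP (nd x n)).2; exact: Hr.
have Bz x : exists z, forall n, nd x n = mkseq z (size (nd x n)).
  have [n|z zP] := @chain_branch _ (nd x); last by exists z => n; case: (zP n).
  by exists [:: next (nd x n) x] => //=; rewrite cats1.
have size_nd x n : size (nd x n) = (size s + n)%N.
  by elim: n => [|n IH] /=; rewrite ?addn0// size_rcons IH addnS.
have /choice[yy yyP] : forall x, exists y, B x -> exists z,
    [/\ forall n, nd x n = mkseq z (size (nd x n)), codes x y z &
        forall n, (size s <= n)%N -> H (mkseq z n) x].
  move=> x; have [Bx|] := pselect (B x); last by exists x.
  have [z zP] := Bz x.
  have Hz n : (size s <= n)%N -> H (mkseq z n) x.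
    move=> sn; have := Hnd x (n - size s)%N Bx.
    by rewrite zP size_nd subnKC.
  have [[_ Nx] _] := Bx; have [_ HA Hne _] := good _ Nx.
  by have [y Wy] := branch_point HA Hne Hz; exists y => _; exists z.
pose y x := if `[< B x >] then yy x else x.
have my : measurable_fun setT y.
  move=> _ A' mA'; rewrite setTI.
  apply: (cs_generated CS (P := [set A' | measurable (y @^-1` A')])) mA'.
    split=> /=; first by rewrite preimage_set0.
      by move=> V mV; rewrite setTD preimage_setC; exact: measurableC.
    by move=> F mF; rewrite preimage_bigcup; exact: bigcupT_measurable.
  move=> W cW /=.
  pose Good (t : node) := exists2 w, W w &
    forall m, (m < size t)%N -> C m (nth (0, 0)%N t m).2 w.
  rewrite (_ : _ @^-1` _ = (~` B `&` W) `|`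
      (B `&` [set x | forall n, [set x | Good (nd x n)] x])); last first.
    apply/seteqP; split=> [x /=|x /=].
      rewrite /y; case: asboolP => Bx Wy; last by left.
      right; split=> // n; exists (yy x) => // m.
      have [z [zP Wz _]] := yyP x Bx.
      rewrite zP size_mkseq => mn; rewrite nth_mkseq//.
      by case: (Wz m).
    rewrite /y; case: asboolP => Bx; last by case=> [[]//|[]].
    case=> [[]//|[_ HG]].
    have [z [zP Wz _]] := yyP x Bx.
    have [w Hw] : exists w, forall n : nat, W w /\ C n (z n).2 w.
      apply: (cs_complete CS (Z := fun=> W)) => // n.
      have [w Ww Cw] := HG n; exists w => m mn; split=> //.
      have mN' : (m < size (nd x n))%N by rewrite size_nd (leq_trans mn)// leq_addl.
      by have := Cw m mN'; rewrite zP nth_mkseq.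
    suff -> : yy x = w by case: (Hw 0%N).
    apply: (cs_separated CS (k := fun n => (z n).2) (l := fun n => (z n).2)).
    - by move=> n; case: (Wz n).
    - by move=> n; case: (Hw n).
    by move=> n; exists w; split; case: (Hw n).
  apply: measurableU; apply: measurableI => //.
  - exact: measurableC.
  - exact: (cs_measurable CS).
  - by apply: measurable_forall => n; exact: (measurable_fiber Good (mnd n)).
pose G' i := if i is j.+1 then G j else y.
have mG' : mfuns G' by case.
have : outer mu (missed G s) <= outer mu (missed G' s).
  by apply: Gmin => // i; exists i.+1.
apply/negP; rewrite -ltNge.
have sub : missed G' s `<=` H s `\` B.
  move=> x [z' [y' [z's Wy' Gy']]]; split.
    by apply: HD; exists z', y'; split=> // i; exact: (Gy' i.+1).
  move=> Bx; apply: (Gy' 0%N) => /=; rewrite /y asboolT//.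
  apply: contrapT => yy'; have [z [zP Wz Hz]] := yyP x Bx.
  have [n Cn] := codes_conflict Wz Wy' yy'.
  pose M := maxn n.+1 (size s).+1.
  have Hz' : H (mkseq z' M) x.
    apply: HD; exists z', y'; split=> //; first by rewrite size_mkseq.
    by move=> i; exact: (Gy' i.+1).
  have sM : (size s <= M)%N by rewrite /M (leq_trans (leqnSn _))// leq_maxr.
  have split_node (w : nat -> nat * nat) : mkseq w (size s) = s ->
      exists2 t, t <> [::] & mkseq w M = s ++ t.
    move=> ws; exists (drop (size s) (mkseq w M)).
      move/(congr1 size); rewrite size_drop size_mkseq => /eqP.
      by rewrite subn_eq0 leqNgt => /negP; apply; rewrite leq_maxr.
    by rewrite -{1}(cat_take_drop (size s) (mkseq w M)) take_mkseq// ws.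
  have [t t0 tE] := split_node z' z's.
  have [u u0 uE] : exists2 u, u <> [::] & mkseq z M = s ++ u.
    by apply: split_node; have := zP 0%N.
  have [_ /(_ (u, t))] := Bx; apply => /=; last first.
    by rewrite -tE -uE; split=> //; exact: Hz.
  split=> //; rewrite -tE -uE; exists n; rewrite !size_mkseq.
  have nM : (n < M)%N by rewrite leq_maxl.
  by rewrite nM !nth_mkseq.
apply: (le_lt_trans (outer_le mu (measurableD (mH s) mB) sub)).
rewrite -(HH s).2 (prDI mu (mH s) mB) (_ : H s `&` B = B) ?ltrDl//.
by apply/seteqP; split=> [x []//|x Bx]; split=> //; case: Bx => -[].
Qed.

(** At a point where the tree of hulls is not empty, conflicting nodes allow to
    diagonalise: the branch leaves, step by step, the cells of each point of an
    enumeration of the section, yet it codes a point of the section. *)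
Lemma scheme_uniformization :
  {ae mu, forall x, countable [set y | exists z, codes x y z]} ->
  exists2 G : nat -> X -> X, mfuns G &
    {ae mu, forall x, forall y z, codes x y z -> exists i, G i x = y}.
Proof.
move=> ctble; have [G mG Gmin] := minimal_missed.
have /choice[H HH] : forall s, exists H, is_hull mu (missed G s) H /\
    pr mu H = outer mu (missed G s).
  by move=> s; exact: hull_exists.
have mH t : measurable (H t) by have [[]] := HH t.
have HD t : missed G t `<=` H t by have [[]] := HH t.
have Hmin s B : measurable B -> missed G s `<=` B -> {ae mu, forall x, H s x -> B x}.
  by have [[_ _ h] _] := HH s; exact: h.
have good : {ae mu, forall x, [/\ forall s u, H (s ++ u) x -> H s x,
    forall s n, H s x -> A (fsts (take n s)) x,
    forall s, H s x -> missed G s !=set0 &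
    forall s, H s x -> exists a, H (rcons s a) x]}.
  have g1 : {ae mu, forall x, forall su : node * node, H (su.1 ++ su.2) x -> H su.1 x}.
    apply: ae_forall_count => -[s u] /=; apply: Hmin => //.
    exact: subset_trans (@missed_cat G s u) (HD s).
  have g2 : {ae mu, forall x, forall sn : node * nat,
      H sn.1 x -> A (fsts (take sn.2 sn.1)) x}.
    apply: ae_forall_count => -[s n] /=; apply: Hmin; [exact: mA|exact: missed_sub].
  have g3 : {ae mu, forall x, forall s, H s x -> missed G s !=set0}.
    apply: ae_forall_count => s.
    have [[w Gw]|G0] := pselect (missed G s !=set0).
      by apply: aeW => x _; exists w.
    have s0 : missed G s `<=` set0 by move=> w Gw; apply: G0; exists w.
    by apply: filterS (Hmin _ _ measurable0 s0) => x h /h.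
  have g4 : {ae mu, forall x, forall s, H s x -> exists a, H (rcons s a) x}.
    apply: ae_forall_count => s.
    apply: (Hmin s [set x | exists a, H (rcons s a) x]).
      exact: measurable_exists.
    by move=> x /missed_rcons[a Ga]; exists a; exact: HD.
  apply: filterS (filterI (filterI g1 g2) (filterI g3 g4)) => x [[h1 h2] [h3 h4]]; split=> //.
    by move=> s u; exact: (h1 (s, u)).
  by move=> s n; exact: (h2 (s, n)).
have splits : {ae mu, forall x, forall s, H s x -> exists t u,
    [/\ t <> [::], u <> [::], H (s ++ t) x, H (s ++ u) x &
        conflict (s ++ t) (s ++ u)]}.
  by apply: ae_forall_count => s; exact: hull_splits HH good s.
have H0 : {ae mu, forall x, ~ H [::] x}.
  apply: filterS (filterI good (filterI splits ctble)) => x [[Hpre HA Hne _] [Hsplit Hc]] H0.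
  set E := [set y | _] in Hc.
  have [e eP] : exists e : nat -> X, forall a, E a -> exists n, e n = a.
    have [En0|En0] := pselect (E !=set0); first exact: countable_enum.
    by exists (fun=> x) => a Ea; case: En0; exists a.
  have /choice[step stepP] : forall nt : nat * node, exists u, H nt.2 x ->
      [/\ u <> [::], H (nt.2 ++ u) x & ~ forall m, (m < size (nt.2 ++ u))%N ->
        C m (nth (0, 0)%N (nt.2 ++ u) m).2 (e nt.1)].
    move=> [n t] /=; have [Ht|] := pselect (H t x); last by exists [::].
    have [u [v [u0 v0 Hu Hv [m [mu' mv cm]]]]] := Hsplit _ Ht.
    have [Cu|nCu] := pselect (C m (nth (0, 0)%N (t ++ u) m).2 (e n)).
      exists v => _; split=> // /(_ m mv) Cv.
      by have : set0 (e n) by rewrite -cm.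
    by exists u => _; split=> // /(_ m mu').
  pose fix t n : node := if n is m.+1 then t m ++ step (m, t m) else [::].
  have Ht n : H (t n) x.
    by elim: n => //= n IH; have [_ h _] := stepP (n, t n) IH.
  have [n|z zP] := @chain_branch _ t.
    by exists (step (n, t n)) => //; have [h _ _] := stepP (n, t n) (Ht n).
  have Hz n : H (mkseq z n) x.
    have [nt tE] := zP n; have := Ht n; rewrite tE.
    rewrite -(cat_take_drop n (mkseq z _)) take_mkseq//; exact: Hpre.
  have [y Wy] := branch_point (n0 := 0%N) HA Hne (fun n _ => Hz n).
  have [n en] := eP y (ex_intro _ z Wy).
  have [_ _] := stepP (n, t n) (Ht n); apply => m /=.
  rewrite -/(t n.+1) (zP n.+1).2 size_mkseq => mt.
  by rewrite nth_mkseq// en; case: (Wy m).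
exists G => //; apply: filterS H0 => x Hx y z W; apply: contrapT => nG; apply: Hx.
by apply: HD; exists z, y; split=> // i Giy; apply: nG; exists i.
Qed.

End Uniformization.

Section LusinNovikov.
Context {R : realType} {d : measure_display} {X : measurableType d}.
Variables (mu : probability X R).
Hypothesis X_standard : standard_borel R X.

(** Lusin-Novikov up to a null set. *)
Lemma uniformization_ae (E : set (X * X)) : measurable E ->
  {ae mu, forall x, countable (xsection E x)} ->
  exists2 G : nat -> X -> X, (forall i, measurable_fun setT (G i)) &
    {ae mu, forall x, forall y, E (x, y) -> exists i, G i x = y}.
Proof.
move=> mE ctble; have [cl [C CS]] := standard_borel_scheme X_standard.
have [A [Z [mA cZ EP]]] := souslin_measurable CS mE.
have codeE x y : E (x, y) <-> exists z, codes C A Z x y z.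
  split=> [/EP[z Hz]|[z Hz]].
    have /choice[k kP] : forall n, exists k, C n k y by move=> n; exact: cs_cover CS n y.
    exists (fun n => (z n, k n)) => n.
    have -> : map fst (mkseq (fun n => (z n, k n)) n) = mkseq z n.
      by rewrite /mkseq -map_comp; apply: eq_map.
    by have [] := Hz n; split.
  apply/EP; exists (fun n => (z n).1) => n; have [h1 h2 _] := Hz n.
  have -> : mkseq (fun n => (z n).1) n = map fst (mkseq z n).
    by rewrite /mkseq -map_comp; apply: eq_map.
  by [].
have [|G mG GP] := @scheme_uniformization _ _ _ mu _ _ CS _ _ mA cZ.
  apply: filterS ctble => x; congr countable.
  by apply/seteqP; split=> y /=; rewrite /xsection /= inE => /codeE.
exists G => //; apply: filterS GP => x H y /codeE[z]; exact: H.
Qed.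

(** Equality is decided by the countably many cells. *)
Lemma measurable_graph (f g : X -> X) : measurable_fun setT f ->
  measurable_fun setT g -> measurable [set x | f x = g x].
Proof.
move=> mf mg; have [cl [C CS]] := standard_borel_scheme X_standard.
rewrite (_ : [set x | _] = [set x | forall nk : nat * nat,
  (~` (f @^-1` C nk.1 nk.2) `|` (g @^-1` C nk.1 nk.2)) x]).
  apply: measurable_forall => -[n k] /=; have mC := cs_measurable CS (cs_cell CS n k).
  apply: measurableU; first apply: measurableC.
    by rewrite -[X in measurable X]setTI; exact: mf.
  by rewrite -[X in measurable X]setTI; exact: mg.
apply/seteqP; split=> [x /= fg [n k] /=|x /= H].
  by rewrite -fg; have [|] := pselect (C n k (f x)); [right|left].
have /choice[k kP] : forall n, exists k, C n k (f x) by move=> n; exact: cs_cover CS n (f x).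
apply: (cs_separated CS (k := k) (l := k)) => // n; first by case: (H (n, k n)) => // /(_ (kP n)).
by exists (f x).
Qed.

Lemma separating_sets : exists2 U : nat -> set X, forall n, measurable (U n) &
  forall x y, x <> y -> exists n, U n x /\ ~ U n y.
Proof.
have [cl [C CS]] := standard_borel_scheme X_standard.
pose U n := if (unpickle n : option (nat * nat)) is Some (i, j) then C i j else set0.
exists U => [n|x y xy].
  by rewrite /U; case: unpickle => [[i j]|//]; exact: (cs_measurable CS (cs_cell CS i j)).
have /choice[k kP] : forall n, exists k, C n k x by move=> n; exact: cs_cover CS n x.
apply: contrapT => H; apply: xy.
apply: (cs_separated CS (k := k) (l := k)) => // n; last by exists x.
apply: contrapT => Cy; apply: H; exists (pickle (n, k n)).
by rewrite /U pickleK.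
Qed.

End LusinNovikov.

(** * The full group of a measure preserving relation *)

Import HBSimple HBNNSimple.

Section LowerIntegral.
Import finmap.
Context {R : realType} {d : measure_display} {X : measurableType d}.
Variable mu : probability X R.
Local Open Scope ereal_scope.

(** The integral of a nonnegative function is a supremum over simple functions
    below it, so its monotonicity requires no measurability. *)
Lemma ae_le_integral (f g : X -> \bar R) : (forall x, 0 <= f x) ->
  (forall x, 0 <= g x) -> {ae mu, forall x, f x <= g x} ->
  \int[mu]_x f x <= \int[mu]_x g x.
Proof.
move=> f0 g0 [N [mN N0 HN]].
rewrite ge0_integralTE// [X in _ <= X]ge0_integralTE//.
apply: ub_ereal_sup => _ [h hf <-].
have mNC := measurableC mN.
pose k : {nnsfun X >-> R} := mul_nnsfun h (indic_nnsfun R mNC).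
have kE x : k x = (h x * \1_(~` N) x)%R by [].
apply: (@le_trans _ _ (sintegral mu k)); last first.
  apply: ereal_sup_ubound; exists k => // x.
  have -> : k x = (h x * \1_(~` N) x)%R by exact: kE.
  have [Nx|Nx] := pselect (N x).
    by rewrite indicE memNset ?mulr0.
  rewrite indicE mem_set// mulr1; apply: (le_trans (hf x)).
  by apply: contrapT => H; apply: Nx; exact: HN.
rewrite -!integralT_nnsfun le_eqVlt; apply/orP; left; apply/eqP.
apply: ge0_ae_eq_integral => //.
- by apply/measurable_EFinP; exact: measurable_funPT.
- by apply/measurable_EFinP; exact: measurable_funPT.
- by move=> x _; rewrite lee_fin; exact: fun_ge0.
- by move=> x _; rewrite lee_fin; exact: fun_ge0.
exists N; split=> // x /= H; apply: contrapT => Nx; apply: H => _.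
have kh : k x = h x by apply: (etrans (kE x)); rewrite indicE mem_set// mulr1.
exact: (congr1 EFin (esym kh)).
Qed.

Lemma counting_ge0 (A : set X) : 0 <= counting A :> \bar R.
Proof. by rewrite /counting; case: ifPn; rewrite ?lee_fin. Qed.

Lemma counting_set0 : counting (set0 : set X) = 0 :> \bar R.
Proof. by rewrite /counting asboolT// fset_set0. Qed.

Lemma counting_set1 (x : X) : counting [set x] = 1 :> \bar R.
Proof. by rewrite /counting asboolT// fset_set1 cardfs1. Qed.

Lemma integral_prob_indic (A : set X) : measurable A ->
  \int[mu]_x (\1_A x)%:E = mu A.
Proof. by move=> mA; rewrite integral_indic// setIT. Qed.

End LowerIntegral.

Section FullGroup.
Context {R : realType} {d : measure_display} {X : measurableType d}.
Variables (mu : probability X R) (Rel : set (X * X)).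
Hypothesis X_standard : standard_borel R X.
Hypothesis Rel_equivalence : borel_equivalence Rel.
Hypothesis Rel_discrete : discrete mu Rel.
Hypothesis Rel_pmp : measure_preserving mu Rel.

Let mRel : measurable Rel := Rel_equivalence.1.

Lemma Rel_refl x : Rel (x, x).
Proof. by have [_ [h _ _]] := Rel_equivalence; exact: h. Qed.
Lemma Rel_sym x y : Rel (x, y) -> Rel (y, x).
Proof. by have [_ [_ h _]] := Rel_equivalence; exact: h. Qed.
Lemma Rel_trans x y z : Rel (x, y) -> Rel (y, z) -> Rel (x, z).
Proof. by have [_ [_ _ h]] := Rel_equivalence; exact: h. Qed.

Lemma measurable_preim (Y : set X) (f : X -> X) : measurable_fun setT f ->
  measurable Y -> measurable [set x | Y (f x)].
Proof. by move=> mf mY; rewrite -[X in measurable X]setTI; exact: mf. Qed.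

Lemma measurable_preim2 (E : set (X * X)) (f g : X -> X) :
  measurable_fun setT f -> measurable_fun setT g -> measurable E ->
  measurable [set x | E (f x, g x)].
Proof.
move=> mf mg mE; rewrite -[X in measurable X]setTI.
exact: (measurable_fun_pair mf mg).
Qed.

Lemma measurable_graph_on (A : set X) (f : X -> X) : measurable A ->
  measurable_fun setT f -> measurable [set p : X * X | A p.1 /\ p.2 = f p.1].
Proof.
move=> mA mf; rewrite (_ : [set p | _] = (A `*` setT) `&`
    [set p : X * X | p.2 = f p.1]); last first.
  by apply/seteqP; split=> -[x y] /= => [[]|[[]]].
apply: measurableI; first exact: measurableX.
have [U mU sepU] := separating_sets X_standard.
rewrite (_ : [set p | _] = [set p | forall n,
  (~` (f @^-1` U n `*` setT) `|` (setT `*` U n)) p] `&` [set p | forall n,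
  ((f @^-1` U n `*` setT) `|` ~` (setT `*` U n)) p]); last first.
  apply/seteqP; split=> [[x y] /= ->|[x y] /= [H1 H2]].
    by split=> n; have [|] := pselect (U n (f x)) => h; [right|left|left|right] => //= -[].
  apply: contrapT => /sepU[n [Uy Uf]].
  by case: (H2 n) => [[]//|]; apply.
have mfU n : measurable (f @^-1` U n `*` (setT : set X)).
  by apply: measurableX => //; exact: measurable_preim.
have mXU n : measurable ((setT : set X) `*` U n) by exact: measurableX.
by apply: measurableI; apply: measurable_forall => n; apply: measurableU => //; exact: measurableC.
Qed.

Lemma xsection_graph (A : set X) (f : X -> X) x :
  xsection [set p : X * X | A p.1 /\ p.2 = f p.1] x =
  if `[< A x >] then [set f x] else set0.
Proof.
case: asboolP => Ax; apply/seteqP; split=> y.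
- by move/xsectionP => [].
- by move=> ->; apply/xsectionP.
- by move/xsectionP => [].
- by [].
Qed.

Lemma mu_rel_graph (A : set X) (f : X -> X) : measurable A ->
  mu_rel mu [set p | A p.1 /\ p.2 = f p.1] = mu A.
Proof.
move=> mA; rewrite /mu_rel -integral_prob_indic//; apply: eq_integral => x _.
rewrite xsection_graph indicE; case: asboolP => Ax.
  by rewrite mem_set// counting_set1.
by rewrite memNset// counting_set0.
Qed.

Lemma mu_rel_le (E F : set (X * X)) : E `<=` F -> (mu_rel mu E <= mu_rel mu F)%E.
Proof.
move=> EF; apply: ae_le_integral => [x|x|]; try exact: counting_ge0.
apply: aeW => x; rewrite /counting; case: asboolP => fE; last first.
  rewrite asboolF// => fF; apply: fE; apply: sub_finite_set fF => y.
  by move/xsectionP/EF/xsectionP.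
case: asboolP => fF; last by rewrite leey.
rewrite lee_fin ler_nat; apply: finmap.fsubset_leq_card; apply/finmap.fsubsetP => y.
rewrite !in_fset_set// => /set_mem/xsectionP/EF Fxy.
by apply/mem_set/xsectionP.
Qed.

(** Invariance of [mu_rel] under the flip, for the graph of a map that need not be
    injective. *)
Lemma mu_rel_graph_flip (A : set X) (f h : X -> X) : measurable A ->
  measurable_fun setT f -> A `<=` [set x | Rel (x, f x)] ->
  mu_rel mu [set p | A p.2 /\ p.1 = f p.2] = mu A.
Proof.
move=> mA mf AR; rewrite -(mu_rel_graph f mA).
apply: (Rel_pmp (measurable_graph_on mA mf)).
by move=> [x y] /= [Ax ->]; exact: AR.
Qed.

(** Flipped, the graph over this set consists of pairs whose first coordinate lies
    in [N]. *)
Lemma null_preimage (N : set X) (f : X -> X) : measurable N -> mu N = 0%E ->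
  measurable_fun setT f ->
  mu [set x | Rel (x, f x) /\ N (f x)] = 0%E.
Proof.
move=> mN N0 mf.
have mA : measurable [set x | Rel (x, f x) /\ N (f x)].
  by apply: measurableI; [exact: (measurable_preim2 (@measurable_id _ _ _) mf)|
    exact: measurable_preim].
rewrite -(mu_rel_graph_flip id mA mf); last by move=> x [].
apply/eqP; rewrite eq_le; apply/andP; split; last first.
  by apply: integral_ge0 => x _; exact: counting_ge0.
rewrite -(integral0 mu setT); apply: ae_le_integral => //.
apply: (@filterS _ _ _ (~` N)); last exact: (ae_null mN N0).
move=> y Ny /=; rewrite (_ : xsection _ _ = set0) ?counting_set0//.
by apply/seteqP; split=> // x /xsectionP /= [[_ Nf] yf]; rewrite yf in Ny.
Qed.

Section Element.
Variable g : full_group mu Rel.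

Let g_measurable := fg_fun_measurable g.
Let gi_measurable := fg_inv_measurable g.

(** The graph of [g] over [A] is the flipped graph of its inverse over the image, up
    to the null set where [g] leaves the classes. Equality follows by applying
    the inequality to the complement. *)
Let fg_inv_preserving_le A : measurable A -> (mu A <= mu (fg_inv g @^-1` A))%E.
Proof.
move=> mA; pose A' := A `&` [set x | Rel (x, g x)].
have mA' : measurable A'.
  by apply: measurableI => //; exact: (measurable_preim2 (@measurable_id _ _ _)).
have mI : measurable (fg_inv g @^-1` A') by exact: measurable_preim.
have -> : mu A = mu A'.
  rewrite (prE mu mA) (prE mu mA'); congr EFin.
  have mR : measurable [set x | Rel (x, g x)].
    exact: (measurable_preim2 (@measurable_id _ _ _)).
  rewrite (prDI mu mA mR) [X in X + _]pr_ae0 ?add0r//; first exact: measurableD.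
  by apply: filterS (fg_rel g) => x Rx [_ /(_ Rx)].
rewrite -(mu_rel_graph_flip id mA' g_measurable); last by move=> x [].
rewrite (_ : [set p | _] = [set p | (fg_inv g @^-1` A') p.1 /\ p.2 = fg_inv g p.1]).
  have mIA : measurable (fg_inv g @^-1` A) by exact: measurable_preim.
  by rewrite mu_rel_graph//; apply: le_measure; [exact: mem_set|exact: mem_set|move=> x []].
apply/seteqP; split=> -[x y] /= [Ay xy]; first by rewrite xy fg_funK.
by rewrite xy fg_invK.
Qed.

Lemma fg_inv_preserving A : measurable A -> mu (fg_inv g @^-1` A) = mu A.
Proof.
move=> mA; apply/eqP; rewrite eq_le fg_inv_preserving_le// andbT.
have mI : measurable (fg_inv g @^-1` A) by exact: measurable_preim.
have := fg_inv_preserving_le (measurableC mA).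
have mIC := measurableC mI.
rewrite preimage_setC (prE mu mA) (prE mu mI) (prE mu (measurableC mA)) (prE mu mIC).
by rewrite !lee_fin !prC// lerD2l lerN2.
Qed.

Lemma fg_preserving A : measurable A -> mu (g @^-1` A) = mu A.
Proof.
move=> mA; have mI : measurable (g @^-1` A) by exact: measurable_preim.
rewrite -(fg_inv_preserving mI); congr (mu _).
by apply/seteqP; split=> x /=; rewrite fg_invK.
Qed.

Lemma pr_fg A : measurable A -> pr mu (g @^-1` A) = pr mu A.
Proof. by move=> mA; rewrite /pr fg_preserving. Qed.

Lemma ae_fg (P : X -> Prop) : {ae mu, forall x, P x} -> {ae mu, forall x, P (g x)}.
Proof.
move=> [N [mN N0 HN]]; exists (g @^-1` N); split; first exact: measurable_preim.
  by rewrite fg_preserving.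
by move=> x /= nP; apply: HN.
Qed.

Lemma ae_fg_inv (P : X -> Prop) : {ae mu, forall x, P x} ->
  {ae mu, forall x, P (fg_inv g x)}.
Proof.
move=> [N [mN N0 HN]]; exists (fg_inv g @^-1` N); split; first exact: measurable_preim.
  by rewrite fg_inv_preserving.
by move=> x /= nP; apply: HN.
Qed.

Lemma fg_inv_rel : {ae mu, forall x, Rel (x, fg_inv g x)}.
Proof.
by apply: filterS (ae_fg_inv (fg_rel g)) => x; rewrite fg_invK; exact: Rel_sym.
Qed.

End Element.

Definition fg_id : full_group mu Rel := @FullGroup _ _ _ mu Rel id id
  (fun=> erefl) (fun=> erefl) (@measurable_id _ _ _) (@measurable_id _ _ _)
  (aeW mu Rel_refl).

Definition fg_opp (g : full_group mu Rel) : full_group mu Rel :=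
  FullGroup (fg_invK g) (fg_funK g) (fg_inv_measurable g)
    (fg_fun_measurable g) (fg_inv_rel g).

Lemma fg_comp_rel (g h : full_group mu Rel) :
  {ae mu, forall x, Rel (x, g (h x))}.
Proof.
apply: filterS2 (fg_rel h) (ae_fg h (fg_rel g)) => x; exact: Rel_trans.
Qed.

Definition fg_comp (g h : full_group mu Rel) : full_group mu Rel :=
  FullGroup (can_comp (fg_funK g) (fg_funK h))
    (can_comp (fg_invK h) (fg_invK g))
    (measurableT_comp (fg_fun_measurable g) (fg_fun_measurable h))
    (measurableT_comp (fg_inv_measurable h) (fg_inv_measurable g))
    (fg_comp_rel g h).

(** Two partially inverse maps [f] and [h] yield an involution that moves every
    point of [T] to its image under [f], once [U] separates [T] from [f @` T]. *)
Lemma swap_exists (f h : X -> X) (U : set X) : measurable_fun setT f ->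
  measurable_fun setT h -> measurable U ->
  exists g : full_group mu Rel, (forall x, Rel (x, g x)) /\
    forall x, [/\ Rel (x, f x), h (f x) = x, U x & ~ U (f x)] -> g x = f x.
Proof.
move=> mf mh mU.
pose T x := [/\ Rel (x, f x), h (f x) = x, U x & ~ U (f x)].
pose S y := f (h y) = y /\ T (h y).
have mT : measurable T.
  rewrite (_ : T = ([set x | Rel (x, f x)] `&` [set x | h (f x) = x]) `&`
    (U `&` [set x | (~` U) (f x)])); last first.
    by apply/seteqP; split=> [x []//|x [[? ?] []]].
  apply: measurableI; apply: measurableI => //.
  - exact: (measurable_preim2 (@measurable_id _ _ _)).
  - apply: (measurable_graph X_standard) => //; exact: measurableT_comp.
  - by apply: measurable_preim => //; exact: measurableC.
have mS : measurable S.
  apply: measurableI; last exact: (measurable_preim mh mT).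
  apply: (measurable_graph X_standard) => //; exact: measurableT_comp.
have TS x : T x -> S (f x) by move=> Tx; case: (Tx) => _ e _ _; rewrite /S e.
have ST x : S x -> ~ T x.
  by move=> [e [_ _ _]]; rewrite e => nU [].
pose s x := if `[< T x >] then f x else if `[< S x >] then h x else x.
have sT x : T x -> s x = f x by move=> Tx; rewrite /s asboolT.
have sS x : S x -> s x = h x.
  by move=> Sx; rewrite /s asboolF ?asboolT//; exact: ST.
have ss : involutive s.
  move=> x; have [Tx|nT] := pselect (T x).
    by rewrite (sT x)// sS; [case: Tx|exact: TS].
  have [Sx|nS] := pselect (S x); first by rewrite (sS x)// sT; case: Sx.
  have sx : s x = x by rewrite /s !asboolF.
  by rewrite sx sx.
have ms : measurable_fun setT s.
  move=> _ Y mY; rewrite setTI (_ : _ @^-1` _ = (T `&` [set x | Y (f x)]) `|`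
    (S `&` [set x | Y (h x)]) `|` ((~` T `&` ~` S) `&` Y)); last first.
    apply/seteqP; split=> x /=; rewrite /s.
      case: asboolP => Tx; first by left; left.
      by case: asboolP => Sx; [left; right|right].
    case=> [[[Tx Yx]|[Sx Yx]]|[[nT nS] Yx]]; first by rewrite asboolT.
      by rewrite asboolF ?asboolT//; exact: ST.
    by rewrite !asboolF.
  have mTC := measurableC mT; have mSC := measurableC mS.
  by apply: measurableU; [apply: measurableU|]; repeat apply: measurableI => //;
    exact: measurable_preim.
have sR x : Rel (x, s x).
  rewrite /s; case: asboolP => [[]//|_]; case: asboolP => [[e [r _ _ _]]|_].
    by rewrite e in r; exact: Rel_sym.
  exact: Rel_refl.
by exists (FullGroup ss ss ms ms (aeW mu sR)).
Qed.

(** Let [f n] be maps exhausting the classes. If [f n] sends [x] to [y], some [f m]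
    sends [y] back, and some [U k] separates the two points: the corresponding
    swap is one of countably many involutions. *)
Lemma full_group_cover : exists2 g : nat -> full_group mu Rel,
  [/\ forall i x, Rel (x, g i x) & forall x, g 0%N x = x] &
  {ae mu, forall x, forall y, Rel (x, y) -> exists i, g i x = y}.
Proof.
have [f mf fP] := uniformization_ae X_standard mRel Rel_discrete.
have [U mU sepU] := separating_sets X_standard.
have /choice[s sP] : forall nmk : nat * nat * nat, exists g : full_group mu Rel,
   (forall x, Rel (x, g x)) /\ forall x, [/\ Rel (x, f nmk.1.1 x),
     f nmk.1.2 (f nmk.1.1 x) = x, U nmk.2 x & ~ U nmk.2 (f nmk.1.1 x)] ->
     g x = f nmk.1.1 x.
  by move=> [[n m] k] /=; exact: swap_exists.
pose g (i : nat) : full_group mu Rel := if i is j.+1 then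
  (if (unpickle j : option (nat * nat * nat)) is Some nmk then s nmk else fg_id)
  else fg_id.
exists g.
  split=> // -[|j] x /=; first exact: Rel_refl.
  by case: unpickle => [nmk|]; [exact: (sP nmk).1|exact: Rel_refl].
have [N [mN N0 HN]] := ae_set fP.
have fN : {ae mu, forall x, forall n, ~ (Rel (x, f n x) /\ N (f n x))}.
  apply: ae_foralln => n; apply: ae_null; last by apply: null_preimage => //; exact: pr_eq0.
  by apply: measurableI; [exact: (measurable_preim2 (@measurable_id _ _ _))|
    exact: measurable_preim].
apply: filterS2 fP fN => x Hx Nx y Rxy.
have [<-|xy] := pselect (x = y); first by exists 0%N.
have [n fny] := Hx y Rxy.
have yN : ~ N y by move=> Ny; apply: (Nx n); rewrite fny.
have [m fmx] := HN _ yN x (Rel_sym Rxy).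
have [k [Ux Uy]] := sepU _ _ xy.
exists (pickle (n, m, k)).+1; rewrite /= pickleK.
by have [_ ->//=] := sP (n, m, k); rewrite /= fny.
Qed.

(** On measurable parts of the relation, [mu_rel] is the countable sum, over an
    exhausting sequence in the full group, of the measures of the sets of points
    where the graph of the [i]-th element adds a new pair. *)
Lemma mu_rel_measure : exists nu : {measure set (X * X) -> \bar R},
  (forall E, measurable E -> E `<=` Rel -> mu_rel mu E = nu E) /\
  (forall E, measurable E -> {ae mu, forall x, forall y, Rel (x, y) -> ~ E (x, y)} ->
    nu E = 0%E).
Proof.
have [g [gR g0] gP] := full_group_cover.
pose new i := [set x | forall j : 'I_i, (~` [set x | g j x = g i x]) x].
have mnew i : measurable (new i).
  apply: measurable_forall => j; apply: measurableC.
  apply: (measurable_graph X_standard); exact: fg_fun_measurable.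
have mp i : measurable_fun setT (fun x => (x, g i x)).
  by apply: measurable_fun_pair => //; exact: fg_fun_measurable.
pose m i := measure_function_pushforward__canonical__measure_function_Measure
  (mrestr mu (mnew i)) (mp i).
have mE E i : measurable E -> measurable ([set x | E (x, g i x)] `&` new i).
  move=> mE; apply: measurableI => //.
  by apply: (measurable_preim2 (@measurable_id _ _ _)) => //; exact: fg_fun_measurable.
have newP x y : (exists i, g i x = y) -> exists i, g i x = y /\ new i x.
  move=> ex; have ex' : exists i, `[< g i x = y >].
    by case: ex => i gi; exists i; exact/asboolP.
  case: (ex_minnP ex') => i /asboolP gi imin; exists i; split=> // j /= gj.
  have := imin j; rewrite leqNgt ltn_ord => /(_ _)/negP; apply=> //.
  by apply/asboolP; rewrite gj.
exists (mseries m 0); split=> [E mE' ER|E mE' E0]; last first.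
  rewrite /= /mseries eseries0// => i _ _.
  rewrite /= /pushforward /mrestr.
  apply: measure_negligible; first exact: mE.
  apply: negligibleS E0 => x [Ex _] /= H.
  exact: H (gR i x) Ex.
pose E_ i := [set x | E (x, g i x)] `&` new i.
pose S i x : set X := if `[< E_ i x >] then [set g i x] else set0.
have cS i x : counting (S i x) = (\1_(E_ i) x)%:E :> \bar R.
  rewrite /S indicE; case: asboolP => Ex.
    by rewrite mem_set// counting_set1.
  by rewrite memNset// counting_set0.
have m1 (a : X) : measurable [set a].
  by apply: (measurable_graph X_standard (f := id) (g := cst a)) => //;
    exact: measurable_id.
have cE : {ae mu, forall x,
    counting (xsection E x) = (\sum_(i <oo) (\1_(E_ i) x)%:E)%E :> \bar R}.
  apply: filterS gP => x gPx.
  rewrite (_ : xsection E x = \bigcup_i S i x).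
    rewrite (@measure_semi_bigcup _ _ _ (@counting X R)).
    - by apply: eq_eseriesr => i _; rewrite -cS.
    - by move=> i; rewrite /S; case: ifP.
    - apply/trivIsetP => i j _ _ ij; apply/seteqP; split=> // y [].
      rewrite /S; case: asboolP => // -[_ ni] /= ->; case: asboolP => // -[_ nj] /= gij.
      have [lt|lt|e] := ltngtP i j; last by rewrite e eqxx in ij.
        exact: nj (Ordinal lt) gij.
      exact: ni (Ordinal lt) (esym gij).
    - by apply: bigcupT_measurable => i; rewrite /S; case: ifP.
  apply/seteqP; split=> [y /xsectionP Exy|y [i _]].
    have [i [gi ni]] := newP _ _ (gPx y (ER _ Exy)).
    by exists i => //; rewrite /S asboolT//; split=> //=; rewrite gi.
  by rewrite /S; case: asboolP => // -[/= Ex _] ->; apply/xsectionP.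
transitivity (\int[mu]_x \sum_(i <oo) (\1_(E_ i) x)%:E)%E.
  have s0 x : (0 <= \sum_(i <oo) (\1_(E_ i) x)%:E :> \bar R)%E.
    by apply: nneseries_ge0 => i _ _; rewrite lee_fin.
  apply/eqP; rewrite eq_le; apply/andP; split; apply: ae_le_integral => //;
    try by move=> x; exact: counting_ge0.
    by apply: filterS cE => x ->.
  by apply: filterS cE => x ->.
rewrite integral_nneseries//.
- apply: eq_eseriesr => i _; rewrite integral_prob_indic//; exact: mE.
- move=> i; apply/measurable_EFinP; apply: measurable_indic; exact: mE.
Qed.

Lemma mu_relU (E F : set (X * X)) : measurable E -> measurable F ->
  E `<=` Rel -> F `<=` Rel ->
  (mu_rel mu (E `|` F) <= mu_rel mu E + mu_rel mu F)%E.
Proof.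
move=> mE mF ER FR; have [nu [nuE _]] := mu_rel_measure.
rewrite !nuE//; [exact: measureU2|exact: measurableU|].
by move=> p [/ER|/FR].
Qed.

Lemma mu_rel_cvg0 (Q : set (X * X)) (B : nat -> set (X * X)) :
  Q `<=` Rel -> (mu_rel mu Q < +oo)%E ->
  (forall n, measurable (B n)) -> (forall n, B n `<=` Q) ->
  {ae mu, forall x, forall y, Rel (x, y) ->
    exists N, forall n, (N <= n)%N -> ~ B n (x, y)} ->
  forall e : R, 0 < e -> exists N, forall n, (N <= n)%N ->
    (mu_rel mu (B n) < e%:E)%E.
Proof.
move=> QR Qoo mB BQ B0 e e0; have [nu [nuE nu0]] := mu_rel_measure.
have BR n : B n `<=` Rel by exact: subset_trans QR.
pose D n := \bigcup_(k in [set k | (n <= k)%N]) B k.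
have mD n : measurable (D n) by exact: bigcup_measurable.
have DQ n : D n `<=` Q by move=> p [k _ /BQ].
have DR n : D n `<=` Rel by exact: subset_trans QR.
have : nu \o D @ \oo --> nu (\bigcap_n D n).
  apply: nonincreasing_cvg_mu => //.
  - by rewrite -nuE//; apply: le_lt_trans Qoo; exact: mu_rel_le.
  - exact: bigcapT_measurable.
  - move=> m n mn; apply/subsetPset => p [k /= nk Bk]; exists k => //=.
    exact: leq_trans nk.
rewrite (nu0 (\bigcap_n D n)); last 2 first.
- exact: bigcapT_measurable.
- apply: filterS B0 => x Hx y Rxy Dxy; have [N HN] := Hx y Rxy.
  by have [k Nk] := Dxy N I; exact: HN.
move=> /fine_cvgP[_] /cvgrPdist_lt/(_ _ e0)[N _ HN].
exists N => n Nn; have := HN n Nn; rewrite /= sub0r normrN => lt.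
apply: (@le_lt_trans _ _ (nu (D n))).
  by rewrite -nuE//; apply: mu_rel_le => p Bp; exists n => /=.
have nf : (nu (D n) < +oo)%E by rewrite -nuE//; apply: le_lt_trans Qoo; exact: mu_rel_le.
have nfin : nu (D n) \is a fin_num by rewrite ge0_fin_numE.
by rewrite -(fineK nfin) lte_fin; apply: le_lt_trans lt; exact: ler_norm.
Qed.

End FullGroup.

(** * The Hilbert space of square summable complex sequences *)

Section SquareSummable.
Variable R : realType.
Implicit Types f g h : nat -> R[i].

(** The [k]-th summand of the real inner product. *)
Definition rterm f g k : R :=
  complex.Re (f k) * complex.Re (g k) + complex.Im (f k) * complex.Im (g k).

Definition sqsum f := exists M : R, forall n, \sum_(0 <= k < n) rterm f f k <= M.

(** The real part of the inner product. *)
Definition rip f g : R := limn (series (rterm f g)).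

Lemma rterm_ge0 f k : 0 <= rterm f f k.
Proof. by rewrite addr_ge0// -expr2 sqr_ge0. Qed.

Lemma rtermC f g k : rterm f g k = rterm g f k.
Proof. by rewrite /rterm; congr (_ + _); rewrite mulrC. Qed.

Lemma rtermDl f g h k : rterm (f \+ g) h k = rterm f h k + rterm g h k.
Proof. rewrite /rterm /=; case: (f k) (g k) => [a b] [a' b'] /=; ring. Qed.

Lemma rterm_norm f g k : `|rterm f g k| <= rterm f f k + rterm g g k.
Proof.
rewrite /rterm; case: (f k) (g k) => [a b] [a' b'] /=.
have sq (t : R) : 0 <= t * t by rewrite -expr2 sqr_ge0.
have := sq (a - a'); have := sq (b - b'); have := sq (a + a'); have := sq (b + b').
have := sq a; have := sq b; have := sq a'; have := sq b'.
by rewrite ler_norml => *; apply/andP; split; lra.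
Qed.

Lemma sqsum_cvg f : sqsum f -> cvgn (series (rterm f f)).
Proof.
move=> [M HM]; apply: nondecreasing_is_cvgn.
  apply/nondecreasing_seqP => n; rewrite /series /= big_nat_recr//= lerDl.
  exact: rterm_ge0.
by exists M => _ [n _ <-]; exact: HM.
Qed.

Lemma rterm_cvg f g : sqsum f -> sqsum g -> cvgn (series (rterm f g)).
Proof.
move=> sf sg; apply: normed_cvg.
have -> : [normed series (rterm f g)] = series (fun k => `|rterm f g k|) by [].
apply: (@series_le_cvg _ _ (rterm f f + rterm g g)) => [n|n|n|].
- exact: normr_ge0.
- by rewrite /= addr_ge0 ?rterm_ge0.
- exact: rterm_norm.
by rewrite seriesD; apply: is_cvgD; exact: sqsum_cvg.
Qed.

Lemma ripC f g : rip f g = rip g f.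
Proof. by rewrite /rip; congr (limn (series _)); apply/funext => k; exact: rtermC. Qed.

Lemma ripDl f g h : sqsum f -> sqsum g -> sqsum h ->
  rip (f \+ g) h = rip f h + rip g h.
Proof.
move=> sf sg sh; apply: cvg_lim => //.
rewrite (_ : series (rterm _ _) = series (rterm f h) \+ series (rterm g h)).
  by apply: cvgD; apply: rterm_cvg.
apply/funext => n; rewrite /series /= -big_split/=.
by apply: eq_bigr => k _; exact: rtermDl.
Qed.

Lemma ripZl (a : R) f g : sqsum f -> sqsum g ->
  rip (fun k => a%:C * f k) g = a * rip f g.
Proof.
move=> sf sg; apply: cvg_lim => //.
rewrite (_ : series (rterm _ _) = fun n => a * series (rterm f g) n).
  by apply: cvgMr; apply: rterm_cvg.
apply/funext => n; rewrite /series /= big_distrr/=.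
by apply: eq_bigr => k _; rewrite /rterm; case: (f k) => [x y] /=; ring.
Qed.

Lemma ripZZ (a : R[i]) f : sqsum f ->
  rip (fun k => a * f k) (fun k => a * f k) =
  (complex.Re a ^+ 2 + complex.Im a ^+ 2) * rip f f.
Proof.
move=> sf; apply: cvg_lim => //.
rewrite (_ : series (rterm _ _) = fun n =>
    (complex.Re a ^+ 2 + complex.Im a ^+ 2) * series (rterm f f) n).
  by apply: cvgMr; exact: sqsum_cvg.
apply/funext => n; rewrite /series /= big_distrr/=.
by apply: eq_bigr => k _; rewrite /rterm; case: a (f k) => [x y] [x' y'] /=; ring.
Qed.

Lemma ripJ f g : rip (fun k => 'i%C * f k) (fun k => 'i%C * g k) = rip f g.
Proof.
rewrite /rip; congr (limn (series _)); apply/funext => k.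
by rewrite /rterm; case: (f k) (g k) => [a b] [a' b'] /=; ring.
Qed.

Lemma rip_le_series f n : sqsum f -> series (rterm f f) n <= rip f f.
Proof.
move=> sf; apply: nondecreasing_cvgn_le; last exact: sqsum_cvg.
apply/nondecreasing_seqP => m; rewrite /series /= big_nat_recr//= lerDl.
exact: rterm_ge0.
Qed.

Lemma rip_ge0 f : sqsum f -> 0 <= rip f f.
Proof.
move=> sf; apply: le_trans (rip_le_series 0 sf).
by rewrite /series /= big_geq.
Qed.

Lemma rterm_le_rip f k : sqsum f -> rterm f f k <= rip f f.
Proof.
move=> sf; apply: le_trans (rip_le_series k.+1 sf).
rewrite /series /= big_nat_recr//= lerDr.
by apply: sumr_ge0 => i _; exact: rterm_ge0.
Qed.

Lemma rterm_eq0 f k : rterm f f k = 0 -> f k = 0.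
Proof.
rewrite /rterm -!expr2 => /eqP; rewrite paddr_eq0 ?sqr_ge0// !sqrf_eq0.
by case: (f k) => a b /= /andP[/eqP -> /eqP ->].
Qed.

Lemma rip_le_bound f (M : R) : (forall n, series (rterm f f) n <= M) -> rip f f <= M.
Proof.
move=> H; have sf : sqsum f by exists M.
by apply: limr_le; [exact: sqsum_cvg|exact: nearW].
Qed.

Lemma sqsum0 : sqsum (fun=> 0).
Proof. by exists 0 => n; rewrite big1// => k _; rewrite /rterm /=; ring. Qed.

Lemma sqsumD f g : sqsum f -> sqsum g -> sqsum (f \+ g).
Proof.
move=> [M HM] [N HN]; exists (2 * M + 2 * N) => n.
apply: (@le_trans _ _ (\sum_(0 <= k < n) (2 * rterm f f k + 2 * rterm g g k))).
  apply: ler_sum => k _; rewrite /rterm /=; case: (f k) (g k) => [a b] [a' b'] /=.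
  have sq (t : R) : 0 <= t * t by rewrite -expr2 sqr_ge0.
  by have := sq (a - a'); have := sq (b - b'); lra.
rewrite big_split/= -!big_distrr/=.
by apply: lerD; rewrite ler_pM2l.
Qed.

Lemma sqsumZ (a : R[i]) f : sqsum f -> sqsum (fun k => a * f k).
Proof.
move=> [M HM]; pose c := complex.Re a ^+ 2 + complex.Im a ^+ 2.
exists (c * M) => n.
rewrite (_ : \sum_(0 <= k < n) _ = c * \sum_(0 <= k < n) rterm f f k).
  by apply: ler_wpM2l => //; rewrite addr_ge0 ?sqr_ge0.
rewrite big_distrr/=; apply: eq_bigr => k _; rewrite /rterm /c.
by case: a {c} (f k) => [x y] [x' y'] /=; ring.
Qed.

Definition cutoff n f k := if (k < n)%N then f k else 0.

Lemma series_fin f n m : (forall k, (n <= k)%N -> f k = 0) -> (n <= m)%N ->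
  series (rterm f f) m = \sum_(0 <= k < n) rterm f f k.
Proof.
move=> f0 nm; rewrite /series /= (big_cat_nat (leq0n n) nm)//=.
rewrite [X in _ + X]big_nat_cond [X in _ + X]big1 ?addr0// => k /andP[/andP[nk _] _].
by rewrite /rterm f0//=; ring.
Qed.

Lemma sqsum_fin f n : (forall k, (n <= k)%N -> f k = 0) -> sqsum f.
Proof.
move=> f0; exists (\sum_(0 <= k < n) rterm f f k) => m.
rewrite -(series_fin f0 (leq_maxl n m)) /series /= [X in _ <= X](big_cat_nat (leq0n m) (leq_maxr n m))//= lerDl.
by apply: sumr_ge0 => k _; exact: rterm_ge0.
Qed.

Lemma rip_fin f n : (forall k, (n <= k)%N -> f k = 0) ->
  rip f f = \sum_(0 <= k < n) rterm f f k.
Proof.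
move=> f0; apply: cvg_lim => //; rewrite -(cvg_shiftn n)/=.
rewrite (_ : (fun _ => _) = fun=> \sum_(0 <= k < n) rterm f f k).
  exact: cvg_cst.
by apply/funext => m; rewrite (series_fin f0)// leq_addl.
Qed.

Lemma sqsum_cutoff n f : sqsum (cutoff n f).
Proof. by apply: (@sqsum_fin _ n) => k nk; rewrite /cutoff ltnNge nk. Qed.

Lemma cutoff_cvg f (e : R) : sqsum f -> 0 < e -> exists n,
  rip (f \- cutoff n f) (f \- cutoff n f) <= e.
Proof.
move=> sf e0; have /cvgrPdist_lt/(_ _ e0)[n _ Hn] := sqsum_cvg sf.
exists n; apply: rip_le_bound => m.
have fn := Hn n (leqnn n).
have [mn|nm] := leqP m n.
  rewrite /series /= big_nat_cond big1; first exact: ltW.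
  move=> k /andP[/andP[_ km] _]; rewrite /rterm /cutoff /= (leq_trans km mn) subrr /=.
  ring.
apply: le_trans (ltW fn); apply: le_trans (ler_norm _).
apply: (@le_trans _ _ (series (rterm f f) m - series (rterm f f) n)); last first.
  by rewrite lerD2r; exact: rip_le_series.
rewrite /series /= [X in _ <= X - _](big_cat_nat (leq0n n) (ltnW nm))//= addrAC subrr add0r.
rewrite (big_cat_nat (leq0n n) (ltnW nm))//= big_nat_cond big1 ?add0r.
  rewrite big_nat_cond [X in _ <= X]big_nat_cond; apply: ler_sum => k /andP[/andP[nk _] _].
  by rewrite /rterm /cutoff /= ltnNge nk /= subr0.
move=> k /andP[/andP[_ kn] _]; rewrite /rterm /cutoff /= kn subrr /=.
ring.
Qed.

Lemma rip_cauchy_schwarz f g : sqsum f -> sqsum g ->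
  rip f g <= Num.sqrt (rip f f) * Num.sqrt (rip g g).
Proof.
move=> sf sg.
have H (t : R) : 0 <= rip f f + 2 * t * rip f g + t ^+ 2 * rip g g.
  have sfg : sqsum (fun k => t%:C * g k) by exact: sqsumZ.
  apply: le_trans (rip_ge0 (sqsumD sf sfg)) _.
  rewrite ripDl//; last exact: sqsumD.
  rewrite ![rip _ (_ \+ _)]ripC !ripDl// !ripZl// ![rip _ (fun k => _ * _)]ripC !ripZl//.
  by rewrite [rip g f]ripC le_eqVlt; apply/orP; left; apply/eqP; ring.
have [g0|g0] := eqVneq (rip g g) 0.
  rewrite g0 sqrtr0 mulr0; rewrite leNgt; apply/negP => fg.
  have := H (- (rip f f + 1) / (2 * rip f g)); rewrite g0 mulr0 addr0.
  rewrite (_ : 2 * _ * _ = - (rip f f + 1)); last first.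
    by field; rewrite gt_eqF.
  by rewrite opprD addrA subrr add0r ler0N1.
have gpos : 0 < rip g g by rewrite lt_neqAle eq_sym g0 rip_ge0.
have := H (- rip f g / rip g g) => {}H.
have : rip f g ^+ 2 <= rip f f * rip g g.
  rewrite -subr_ge0.
  have -> : rip f f * rip g g - rip f g ^+ 2 = rip g g *
      (rip f f + 2 * (- rip f g / rip g g) * rip f g + (- rip f g / rip g g) ^+ 2 * rip g g).
    by field.
  by rewrite mulr_ge0// ltW.
move=> le2; apply: (le_trans (ler_norm _)).
rewrite -sqrtr_sqr -sqrtrM ?rip_ge0// ler_sqrt//.
by rewrite mulr_ge0// ?rip_ge0.
Qed.

Lemma rip_triangle f g : sqsum f -> sqsum g ->
  Num.sqrt (rip (f \+ g) (f \+ g)) <= Num.sqrt (rip f f) + Num.sqrt (rip g g).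
Proof.
move=> sf sg; have sfg := sqsumD sf sg.
rewrite -[leRHS]ger0_norm ?addr_ge0 ?sqrtr_ge0// -sqrtr_sqr ler_sqrt ?sqr_ge0//.
rewrite ripDl// ![rip _ (_ \+ _)]ripC !ripDl// sqrrD !sqr_sqrtr ?rip_ge0// [rip g f]ripC.
have := rip_cauchy_schwarz sf sg; rewrite mulr2n; lra.
Qed.

End SquareSummable.

Section L2Type.
Variable R : realType.

Definition sqsum_pred : {pred (nat -> R[i]^o)} := fun f => `[< sqsum f >].

Lemma sqsum_submod : submod_closed sqsum_pred.
Proof.
split=> [|a f g /asboolP sf /asboolP sg]; apply/asboolP; first exact: sqsum0.
by apply: sqsumD => //; exact: sqsumZ.
Qed.

HB.instance Definition _ := GRing.isSubmodClosed.Build R[i] (nat -> R[i]^o)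
  sqsum_pred sqsum_submod.

Record l2 := L2 { l2val :> nat -> R[i]^o; l2P : l2val \in sqsum_pred }.
HB.instance Definition _ := [isSub for l2val].
HB.instance Definition _ := [Choice of l2 by <:].
HB.instance Definition _ := [SubChoice_isSubLmodule of l2 by <:].

Implicit Types u v w : l2.

Lemma l2_sqsum u : sqsum u.
Proof. by apply/asboolP; exact: l2P. Qed.

Lemma l2D u v : (u + v : l2) = (u \+ v) :> (nat -> R[i]).
Proof. by apply/funext => k. Qed.

Lemma l2Z (a : R[i]) u : (a *: u : l2) = (fun k => a * u k) :> (nat -> R[i]).
Proof. by apply/funext => k. Qed.

Lemma l2_ext u v : (forall k, u k = v k) -> u = v.
Proof. by move=> uv; apply: val_inj; apply/funext. Qed.

Definition l2_norm u : R := Num.sqrt (rip u u).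

Lemma l2_norm_le u (M : R) : 0 <= M -> rip u u <= M ^+ 2 -> l2_norm u <= M.
Proof.
by move=> M0 H; rewrite /l2_norm -(ger0_norm M0) -sqrtr_sqr; exact: ler_wsqrtr.
Qed.

Lemma l2_norm_triangle u v : (l2_norm (u + v))%:C <= (l2_norm u)%:C + (l2_norm v)%:C.
Proof.
rewrite -rmorphD lecR /l2_norm l2D; exact: rip_triangle (l2_sqsum u) (l2_sqsum v).
Qed.

Lemma l2_rip_scale (a : R[i]) u v : rip (a *: u : l2) v =
  complex.Re a * rip u v - complex.Im a * rip u ('i *: v : l2).
Proof.
have -> : (a *: u : l2) = (complex.Re a)%:C *: u + (complex.Im a)%:C *: ('i *: u).
  rewrite scalerA -scalerDl; congr (_ *: _); case: a => x y.
  by apply/eqP; rewrite eq_complex /=; apply/andP; split; apply/eqP; ring.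
rewrite l2D ripDl ?ripZl; try exact: l2_sqsum.
congr (_ + _); rewrite -mulrN; congr (_ * _).
suff : rip (fun k => 'i * u k) v = - rip u (fun k => 'i * v k) by [].
rewrite -(ripJ _ v) (_ : (fun k => 'i * ('i * u k)) = fun k => (-1)%:C * u k).
  by rewrite ripZl ?mulN1r//; [exact: l2_sqsum|exact: sqsumZ (l2_sqsum v)].
apply/funext => k; rewrite mulrA; congr (_ * _).
by apply/eqP; rewrite eq_complex /=; apply/andP; split; apply/eqP; ring.
Qed.

Lemma l2_normZ (a : R[i]) u : (l2_norm (a *: u))%:C = `|a| * (l2_norm u)%:C.
Proof.
rewrite normc_def -rmorphM; congr (_%:C).
rewrite /l2_norm -sqrtrM ?addr_ge0 ?sqr_ge0//; congr Num.sqrt.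
exact: ripZZ (l2_sqsum u).
Qed.

Lemma l2_norm_eq0 u : (l2_norm u)%:C = 0 -> u = 0.
Proof.
move=> [/eqP]; rewrite sqrtr_eq0 => u0; apply: l2_ext => k.
apply: rterm_eq0; apply/eqP; rewrite eq_le rterm_ge0 andbT.
by apply: le_trans u0; apply: rterm_le_rip; exact: l2_sqsum.
Qed.

HB.instance Definition _ := Lmodule_isNormed.Build R[i] l2
  l2_norm_triangle l2_normZ l2_norm_eq0.

Lemma l2_normE u : `|u| = (l2_norm u)%:C. Proof. by []. Qed.

(** The complex inner product is recovered from the real one. *)
Definition l2_inner u v : R[i] := rip u v +i* rip u ('i *: v : l2).

Lemma l2_inner_addl u v w : l2_inner (u + v) w = l2_inner u w + l2_inner v w.
Proof.
by rewrite /l2_inner !l2D !ripDl//; exact: l2_sqsum.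
Qed.

Lemma l2_innerC u v : l2_inner u v = Num.conj (l2_inner v u).
Proof.
apply/eqP; rewrite eq_complex /= ripC eqxx /=; apply/eqP.
have := l2_rip_scale 'i v u; rewrite /= mul0r sub0r mul1r => <-.
by rewrite ripC.
Qed.

Lemma l2_innerZ (a : R[i]) u v : l2_inner (a *: u) v = a * l2_inner u v.
Proof.
have ii : rip u ('i *: ('i *: v) : l2) = - rip u v.
  have -> : 'i *: ('i *: v) = (-1)%:C *: v.
    rewrite scalerA; congr (_ *: _).
    by apply/eqP; rewrite eq_complex /=; apply/andP; split; apply/eqP; ring.
  rewrite l2Z ripC ripZl; try exact: l2_sqsum.
  by rewrite mulN1r ripC.
rewrite /l2_inner !l2_rip_scale ii; case: a => x y /=.
by apply/eqP; rewrite eq_complex /=; apply/andP; split; apply/eqP; ring.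
Qed.

Lemma l2_inner_bilinear : bilinear_for ( *%R ) (Num.conj \; *%R) l2_inner.
Proof.
split=> [w a u v|u a v w]; first by rewrite /applyr l2_inner_addl l2_innerZ.
rewrite l2_innerC l2_inner_addl l2_innerZ rmorphD rmorphM /=.
by rewrite -!l2_innerC.
Qed.

HB.instance Definition _ := bilinear_isBilinear.Build R[i] l2 l2 R[i]
  ( *%R ) (Num.conj \; *%R) l2_inner l2_inner_bilinear.

Lemma l2_inner_hermitian u v :
  l2_inner u v = (-1) ^+ false * Num.conj (l2_inner v u).
Proof. by rewrite expr0 mul1r -l2_innerC. Qed.

HB.instance Definition _ := isHermitianSesquilinear.Build R[i] l2 false
  (Num.conj) l2_inner l2_inner_hermitian.

Lemma l2_inner_self u : l2_inner u u = (rip u u)%:C.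
Proof.
apply/eqP; rewrite eq_complex /= eqxx /=; apply/eqP.
have := l2_rip_scale 'i u u; rewrite /= mul0r sub0r mul1r ripC; lra.
Qed.

Lemma l2_inner_gt0 u : u != 0 -> 0 < l2_inner u u.
Proof.
move=> u0; rewrite l2_inner_self ltcR lt_neqAle rip_ge0 ?andbT; last exact: l2_sqsum.
apply: contra_neq u0 => e; apply: l2_norm_eq0.
by rewrite /l2_norm -e sqrtr0.
Qed.

HB.instance Definition _ := isDotProduct.Build R[i] l2 l2_inner l2_inner_gt0.

Lemma l2_inner_norm u : `|u| ^+ 2 = l2_inner u u.
Proof.
rewrite l2_inner_self l2_normE -rmorphXn /=; congr (_%:C).
by rewrite sqr_sqrtr// rip_ge0//; exact: l2_sqsum.
Qed.

Lemma l2_coord u k : `|complex.Re (u k)| <= l2_norm u /\ `|complex.Im (u k)| <= l2_norm u.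
Proof.
have := rterm_le_rip k (l2_sqsum u); rewrite /rterm -!expr2 => H.
by split; rewrite -sqrtr_sqr /l2_norm ler_wsqrtr//; apply: le_trans H;
  rewrite ?lerDl ?lerDr sqr_ge0.
Qed.

(** The coordinates converge, and a Cauchy estimate for partial sums passes to the
    limit. *)
Lemma l2_complete (F : set_system l2) : ProperFilter F -> cauchy F -> cvg F.
Proof.
move=> FF Fc.
have Fb (e : R) : 0 < e -> exists z : l2, F (ball z e%:C).
  by move=> e0; apply: ((cauchyP F).1 Fc); rewrite ltcR.
have ballE (z w : l2) (e : R) : ball z e%:C w -> l2_norm (z - w) < e.
  by rewrite -ball_normE /= l2_normE ltcR.
have cRe k : cvg ((fun u : l2 => complex.Re (u k)) @ F).
  apply: cauchy_cvg; apply: cauchy_exP => e e0.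
  have [z Fz] := Fb e e0; exists (complex.Re (z k)).
  change (F ((fun u : l2 => complex.Re (u k)) @^-1` ball (complex.Re (z k)) e)).
  apply: filterS Fz => w /ballE zw; rewrite /= -ball_normE /=.
  by apply: le_lt_trans zw; have := (l2_coord (z - w) k).1; rewrite raddfB.
have cIm k : cvg ((fun u : l2 => complex.Im (u k)) @ F).
  apply: cauchy_cvg; apply: cauchy_exP => e e0.
  have [z Fz] := Fb e e0; exists (complex.Im (z k)).
  change (F ((fun u : l2 => complex.Im (u k)) @^-1` ball (complex.Im (z k)) e)).
  apply: filterS Fz => w /ballE zw; rewrite /= -ball_normE /=.
  by apply: le_lt_trans zw; have := (l2_coord (z - w) k).2; rewrite raddfB.
pose f k : R[i] := lim ((fun u : l2 => complex.Re (u k)) @ F)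
  +i* lim ((fun u : l2 => complex.Im (u k)) @ F).
have key (e : R) (z w : l2) : F (ball z e%:C) -> ball z e%:C w ->
    forall n, series (rterm (w \- f) (w \- f)) n <= (e + e) ^+ 2.
  move=> Fz zw n.
  have e0 : 0 < e by apply: le_lt_trans (ballE _ _ _ zw); exact: sqrtr_ge0.
  have cv : (fun u : l2 => series (rterm (w \- u) (w \- u)) n) @ F -->
      series (rterm (w \- f) (w \- f)) n.
    rewrite /series /=; elim: n => [|n IHn].
      by under eq_fun do rewrite big_geq//; rewrite big_geq//; exact: cvg_cst.
    under eq_fun do rewrite big_nat_recr//=.
    rewrite big_nat_recr//=; apply: cvgD => //; rewrite /rterm /=.
    under eq_fun do rewrite !raddfB /=.
    by rewrite !raddfB /=; apply: cvgD; apply: cvgM; apply: cvgB => //; exact: cvg_cst.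
  apply: (closed_cvg (fun r => r <= (e + e) ^+ 2) _ _ _ cv).
    exact: closed_le.
  apply: filterS Fz => u zu /=.
  have -> : w \- u = (w - u : l2) :> (nat -> R[i]) by apply/funext.
  apply: le_trans (rip_le_series n (l2_sqsum (w - u))) _.
  rewrite -[rip _ _]sqr_sqrtr ?rip_ge0//; last exact: l2_sqsum.
  rewrite ler_sqr ?nnegrE; [|exact: sqrtr_ge0|by rewrite addr_ge0// ltW].
  rewrite -/(l2_norm (w - u)) -lecR.
  have -> : w - u = (z - u) + - (z - w) by rewrite opprB [RHS]addrC subrKA.
  apply: le_trans (ler_normD (z - u) (- (z - w))) _.
  rewrite normrN !l2_normE -rmorphD lecR; apply: lerD.
    exact: ltW (ballE _ _ _ zu).
  exact: ltW (ballE _ _ _ zw).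
have sf : sqsum f.
  have [z Fz] := Fb 1 ltr01.
  have /filter_ex[w zw] := Fz.
  have swf : sqsum (w \- f) by exists ((1 + 1) ^+ 2); exact: key Fz zw.
  rewrite (_ : f = w \+ (fun k => -1 * (w \- f) k)).
    by apply: sqsumD; [exact: l2_sqsum|exact: sqsumZ].
  by apply/funext => k /=; rewrite mulN1r opprB addrC subrK.
have fP : f \in sqsum_pred by apply/asboolP.
pose lf : l2 := L2 fP.
apply/cvg_ex; exists lf; apply/cvg_ballP => e /gt0C[e0 ->].
set r := complex.Re e in e0 *.
have [z Fz] := Fb (r / 4) (divr_gt0 e0 (ltr0n _ 4)).
apply: filterS (Fz) => w zw.
rewrite -ball_normE /= l2_normE ltcR.
apply: (@le_lt_trans _ _ (r / 4 + r / 4)); last lra.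
apply: l2_norm_le; first lra.
have -> : lf - w = - (w - lf) by rewrite opprB.
have -> : rip (- (w - lf)) (- (w - lf) : l2) = rip (w \- f) (w \- f).
  rewrite /rip; congr (limn (series _)); apply/funext => k.
  by rewrite /rterm /= raddfN /= raddfN /= !mulrNN.
apply: rip_le_bound => n; exact: key Fz zw n.
Qed.

HB.instance Definition _ := Uniform_isComplete.Build l2 l2_complete.

End L2Type.

Section L2Hilbert.
Variable R : realType.
Local Notation l2 := (l2 R).

Lemma cutoff_sqsum_pred (f : nat -> R[i]) (n : nat) : cutoff n f \in @sqsum_pred R.
Proof. by apply/asboolP; exact: sqsum_cutoff. Qed.

Definition l2_fin (f : nat -> R[i]) (n : nat) : l2 := L2 (cutoff_sqsum_pred f n).

Lemma l2_fin_near (u : l2) (e : R) : 0 < e ->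
  exists n, l2_norm (u - l2_fin u n) < e.
Proof.
move=> e0; have e2 : 0 < (e / 2) ^+ 2 by rewrite exprn_gt0// divr_gt0.
have [n Hn] := cutoff_cvg (l2_sqsum u) e2; exists n.
apply: (@le_lt_trans _ _ (e / 2)); last lra.
by apply: l2_norm_le => //; lra.
Qed.

Lemma l2_separable : exists2 D : set l2, countable D & dense D.
Proof.
pose q (s : seq (rat * rat)) k : R[i] :=
  ratr (nth (0, 0) s k).1 +i* ratr (nth (0, 0) s k).2.
exists (range (fun s => l2_fin (q s) (size s))).
  exact: (card_le_trans (card_image_le _ _) (countableP _)).
move=> O [z Oz] Oo.
have /nbhs_ballP[e /gt0C[e0 ->] eO] : nbhs z O by exact: open_nbhs_nbhs.
set r := complex.Re e in e0 eO *.
have r2 : 0 < r / 2 by rewrite divr_gt0.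
have [n Hn] := l2_fin_near z r2.
have [t t0 nt] : exists2 t : R, 0 < t & n.+1%:R * t = r / 8.
  exists (r / 8 / n.+1%:R); first by rewrite !divr_gt0.
  by rewrite mulrCA mulfV ?mulr1 ?pnatr_eq0.
have rd (a : R) : exists p : rat, `|a - ratr p| < t.
  have /rat_in_itvoo[p] : a - t < a + t by rewrite ltrD2l gtrN.
  by rewrite in_itv /= => ap; exists p; rewrite distrC ltr_distl.
have /choice[p pP] : forall k, exists p : rat * rat,
    `|complex.Re (z k) - ratr p.1| < t /\ `|complex.Im (z k) - ratr p.2| < t.
  move=> k; have [p1 h1] := rd (complex.Re (z k)).
  by have [p2 h2] := rd (complex.Im (z k)); exists (p1, p2).
pose s := mkseq p n.
exists (l2_fin (q s) (size s)); split; last by exists s.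
apply: eO; rewrite -ball_normE /= l2_normE ltcR.
have -> : z - l2_fin (q s) (size s) =
    (z - l2_fin z n) + (l2_fin z n - l2_fin (q s) (size s)) by rewrite subrKA.
rewrite -ltcR -l2_normE; apply: le_lt_trans (ler_normD _ _) _.
rewrite !l2_normE -rmorphD ltcR [ltRHS]splitr; apply: ltrD => //.
set w := l2_fin z n - _.
apply: (@le_lt_trans _ _ (2 * (n.+1%:R * t))); last first.
  by rewrite nt; move: e0; lra.
apply: l2_norm_le; first by rewrite !mulr_ge0// ltW.
have wk k : w k = if (k < n)%N then z k - q s k else 0.
  rewrite /w /l2_fin /= /cutoff size_mkseq.
  change ((if (k < n)%N then z k else 0) - (if (k < n)%N then q s k else 0) =
    if (k < n)%N then z k - q s k else 0).
  by case: ifP => // _; rewrite subr0.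
rewrite (@rip_fin _ w n); last by move=> k nk; rewrite wk ltnNge nk.
apply: (@le_trans _ _ (\sum_(0 <= k < n) (2 * t ^+ 2))).
  rewrite big_nat_cond [leRHS]big_nat_cond; apply: ler_sum => k /andP[/andP[_ kn] _].
  rewrite /rterm wk kn !raddfB /= !nth_mkseq// -!expr2 mulr_natl mulr2n.
  have [h1 h2] := pP k.
  have sq_le (a : R) : `|a| < t -> a ^+ 2 <= t ^+ 2.
    by move=> h; rewrite -[leLHS]real_normK ?num_real// !expr2 ler_pM// ltW.
  by apply: lerD; apply: sq_le.
rewrite sumr_const_nat subn0 -[leLHS]mulr_natr.
have n1 : (n%:R : R) <= n.+1%:R ^+ 2.
  by rewrite -natrX ler_nat; nia.
have n0 : (0 : R) <= n%:R by [].
rewrite !exprMn; have t2 : 0 <= t ^+ 2 by exact: sqr_ge0.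
have := ler_wpM2r t2 n1; have := mulr_ge0 n0 t2.
by move: (t ^+ 2) (n.+1%:R ^+ 2) (n%:R) => a b c; lra.
Qed.

Definition l2_hilbert : hilbert R :=
  @Hilbert R l2 (@l2_inner R) (@l2_inner_norm R) l2_separable.

End L2Hilbert.

(** * Permutations and measurability in the sequence space *)

Section L2More.
Variable R : realType.
Local Notation l2 := (l2 R).
Implicit Types (f g : nat -> R[i]) (u v : l2).

Lemma rip_finl f g n : (forall k, (n <= k)%N -> f k = 0) ->
  rip f g = \sum_(0 <= k < n) rterm f g k.
Proof.
move=> f0; apply: cvg_lim => //; rewrite -(cvg_shiftn n)/=.
rewrite (_ : (fun _ => _) = fun=> \sum_(0 <= k < n) rterm f g k).
  exact: cvg_cst.
apply/funext => m; rewrite /series /= (big_cat_nat (leq0n n) (leq_addl m n))//=.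
rewrite [X in _ + X]big_nat_cond [X in _ + X]big1 ?addr0// => k /andP[/andP[nk _] _].
by rewrite /rterm f0//=; ring.
Qed.

Lemma sqsum_reindex (s : nat -> nat) f : involutive s -> sqsum f ->
  sqsum (f \o s) /\ rip (f \o s) (f \o s) <= rip f f.
Proof.
move=> ss sf.
have H n : series (rterm (f \o s) (f \o s)) n <= rip f f.
  pose m := (\max_(k < n) s k).+1.
  apply: le_trans (rip_le_series m sf).
  rewrite /series /= !big_mkord.
  have sm (k : 'I_n) : (s k < m)%N by rewrite ltnS (bigD1 k)//= leq_maxl.
  rewrite (eq_bigr (fun k : 'I_n => rterm f f (Ordinal (sm k))))//.
  have hI : {in xpredT &, injective (fun k : 'I_n => Ordinal (sm k))}.
    by move=> j k _ _ [] /(inv_inj ss) /val_inj.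
  rewrite -(big_imset (fun k : 'I_m => rterm f f k) hI)/=.
  rewrite [leRHS](bigID (mem [set Ordinal (sm k) | k in xpredT]%SET))/= lerDl.
  by apply: sumr_ge0 => k _; exact: rterm_ge0.
by split; [exists (rip f f)|exact: rip_le_bound].
Qed.

Lemma rip_reindex_self (s : nat -> nat) f : involutive s -> sqsum f ->
  rip (f \o s) (f \o s) = rip f f.
Proof.
move=> ss sf; have [sfs le1] := sqsum_reindex ss sf.
apply/eqP; rewrite eq_le le1/=; have [_] := sqsum_reindex ss sfs.
by rewrite (_ : (f \o s) \o s = f)//; apply/funext => k /=; rewrite ss.
Qed.

(** Polarisation carries isometry statements over to inner products. *)
Lemma rip_polar f g : sqsum f -> sqsum g ->
  rip f g = (rip (f \+ g) (f \+ g) - rip f f - rip g g) / 2.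
Proof.
move=> sf sg; rewrite ripDl//; last exact: sqsumD.
rewrite ![rip _ (f \+ g)]ripC !ripDl// [rip g f]ripC; lra.
Qed.

Lemma rip_reindex (s : nat -> nat) f g : involutive s -> sqsum f -> sqsum g ->
  rip (f \o s) (g \o s) = rip f g.
Proof.
move=> ss sf sg; have [sfs _] := sqsum_reindex ss sf; have [sgs _] := sqsum_reindex ss sg.
rewrite (rip_polar sfs sgs) (rip_polar sf sg).
rewrite (rip_reindex_self ss sf) (rip_reindex_self ss sg).
by rewrite (rip_reindex_self ss (sqsumD sf sg)).
Qed.

Lemma l2_reindexP (s : nat -> nat) u : involutive s -> (u \o s) \in @sqsum_pred R.
Proof. by move=> ss; apply/asboolP; exact: (sqsum_reindex ss (l2_sqsum u)).1. Qed.

Definition l2_reindex (s : nat -> nat) (ss : involutive s) u : l2 := L2 (l2_reindexP u ss).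

Lemma l2_reindex_unitary (s : nat -> nat) (ss : involutive s) :
  @unitary R (l2_hilbert R) (l2_hilbert R) (l2_reindex ss).
Proof.
split.
- by move=> a u v; apply: l2_ext => k.
- move=> u v; rewrite /inner /= /l2_inner; congr (_ +i* _).
    exact: (rip_reindex ss (l2_sqsum u) (l2_sqsum v)).
  exact: (rip_reindex ss (l2_sqsum u) (l2_sqsum ('i *: v : l2))).
- move=> w; exists (l2_reindex ss w); apply: l2_ext => k /=.
  by rewrite ss.
Qed.

Definition l2_delta n : l2 := l2_fin (fun k => (k == n)%:R) n.+1.

Lemma l2_deltaE n k : l2_delta n k = (k == n)%:R.
Proof.
rewrite /l2_delta /= /cutoff; case: ltnP => // nk.
by rewrite gtn_eqF.
Qed.

Lemma l2_inner_delta n u : l2_inner (l2_delta n) u = Num.conj (u n).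
Proof.
have rt g k : rterm (l2_delta n) g k = if k == n then complex.Re (g n) else 0.
  rewrite /rterm l2_deltaE; case: eqP => [->|_] /=; ring.
have H g : rip (l2_delta n) g = complex.Re (g n).
  rewrite (@rip_finl _ _ n.+1); last by move=> k nk; rewrite l2_deltaE gtn_eqF.
  rewrite (eq_bigr _ (fun k _ => rt g k)) big_nat_recr//= eqxx.
  rewrite big_nat_cond big1 ?add0r// => k /andP[/andP[_ kn] _].
  by rewrite ltn_eqF.
rewrite /l2_inner !H l2Z; case: (u n) => a b.
by apply/eqP; rewrite eq_complex /=; apply/andP; split; apply/eqP; ring.
Qed.

Lemma l2_span_delta (u : l2) : closure (lin_span (H := l2_hilbert R) l2_delta) u.
Proof.
move=> B /nbhs_ballP[e /gt0C[e0 ->] eB].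
have [n Hn] := l2_fin_near u e0; exists (l2_fin u n); split.
  exists n, (fun i => u i); apply: l2_ext => k.
  rewrite /= /cutoff.
  have -> : (\sum_(i < n) u i *: l2_delta i : l2) k = \sum_(i < n) u i * (k == i)%:R.
    rewrite (big_morph (fun v : l2 => v k) (id1 := 0) (op1 := +%R))//.
    by apply: eq_bigr => i _; rewrite -l2_deltaE.
  case: ltnP => kn.
    rewrite (bigD1 (Ordinal kn))//= eqxx mulr1 big1 ?addr0// => i ik.
    rewrite (_ : (k == i) = false) ?mulr0//.
    by apply/negbTE; apply: contra ik => /eqP ki; apply/eqP/val_inj.
  by rewrite big1// => i _; rewrite gtn_eqF ?mulr0// (leq_trans (ltn_ord i)).
by apply: eB; rewrite -ball_normE /= l2_normE ltcR.
Qed.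

Lemma l2_finite_large u (q : R) : 0 < q ->
  exists N, forall k, (N <= k)%N -> rterm u u k < q.
Proof.
move=> q0; have /cvg_series_cvg_0/cvgrPdist_lt/(_ _ q0)[N _ HN] := sqsum_cvg (l2_sqsum u).
exists N => k /HN; rewrite /= sub0r normrN ger0_norm//; exact: rterm_ge0.
Qed.

Section Measurability.
Context {d : measure_display} {T : measurableType d}.
Variables (D : set T).
Hypothesis mD : measurable D.

Lemma measurable_rip (u v : T -> nat -> R[i]) :
  (forall x, sqsum (u x)) -> (forall x, sqsum (v x)) ->
  (forall k, cmeasurable D (fun x => u x k)) ->
  (forall k, cmeasurable D (fun x => v x k)) ->
  measurable_fun D (fun x => rip (u x) (v x)).
Proof.
move=> su sv mu mv.
apply: (@measurable_fun_cvg _ _ _ _ (fun n x => series (rterm (u x) (v x)) n)) => //.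
  move=> n; rewrite /series /=; apply: measurable_sum => k.
  have [ur ui] := mu k; have [vr vi] := mv k.
  by apply: measurable_funD; apply: measurable_funM.
by move=> x _; apply: rterm_cvg.
Qed.

Lemma cmeasurable_scale (a : R[i]) (f : T -> R[i]) :
  cmeasurable D f -> cmeasurable D (fun x => a * f x).
Proof.
move=> [fr fi]; case: a => x y; split.
  rewrite (_ : (fun t => _) = fun t => x * complex.Re (f t) - y * complex.Im (f t)).
    by apply: measurable_funB; apply: measurable_funM.
  by apply/funext => t; case: (f t).
rewrite (_ : (fun t => _) = fun t => x * complex.Im (f t) + y * complex.Re (f t)).
  by apply: measurable_funD; apply: measurable_funM.
by apply/funext => t; case: (f t).
Qed.

Lemma cmeasurable_l2_inner (u v : T -> l2) :
  (forall k, cmeasurable D (fun x => u x k)) ->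
  (forall k, cmeasurable D (fun x => v x k)) ->
  cmeasurable D (fun x => l2_inner (u x) (v x)).
Proof.
move=> mu mv; split.
  by apply: measurable_rip => // x; exact: l2_sqsum.
have su x : sqsum (u x) by exact: l2_sqsum.
have sv x : sqsum ('i *: v x : l2) by exact: l2_sqsum.
have miv k : cmeasurable D (fun x => ('i *: v x : l2) k).
  exact: (cmeasurable_scale 'i (mv k)).
exact: measurable_rip su sv mu miv.
Qed.

Lemma cmeasurable_index (w : T -> nat) (f : nat -> T -> R[i]) :
  (forall n, measurable [set x | w x = n]) -> (forall n, cmeasurable D (f n)) ->
  cmeasurable D (fun x => f (w x) x).
Proof.
move=> mw mf.
have H (g : nat -> T -> R) : (forall n, measurable_fun D (g n)) ->
    measurable_fun D (fun x => g (w x) x).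
  move=> mg _ Y mY; rewrite (_ : _ `&` _ = [set x | exists n,
      ([set x | w x = n] `&` (D `&` g n @^-1` Y)) x]).
    by apply: measurable_exists => n; apply: measurableI => //; exact: mg.
  apply/seteqP; split=> [x [Dx Yx]|x [n [/= <- [Dx Yx]]]]; last by split.
  by exists (w x).
by split; [apply: (H (fun n x => complex.Re (f n x)))|
  apply: (H (fun n x => complex.Im (f n x)))] => n; case: (mf n).
Qed.

End Measurability.

End L2More.

(** * Bitwise addition of natural numbers *)

From Stdlib Require PeanoNat.

Notation nbit := PeanoNat.Nat.testbit.
Notation nxor := PeanoNat.Nat.lxor.

Lemma nbit_xor a b j : nbit (nxor a b) j = nbit a j (+) nbit b j.
Proof. by rewrite PeanoNat.Nat.lxor_spec; do 2!case: nbit. Qed.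

Lemma nbit_inj a b : (forall j, nbit a j = nbit b j) -> a = b.
Proof. by move=> H; apply: PeanoNat.Nat.bits_inj. Qed.

Lemma nxorK a : involutive (nxor a).
Proof. by move=> b; apply: nbit_inj => j; rewrite !nbit_xor addKb. Qed.

Lemma nbit_exists (b : nat -> bool) N :
  exists n, forall j, nbit n j = (j < N)%N && b j.
Proof.
elim: N => [|N [n Hn]]; first by exists 0%N => j; rewrite PeanoNat.Nat.bits_0.
have step j : (j < N.+1)%N && b j = (N == j) && b N || (j < N)%N && b j.
  rewrite ltnS leq_eqVlt eq_sym; case: eqP => [<-|_] //=.
  by rewrite ltnn orbF.
case bN: (b N); last first.
  by exists n => j; rewrite Hn step bN andbF.
exists (PeanoNat.Nat.setbit n N) => j.
rewrite PeanoNat.Nat.setbit_eqb Hn step bN andbT; congr (_ || _).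
Qed.

(** The numbers with at most [N] binary digits, a finite subgroup under bitwise
    addition. *)
Definition low N k := forall j, (N <= j)%N -> nbit k j = false.

Lemma low_exists k : exists N, forall M, (N <= M)%N -> low M k.
Proof.
exists (PeanoNat.Nat.log2 k).+1 => M NM j Mj.
apply: PeanoNat.Nat.bits_above_log2. apply/ssrnat.ltP.
exact: leq_trans NM Mj.
Qed.

Lemma low_bounded N : exists M, forall k, low N k -> (k < M)%N.
Proof.
exists (PeanoNat.Nat.pow 2 N).+1 => k lk; rewrite ltnS leqNgt; apply/negP => /ssrnat.ltP h.
have k0 : k <> 0%N by move=> e; move: h; rewrite e => /ssrnat.ltP.
have kpos : (0 < k)%coq_nat by apply/ssrnat.ltP; rewrite lt0n; apply/eqP.
have [h2|/ssrnat.ltP h2] := leqP N (PeanoNat.Nat.log2 k).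
  by have := PeanoNat.Nat.bit_log2 _ k0; rewrite lk.
have /ssrnat.ltP := (PeanoNat.Nat.log2_lt_pow2 _ _ kpos).2 h2.
by rewrite ltnNge => /negP; apply; apply/ssrnat.leP/PeanoNat.Nat.lt_le_incl.
Qed.

Lemma low_xor N a b : low N a -> low N b -> low N (nxor a b).
Proof. by move=> la lb j Nj; rewrite nbit_xor la// lb. Qed.

Section ComplexFunctions.
Context {R : realType} {d : measure_display} {T : measurableType d}.
Variables (D : set T).
Implicit Types (f g : T -> R[i]).

Lemma ltC_norm (e : R) (z : R[i]) : 0 < e ->
  (e%:C < `|z|) = (e ^+ 2 < complex.Re z ^+ 2 + complex.Im z ^+ 2).
Proof.
move=> e0; rewrite normc_def ltcR -{1}(ger0_norm (ltW e0)) -sqrtr_sqr.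
set b := _ + _; have [b0|b0] := ltP 0 b; first by rewrite ltr_sqrt.
rewrite (ler0_sqrtr b0) !ltNge sqrtr_ge0 /=.
by rewrite (le_trans b0)// sqr_ge0.
Qed.

Lemma cmeasurable_norm_gt f (e : R) : measurable D -> 0 < e -> cmeasurable D f ->
  measurable [set x | D x /\ e%:C < `|f x|].
Proof.
move=> mD e0 [fr fi].
have mg : measurable_fun D (fun x => complex.Re (f x) ^+ 2 + complex.Im (f x) ^+ 2).
  by apply: measurable_funD; apply: measurable_funX.
have := mg mD _ (measurable_itv `]e ^+ 2, +oo[%R).
congr measurable; apply/seteqP; split=> x /= [Dx].
  by rewrite in_itv/= andbT => H; split=> //; rewrite ltC_norm.
by rewrite ltC_norm// => H; split=> //; rewrite in_itv/= H.
Qed.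

Lemma cmeasurableD f g : cmeasurable D f -> cmeasurable D g ->
  cmeasurable D (fun x => f x + g x).
Proof.
move=> [fr fi] [gr gi]; split.
  rewrite (_ : (fun x => _) = fun x => complex.Re (f x) + complex.Re (g x)).
    exact: measurable_funD.
  by apply/funext => x; rewrite raddfD.
rewrite (_ : (fun x => _) = fun x => complex.Im (f x) + complex.Im (g x)).
  exact: measurable_funD.
by apply/funext => x; rewrite raddfD.
Qed.

Lemma cmeasurableB f g : cmeasurable D f -> cmeasurable D g ->
  cmeasurable D (fun x => f x - g x).
Proof.
move=> [fr fi] [gr gi]; split.
  rewrite (_ : (fun x => _) = fun x => complex.Re (f x) - complex.Re (g x)).
    exact: measurable_funB.
  by apply/funext => x; rewrite raddfB.
rewrite (_ : (fun x => _) = fun x => complex.Im (f x) - complex.Im (g x)).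
  exact: measurable_funB.
by apply/funext => x; rewrite raddfB.
Qed.

Lemma cmeasurable_cst (c : R[i]) : cmeasurable D (fun=> c).
Proof. by split; exact: measurable_cst. Qed.

Lemma cmeasurable_sum k (h : 'I_k -> T -> R[i]) :
  (forall i, cmeasurable D (h i)) -> cmeasurable D (fun x => \sum_(i < k) h i x).
Proof.
elim: k h => [|k IH] h mh.
  rewrite (_ : (fun x => _) = fun=> 0); first exact: cmeasurable_cst.
  by apply/funext => x; rewrite big_ord0.
rewrite (_ : (fun x => _) = fun x => \sum_(i < k) h (widen_ord (leqnSn k) i) x + h ord_max x).
  by apply: cmeasurableD => //; exact: IH.
by apply/funext => x; rewrite big_ord_recr.
Qed.

Lemma cmeasurableS f (E : set T) : measurable E -> D `<=` E -> cmeasurable E f ->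
  cmeasurable D f.
Proof.
move=> mE DE [fr fi].
by split; [exact: (measurable_funS mE DE fr)|exact: (measurable_funS mE DE fi)].
Qed.

Lemma cmeasurable_comp d' (T' : measurableType d') (p : T -> T') (f : T' -> R[i]) :
  measurable_fun D p -> cmeasurable setT f -> cmeasurable D (f \o p).
Proof.
move=> mp [fr fi].
by split; [exact: (measurableT_comp fr mp)|exact: (measurableT_comp fi mp)].
Qed.

End ComplexFunctions.

(** * Translations by tail equivalent bit sequences *)

Section XorRepresentation.
Context {R : realType} {d : measure_display} {X : measurableType d}.
Variables (mu : probability X R) (Rel : set (X * X)).
Hypothesis X_standard : standard_borel R X.
Hypothesis Rel_equivalence : borel_equivalence Rel.
Hypothesis Rel_discrete : discrete mu Rel.
Hypothesis Rel_pmp : measure_preserving mu Rel.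
Variable F : nat -> X -> bool.
Hypothesis mF : forall k, measurable [set x | F k x].
Hypothesis F_tail : {ae mu, forall x, forall y, Rel (x, y) ->
  exists N, forall k, (N <= k)%N -> F k x = F k y}.

Let mRel : measurable Rel := Rel_equivalence.1.
Local Notation H := (l2_hilbert R).
Local Notation l2 := (l2 R).

Let fib (x : X) : hilbert R := H.
Let l2_meas : set (forall x, fib x) :=
  [set xi | forall k, cmeasurable setT (fun x => (xi x : l2) k)].

Let l2_meas_inner xi eta : l2_meas xi -> l2_meas eta ->
  cmeasurable setT (fun x => inner (fib x) (xi x) (eta x)).
Proof. by move=> mx me; exact: cmeasurable_l2_inner. Qed.

Let l2_meas_max eta :
  (forall xi, l2_meas xi ->
    cmeasurable setT (fun x => inner (fib x) (xi x) (eta x))) -> l2_meas eta.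
Proof.
move=> H k.
have mk : l2_meas (fun=> l2_delta R k).
  by move=> j; exact: cmeasurable_cst.
have := cmeasurable_mul_conj (cmeasurable_cst setT 1) (H _ mk).
congr cmeasurable; apply/funext => x; rewrite mul1r.
by rewrite [inner _ _ _]l2_inner_delta conjCK.
Qed.

Let l2_meas_total : exists2 xi : nat -> forall x, fib x,
  forall n, l2_meas (xi n) &
  {ae mu, forall x, closure (lin_span (fun n => xi n x)) = setT}.
Proof.
exists (fun n _ => l2_delta R n); first by move=> n k; exact: cmeasurable_cst.
apply: aeW => x; apply/seteqP; split=> // v _; exact: l2_span_delta.
Qed.

Definition l2_field : measurable_field mu :=
  MeasurableField l2_meas_inner l2_meas_max l2_meas_total.

Definition tail_eq x y := exists N, forall k, (N <= k)%N -> F k x = F k y.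

Lemma tail_eq_sym x y : tail_eq x y -> tail_eq y x.
Proof. by move=> [N HN]; exists N => k /HN. Qed.

Lemma tail_eq_trans x y z : tail_eq x y -> tail_eq y z -> tail_eq x z.
Proof.
move=> [N HN] [M HM]; exists (maxn N M) => k; rewrite geq_max => /andP[Nk Mk].
by rewrite HN// HM.
Qed.

(** The natural number whose binary digits tell where two tail equivalent
    binary sequences differ. *)
Lemma xor_cocycle_exists : exists w : X -> X -> nat,
  (forall x y, tail_eq x y -> forall j, nbit (w x y) j = F j x (+) F j y) /\
  (forall x y, ~ tail_eq x y -> w x y = 0%N).
Proof.
have /choice[w wP] : forall p : X * X, exists n,
    (tail_eq p.1 p.2 -> forall j, nbit n j = F j p.1 (+) F j p.2) /\
    (~ tail_eq p.1 p.2 -> n = 0%N).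
  move=> [x y] /=; have [[N HN]|n] := pselect (tail_eq x y); last by exists 0%N.
  have [n Hn] := nbit_exists (fun j => F j x (+) F j y) N.
  exists n; split=> [_ j|[]]; last by exists N.
  by rewrite Hn; case: ltnP => // /HN ->; rewrite addbb.
exists (fun x y => w (x, y)); split=> x y; first exact: (wP (x, y)).1.
exact: (wP (x, y)).2.
Qed.

Definition xor_cocycle : X -> X -> nat := projT1 (cid xor_cocycle_exists).
Local Notation w := xor_cocycle.

Lemma xor_cocycleE x y : tail_eq x y -> forall j, nbit (w x y) j = F j x (+) F j y.
Proof. by rewrite /w; case: cid => w0 [h _] /=; exact: h. Qed.

Lemma xor_cocycle0 x y : ~ tail_eq x y -> w x y = 0%N.
Proof. by rewrite /w; case: cid => w0 [_ h] /=; exact: h. Qed.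

Definition prefix N x : nat := projT1 (cid (nbit_exists (F^~ x) N)).

Lemma prefixE N x j : nbit (prefix N x) j = (j < N)%N && F j x.
Proof. by rewrite /prefix; case: cid. Qed.

Let mF1 k : measurable [set p : X * X | F k p.1].
Proof.
by have := @measurable_fst _ _ X X measurableT _ (mF k); rewrite setTI.
Qed.
Let mF2 k : measurable [set p : X * X | F k p.2].
Proof.
by have := @measurable_snd _ _ X X measurableT _ (mF k); rewrite setTI.
Qed.

Let m_eqb (d' : measure_display) (T : measurableType d') (b c : T -> bool) :
  measurable [set x | b x] -> measurable [set x | c x] ->
  measurable [set x | b x = c x].
Proof.
move=> mb mc; rewrite (_ : [set x | _] = ([set x | b x] `&` [set x | c x]) `|`
   (~` [set x | b x] `&` ~` [set x | c x])).
  by apply: measurableU; apply: measurableI => //; exact: measurableC.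
apply/seteqP; split=> x /=; first by move=> ->; case: (c x); [left|right].
by case: (b x) (c x) => -[] // [[]|[]].
Qed.

Let m_cst (d' : measure_display) (T : measurableType d') (P : Prop) :
  measurable [set x : T | P].
Proof.
by have [p|p] := pselect P; [rewrite (_ : [set x | _] = setT)|
  rewrite (_ : [set x | _] = set0)]; rewrite ?measurableT//; apply/seteqP; split.
Qed.

Lemma measurable_settled N :
  measurable [set p : X * X | forall k, (N <= k)%N -> F k p.1 = F k p.2].
Proof.
by apply: measurable_forall => k; apply: measurable_imply; exact: m_eqb.
Qed.

Lemma measurable_tail_eq : measurable [set p : X * X | tail_eq p.1 p.2].
Proof. by apply: measurable_exists => N; exact: measurable_settled. Qed.

Lemma measurable_xor_cocycle n : measurable [set p : X * X | w p.1 p.2 = n].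
Proof.
rewrite (_ : [set p | _] = ([set p : X * X | tail_eq p.1 p.2] `&`
    [set p | forall j, nbit n j = F j p.1 (+) F j p.2]) `|`
    (~` [set p : X * X | tail_eq p.1 p.2] `&` [set p | n = 0%N])).
  apply: measurableU; apply: measurableI.
  - exact: measurable_tail_eq.
  - apply: measurable_forall => j; apply: m_eqb; first exact: m_cst.
    rewrite (_ : [set p | _] = ~` [set p : X * X | F j p.1 = F j p.2]).
      by apply: measurableC; exact: m_eqb.
    apply/seteqP; split=> p /=; first by move=> + e; rewrite e addbb.
    by move=> e; rewrite -negb_eqb; apply/eqP.
  - by apply: measurableC; exact: measurable_tail_eq.
  - exact: m_cst.
apply/seteqP; split=> [[x y] /= <-|[x y] /=].
  have [t|t] := pselect (tail_eq x y); first by left; split=> // j; exact: xor_cocycleE.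
  by right; split=> //; exact: xor_cocycle0.
case=> [[t e]|[t ->]]; last exact: xor_cocycle0.
by apply: nbit_inj => j; rewrite xor_cocycleE.
Qed.

Lemma measurable_prefix N n : measurable [set x | prefix N x = n].
Proof.
rewrite (_ : [set x | _] = [set x | forall j, nbit n j = (j < N)%N && F j x]).
  apply: measurable_forall => j; apply: m_eqb; first exact: m_cst.
  case: (j < N)%N => /=; first exact: mF.
  by rewrite (_ : [set x | _] = set0)//; apply/seteqP; split.
apply/seteqP; split=> x /= e; first by move=> j; rewrite -e prefixE.
by apply: nbit_inj => j; rewrite prefixE e.
Qed.

Let rmap (x y : X) (v : l2_field y) : l2_field x :=
  l2_reindex (@nxorK (w x y)) (v : l2).

Let rmap_unitary x y : Rel (x, y) -> unitary (@rmap x y).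
Proof. by move=> _; exact: l2_reindex_unitary. Qed.

Let meas_coord1 (xi : forall x, l2_field x) k : meas xi ->
  cmeasurable (setT : set (X * X)) (fun p => (xi p.1 : l2) k).
Proof.
by move=> mx; exact: (cmeasurable_comp (@measurable_fst _ _ X X) (mx k)).
Qed.

Let meas_coord2 (xi : forall x, l2_field x) k : meas xi ->
  cmeasurable (setT : set (X * X)) (fun p => (xi p.2 : l2) k).
Proof.
by move=> mx; exact: (cmeasurable_comp (@measurable_snd _ _ X X) (mx k)).
Qed.

Let rmap_measurable (xi eta : forall x, l2_field x) : meas xi -> meas eta ->
  cmeasurable Rel (fun p : X * X =>
    inner (l2_field p.1) (rmap p.1 (xi p.2)) (eta p.1)).
Proof.
move=> mx me; apply: (@cmeasurableS _ _ _ _ _ setT) => //.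
apply: cmeasurable_l2_inner => // k; last exact: meas_coord1.
apply: (@cmeasurable_index R _ _ setT measurableT (fun p => w p.1 p.2)
   (fun n p => (xi p.2 : l2) (nxor n k))).
- exact: measurable_xor_cocycle.
- by move=> n; exact: meas_coord2.
Qed.

Let rmap_cocycle : {ae mu, forall x, forall y z, Rel (x, y) -> Rel (x, z) ->
  forall v : l2_field z, rmap x (rmap y v) = rmap x v}.
Proof.
apply: filterS F_tail => x Hx y z Rxy Rxz v; apply: l2_ext => k /=.
congr ((v : l2) _); apply: nbit_inj => j.
have txy : tail_eq x y := Hx _ Rxy.
have txz : tail_eq x z := Hx _ Rxz.
have tyz : tail_eq y z by apply: tail_eq_trans txz; exact: tail_eq_sym.
rewrite !nbit_xor !xor_cocycleE//.
by case: (F j x) (F j y) (F j z) (nbit k j) => [] [] [] [].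
Qed.

Definition xor_rep : unitary_rep mu Rel :=
  UnitaryRep rmap_unitary rmap_measurable rmap_cocycle.

Lemma xor_rep_coefE (xi : forall x, xor_rep x) p :
  rep_coef xi p = l2_inner (l2_reindex (@nxorK (w p.1 p.2)) (xi p.2)) (xi p.1).
Proof. by []. Qed.

Lemma L2_coefE (xi : forall x, L2_rep mu Rel x) p :
  rep_coef xi p = (xi p.2 : R[i]) * Num.conj (xi p.1 : R[i]).
Proof. by []. Qed.

(** Unit vectors invariant under larger and larger finite subgroups of the
    group of natural numbers under bitwise addition: this group is amenable. *)
Lemma low_invariant_vector N : exists v : l2, l2_inner v v = 1 /\
  forall a, low N a -> forall k, v (nxor a k) = v k.
Proof.
have [M HM] := low_bounded N.
pose u : l2 := l2_fin (fun k => if `[< low N k >] then 1 else 0) M.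
have uE k : u k = if `[< low N k >] then 1 else 0.
  rewrite /u /= /cutoff; case: ltnP => // Mk; case: asboolP => // /HM.
  by rewrite ltnNge Mk.
have c0 : 0 < rip u u.
  apply: (@lt_le_trans _ _ 1) => //.
  apply: le_trans (rterm_le_rip 0 (l2_sqsum u)).
  have -> : rterm u u 0 = 1; last by [].
  rewrite /rterm uE asboolT ?mulr1 ?mulr0 ?addr0// => j _.
  exact: PeanoNat.Nat.bits_0.
pose s : R := (Num.sqrt (rip u u))^-1.
exists (s%:C *: u); split=> [|a la k].
  rewrite l2_innerZ l2_innerC l2_innerZ rmorphM /= -l2_innerC l2_inner_self.
  apply/eqP; rewrite eq_complex /=; apply/andP; split; apply/eqP; last ring.
  have : s ^+ 2 * rip u u = 1.
    by rewrite /s exprVn sqr_sqrtr ?ltW// mulVf// gt_eqF.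
  move=> <-; ring.
have -> : (s%:C *: u : l2) (nxor a k) = s%:C * u (nxor a k) by [].
have -> : (s%:C *: u : l2) k = s%:C * u k by [].
rewrite !uE; have -> // : `[< low N (nxor a k) >] = `[< low N k >].
apply: asbool_equiv_eq; split; last exact: low_xor.
by move=> /(low_xor la); rewrite nxorK.
Qed.

(** On all but a small part of [Q] the cocycle takes values in the finite subgroup
    [low N], which fixes the vector [v]; multiply functions by [v]. *)
Lemma L2_contained_xor : weakly_contained (L2_rep mu Rel) xor_rep.
Proof.
move=> Q mQ QR Qoo xi mxi e e0.
have mB n : measurable (Q `&` [set p : X * X | ~ low n (w p.1 p.2)]).
  apply: measurableI => //.
  exact: (measurable_fiber (fun m => ~ low n m) measurable_xor_cocycle).
have [N /(_ N (leqnn N)) HN] := mu_rel_cvg0 X_standard Rel_equivalence Rel_discrete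
   Rel_pmp QR Qoo mB (fun n => @subIsetl _ _ _) (aeW mu (fun x y _ =>
     let: ex_intro N HN := low_exists (w x y) in
     ex_intro _ N (fun n Nn (h : _ /\ _) => h.2 (HN n Nn)))) e0.
have [v [v1 vinv]] := low_invariant_vector N.
exists 1%N, (fun _ x => (xi x : R[i]) *: v); split.
  move=> _ k /=.
  rewrite (_ : (fun x => _) = fun x => v k * (xi x : R[i])).
    exact: cmeasurable_scale mxi.
  by apply/funext => x; rewrite mulrC.
apply: le_lt_trans HN; apply: mu_rel_le => p [Qp] /= He; split=> // lw.
move: He; rewrite big_ord1 xor_rep_coefE L2_coefE.
have -> : l2_reindex (@nxorK (w p.1 p.2)) ((xi p.2 : R[i]) *: v : l2) = (xi p.2 : R[i]) *: v.
  apply: l2_ext => k.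
  have -> : ((xi p.2 : R[i]) *: v : l2) k = (xi p.2 : R[i]) * v k by [].
  by rewrite -(vinv _ lw).
rewrite l2_innerZ l2_innerC l2_innerZ rmorphM /= -l2_innerC v1 mulr1 subrr normr0.
by rewrite ltcR ltNge ltW.
Qed.

Lemma l2_inner_partial (u v : l2) (e : R) : 0 < e -> exists M, forall m, (M <= m)%N ->
  ~ (e%:C < `|l2_inner u v - \sum_(j < m) u j * Num.conj (v j)|).
Proof.
move=> e0; have e2 : 0 < e / 2 by rewrite divr_gt0.
have su := l2_sqsum u; have sv := l2_sqsum v; have siv := l2_sqsum ('i *: v : l2).
have /cvgrPdist_lt/(_ _ e2)[M _ HM] := rterm_cvg su sv.
have /cvgrPdist_lt/(_ _ e2)[N _ HN] := rterm_cvg su siv.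
exists (maxn M N) => m; rewrite geq_max => /andP[Mm Nm].
have -> : \sum_(j < m) u j * Num.conj (v j) =
    (series (rterm u v) m) +i* (series (rterm u ('i *: v : l2)) m).
  have iv k : ('i *: v : l2) k = 'i * v k by [].
  have rt j : u j * Num.conj (v j) = rterm u v j +i* rterm u ('i *: v : l2) j.
    rewrite /rterm iv; case: (u j) (v j) => [a b] [a' b'].
    by apply/eqP; rewrite eq_complex /=; apply/andP; split; apply/eqP; ring.
  rewrite (eq_bigr _ (fun (j : 'I_m) _ => rt j)) /series /= !big_mkord.
  elim: m {Mm Nm} => [|m IH]; first by rewrite !big_ord0.
  by rewrite !big_ord_recr /= IH.
move=> /lt_le_trans h; suff /h : `|l2_inner u v - (series (rterm u v) m) +i*
    (series (rterm u ('i *: v : l2)) m)| <= e%:C by rewrite ltxx.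
apply: le_trans (normC_le_ReIm _) _.
rewrite lecR [leRHS]splitr; apply: lerD; apply: ltW.
  exact: HM Mm.
exact: HN Nm.
Qed.

(** Where the bits agree from the [N]-th on, the cocycle is the coboundary of
    [prefix N]. Untwisting by it turns the coefficient into the plain inner product
    of the sections, which is a series of coefficients of the trivial
    representation. *)
Lemma xor_contained_L2 : weakly_contained xor_rep (L2_rep mu Rel).
Proof.
move=> Q mQ QR Qoo xi mxi e e0; have e2 : 0 < e / 2 by rewrite divr_gt0.
have mB1 n : measurable (Q `&` ~` [set p : X * X | forall k, (n <= k)%N -> F k p.1 = F k p.2]).
  by apply: measurableI => //; apply: measurableC; exact: measurable_settled.
have tl : {ae mu, forall x, forall y, Rel (x, y) -> exists N, forall n, (N <= n)%N ->
    ~ (Q `&` ~` [set p : X * X | forall k, (n <= k)%N -> F k p.1 = F k p.2]) (x, y)}.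
  apply: filterS F_tail => x Hx y /Hx[N HN]; exists N => n Nn [_] /=; apply => k nk.
  by apply: HN; exact: leq_trans nk.
have [N /(_ N (leqnn N)) HN] := mu_rel_cvg0 X_standard Rel_equivalence Rel_discrete
   Rel_pmp QR Qoo mB1 (fun n => @subIsetl _ _ _) tl e2.
pose P x : l2 := l2_reindex (@nxorK (prefix N x)) (xi x).
have mP k : cmeasurable setT (fun x => P x k).
  apply: (@cmeasurable_index R _ _ setT measurableT (prefix N)
    (fun n x => (xi x : l2) (nxor n k))) => n; first exact: measurable_prefix.
  exact: mxi.
have mP1 k : cmeasurable (setT : set (X * X)) (fun p => P p.1 k).
  exact: (cmeasurable_comp (@measurable_fst _ _ X X) (mP k)).
have mP2 k : cmeasurable (setT : set (X * X)) (fun p => P p.2 k).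
  exact: (cmeasurable_comp (@measurable_snd _ _ X X) (mP k)).
pose D m (p : X * X) := l2_inner (P p.2) (P p.1) - \sum_(j < m) P p.2 j * Num.conj (P p.1 j).
have mB2 m : measurable (Q `&` [set p | setT p /\ (e / 2)%:C < `|D m p|]).
  apply: measurableI => //; apply: cmeasurable_norm_gt => //.
  apply: cmeasurableB; first exact: cmeasurable_l2_inner.
  by apply: cmeasurable_sum => j; exact: cmeasurable_mul_conj.
have tl2 : {ae mu, forall x, forall y, Rel (x, y) -> exists M, forall m, (M <= m)%N ->
    ~ (Q `&` [set p | setT p /\ (e / 2)%:C < `|D m p|]) (x, y)}.
  apply: aeW => x y _; have [M HM] := l2_inner_partial (P y) (P x) e2.
  by exists M => m Mm [_ [_]]; exact: HM.
have [M /(_ M (leqnn M)) HM] := mu_rel_cvg0 X_standard Rel_equivalence Rel_discrete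
   Rel_pmp QR Qoo mB2 (fun n => @subIsetl _ _ _) tl2 e2.
exists M, (fun j x => P x j : L2_rep mu Rel x); split; first by move=> j; exact: mP.
have -> : e%:E = ((e / 2)%:E + (e / 2)%:E)%E by rewrite -EFinD -splitr.
apply: le_lt_trans (lteD HN HM).
apply: le_trans (mu_relU X_standard Rel_equivalence Rel_discrete Rel_pmp (mB1 N) (mB2 M) _ _).
- apply: mu_rel_le => p [Qp He].
  have [settled|] := pselect (forall k, (N <= k)%N -> F k p.1 = F k p.2); last by left.
  right; split=> //; split=> //; apply: (@le_lt_trans _ _ e%:C).
    by rewrite lecR; lra.
  apply: lt_le_trans He _; rewrite le_eqVlt; apply/orP; left; apply/eqP.
  congr (`| _ - _ |); rewrite xor_rep_coefE.
  have [_ h _] := l2_reindex_unitary R (@nxorK (prefix N p.1)).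
  rewrite -[LHS]h; congr l2_inner; apply: l2_ext => k.
  have -> : P p.2 k = (xi p.2 : l2) (nxor (prefix N p.2) k) by [].
  change ((xi p.2 : l2) (nxor (w p.1 p.2) (nxor (prefix N p.1) k)) =
    (xi p.2 : l2) (nxor (prefix N p.2) k)).
  congr ((xi p.2 : l2) _); apply: nbit_inj => j.
  rewrite !nbit_xor !prefixE xor_cocycleE; last by exists N.
  case: ltnP => [jN|/settled ->]; last by rewrite addbb.
  by case: (F j p.1) (F j p.2) (nbit k j) => [] [] [].
- by apply: subset_trans QR; exact: subIsetl.
- by apply: subset_trans QR; exact: subIsetl.
Qed.

End XorRepresentation.

(** * Invariant sets and functions *)

Section ErgodicSets.
Context {R : realType} {d : measure_display} {X : measurableType d}.
Variables (mu : probability X R) (Rel : set (X * X)).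
Hypothesis X_standard : standard_borel R X.
Hypothesis Rel_equivalence : borel_equivalence Rel.
Hypothesis Rel_discrete : discrete mu Rel.
Hypothesis Rel_pmp : measure_preserving mu Rel.
Hypothesis Rel_ergodic : ergodic mu Rel.

Lemma fg_preim_measurable (g : full_group mu Rel) (S : set X) :
  measurable S -> measurable [set x | S (g x)].
Proof. by apply: measurable_preim; exact: fg_fun_measurable. Qed.

Lemma fg_image (g : full_group mu Rel) (S : set X) :
  g @` S = [set x | S (fg_inv g x)].
Proof.
apply/seteqP; split=> [_ [x Sx <-] /=|x /= Sx]; first by rewrite fg_funK.
by exists (fg_inv g x) => //; rewrite fg_invK.
Qed.

Lemma fg_image_measurable (g : full_group mu Rel) (S : set X) :
  measurable S -> measurable (g @` S).
Proof.
by move=> mS; rewrite fg_image; apply: measurable_preim => //; exact: fg_inv_measurable.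
Qed.

Lemma measurable_symdiff (A B : set X) : measurable A -> measurable B ->
  measurable (A `+` B).
Proof. by move=> mA mB; apply: measurableU; apply: measurableD. Qed.

(** With [g] applied to points rather than to the set: the points that enter or
    leave [S] when [g] is applied. *)
Definition moved (g : X -> X) (S : set X) : set X := [set x | S (g x)] `+` S.

Lemma pr_moved (g : full_group mu Rel) (S : set X) : measurable S ->
  pr mu ((g @` S) `+` S) = pr mu (moved g S).
Proof.
move=> mS.
have mI := fg_image_measurable g mS.
rewrite -(pr_fg X_standard Rel_equivalence Rel_pmp g (measurable_symdiff mI mS)).
congr (pr mu _); rewrite fg_image /moved; apply/seteqP; split=> x /=;
  rewrite fg_funK; tauto.
Qed.

Lemma measurable_moved (g : full_group mu Rel) (S : set X) : measurable S ->
  measurable (moved g S).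
Proof. by move=> mS; apply: measurable_symdiff => //; exact: fg_preim_measurable. Qed.

Lemma ergodic_ae (S : set X) : measurable S ->
  (forall g : full_group mu Rel, {ae mu, forall x, S x <-> S (fg_inv g x)}) ->
  pr mu S = 0 \/ pr mu S = 1.
Proof.
move=> mS inv; rewrite /pr; have [g|->|->] := Rel_ergodic mS; [|by left|by right].
have mD := measurable_symdiff (fg_image_measurable g mS) mS.
apply: pr_eq0 => //; apply: pr_ae0 => //; apply: filterS (inv g) => x.
rewrite fg_image => -[h1 h2] [[/= h3 h4]|[/= h3 h4]].
  by apply: h4; exact: h2.
by apply: h4; exact: h1.
Qed.

(** The sublevel sets are null or conull; the constant is the infimum of the
    levels at which they are conull. *)
Lemma ergodic_constant (f : X -> R) : measurable_fun setT f ->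
  (forall g : full_group mu Rel, {ae mu, forall x, f x = f (fg_inv g x)}) ->
  exists c, {ae mu, forall x, f x = c}.
Proof.
move=> mf inv.
pose S (a : R) := [set x | f x <= a].
have mS a : measurable (S a).
  rewrite (_ : S a = setT `&` f @^-1` `]-oo, a]%classic); first exact: mf.
  by apply/seteqP; split=> [x /=|x /= []]; rewrite in_itv.
have S01 a : pr mu (S a) = 0 \/ pr mu (S a) = 1.
  apply: ergodic_ae => // g; apply: filterS (inv g) => x.
  by rewrite /S /= => ->.
pose A := [set a : R | pr mu (S a) = 1].
have Smono a b : a <= b -> pr mu (S a) <= pr mu (S b).
  by move=> ab; apply: pr_le => // x /le_trans; apply.
have full (B : nat -> set X) : (forall n, measurable (B n)) ->
    (forall n, pr mu (B n) = 0) -> ~ (forall x, exists n, B n x).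
  move=> mB B0 cov.
  have : {ae mu, forall x, forall n, ~ B n x} by apply: ae_foralln => n; exact: ae_pr0.
  have T0 : 0 < pr mu setT by rewrite prT.
  by move=> /(pr_pos_ex measurableT T0)[x _ Hx]; have [n] := cov x; exact: Hx.
have [a0 Aa0] : A !=set0.
  apply: contrapT => nA; apply: (full (fun n => S n%:R)) => // [n|x].
    by case: (S01 n%:R) => // h; case: nA; exists n%:R.
  exists (Num.trunc `|f x|).+1; rewrite /S /=.
  by apply: (le_trans (ler_norm _)); apply: ltW; exact: truncnS_gt.
have [b0 Hb0] : exists b, lbound A b.
  apply: contrapT => nB; apply: (full (fun n => ~` S (- n%:R))) => [n|n|x].
  - exact: measurableC.
  - rewrite prC//; case: (S01 (- n%:R)) => [h|->]; last by rewrite subrr.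
    case: nB; exists (- n%:R) => a Aa; rewrite leNgt; apply/negP => /ltW/Smono.
    by rewrite h Aa ler10.
  exists (Num.trunc `|f x|).+1; rewrite /S /=; apply/negP; rewrite -ltNge.
  rewrite ltrNl; apply: le_lt_trans (truncnS_gt _).
  by rewrite -normrN ler_norm.
have hA : has_inf A by split; [exists a0|exists b0].
exists (inf A).
have up n : {ae mu, forall x, f x <= inf A + n.+1%:R^-1}.
  have n0 : 0 < n.+1%:R^-1 :> R by rewrite invr_gt0.
  have [a Aa lt] := inf_adherent n0 hA.
  have : pr mu (~` S a) = 0 by rewrite prC// Aa subrr.
  move=> /(ae_pr0 (measurableC (mS a))); apply: filterS => x /contrapT fa.
  exact: le_trans fa (ltW lt).
have lo n : {ae mu, forall x, inf A - n.+1%:R^-1 < f x}.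
  have n0 : 0 < n.+1%:R^-1 :> R by rewrite invr_gt0.
  have : pr mu (S (inf A - n.+1%:R^-1)) = 0.
    case: (S01 (inf A - n.+1%:R^-1)) => // h.
    by have := ge_inf hA.2 h; rewrite lerDl oppr_ge0 leNgt n0.
  move=> /(ae_pr0 (mS _)); apply: filterS => x /negP; by rewrite -ltNge.
have /ae_foralln up' := up; have /ae_foralln lo' := lo.
apply: filterS2 up' lo' => x ux lx; apply/eqP; rewrite eq_le; apply/andP; split.
  apply/ler_addgt0Pr => e e0.
  have [n _ ne] : \forall n \near \oo, n.+1%:R^-1 < e :> R.
    by apply: (near_infty_natSinv_lt (PosNum e0)).
  by apply: le_trans (ux n) _; rewrite lerD2l ltW// ne/=.
apply/ler_addgt0Pr => e e0.
have [n _ ne] : \forall n \near \oo, n.+1%:R^-1 < e :> R.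
  by apply: (near_infty_natSinv_lt (PosNum e0)).
rewrite -lerBlDr; apply: le_trans (ltW (lx n)).
by rewrite lerD2l lerN2 ltW// ne/=.
Qed.

End ErgodicSets.

(** * Invariant sections and atoms *)

Section NoEmbedding.
Context {R : realType} {d : measure_display} {X : measurableType d}.
Variables (mu : probability X R) (Rel : set (X * X)).
Hypothesis X_standard : standard_borel R X.
Hypothesis Rel_equivalence : borel_equivalence Rel.
Hypothesis Rel_discrete : discrete mu Rel.
Hypothesis Rel_pmp : measure_preserving mu Rel.
Hypothesis Rel_ergodic : ergodic mu Rel.
Variable F : nat -> X -> bool.
Hypothesis mF : forall k, measurable [set x | F k x].
Hypothesis F_tail : {ae mu, forall x, forall y, Rel (x, y) ->
  exists N, forall k, (N <= k)%N -> F k x = F k y}.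

Local Notation l2 := (l2 R).
Local Notation pi := (xor_rep mF F_tail).

Lemma measurable_bits (n : nat) (b : nat -> bool) (c : nat -> bool) :
  measurable [set x | forall j, (j < n)%N -> F j x (+) c j = b j].
Proof.
apply: measurable_forall => j; apply: measurable_imply.
suff mb (e e' : bool) : measurable [set x | F j x (+) e = e'] by exact: mb.
have mC := measurableC (mF j).
rewrite (_ : [set x | _] = if e (+) e' then [set x | F j x] else ~` [set x | F j x]).
  by case: ifP.
by apply/seteqP; split=> x /=; case: e e' => -[] /=; case: (F j x).
Qed.

Lemma measurable_pattern (b : nat -> bool) : measurable [set x | forall k, F k x = b k].
Proof.
rewrite (_ : [set x | _] = [set x | forall n,
    [set x | forall j, (j < n)%N -> F j x (+) false = b j] x]).
  by apply: measurable_forall => n; exact: (measurable_bits n b (fun=> false)).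
apply/seteqP; split=> x /= H => [n j _|k]; first by rewrite addbF.
by have := H k.+1 k (ltnSn k); rewrite addbF.
Qed.

(** Translate the bits [F x] by the indices of the coordinates of [xi x] that are
    larger than a fixed bound: which finite patterns occur among the results is
    invariant, hence almost everywhere the same. Only finitely many coordinates
    are large, so some fixed sequence [b] is itself a translate of almost every
    [F x], and there are only countably many translates of [b]. *)
Lemma invariant_section_atom (xi : forall x, pi x) : meas xi ->
  (forall g : full_group mu Rel,
    {ae mu, forall x, xi x = full_group_act g xi x}) ->
  ~ {ae mu, forall x, xi x = 0} ->
  exists b : nat -> bool, 0 < pr mu [set x | forall k, F k x = b k].
Proof.
move=> mxi inv nz.
pose large (n k : nat) := [set x | n.+1%:R^-1 < rterm (xi x : l2) (xi x : l2) k].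
have mlarge n k : measurable (large n k).
  have [fr fi] := mxi k.
  have mg : measurable_fun setT (fun x => rterm (xi x : l2) (xi x : l2) k).
    by apply: measurable_funD; apply: measurable_funM.
  rewrite (_ : large n k = setT `&` (fun x => rterm (xi x : l2) (xi x : l2) k) @^-1`
    `]n.+1%:R^-1, +oo[%classic); first exact: mg.
  by apply/seteqP; split=> [x /=|x /= []]; rewrite in_itv/= andbT.
pose S (sn : seq bool * nat) := [set x | exists k, (large sn.2 k `&`
  [set x | forall j, (j < size sn.1)%N -> F j x (+) nbit k j = nth false sn.1 j]) x].
have mS sn : measurable (S sn).
  apply: measurable_exists => k; apply: measurableI => //.
  exact: (measurable_bits _ (nth false sn.1)).
have S01 sn : pr mu (S sn) = 0 \/ pr mu (S sn) = 1.
  apply: (ergodic_ae Rel_ergodic) => // g.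
  apply: filterS2 (filterI F_tail (inv g)) (fg_inv_rel X_standard Rel_equivalence Rel_pmp g).
  move=> x [tx ix] rx; set y := fg_inv g x in ix rx *.
  have txy : tail_eq F x y := tx _ rx.
  have xy k : (xi x : l2) k = (xi y : l2) (nxor (xor_cocycle F x y) k).
    by rewrite [xi x]ix.
  have bit k j : F j y (+) nbit (nxor (xor_cocycle F x y) k) j = F j x (+) nbit k j.
    rewrite nbit_xor xor_cocycleE//.
    by case: (F j x) (F j y) (nbit k j) => [] [] [].
  split=> -[k [lk bk]]; exists (nxor (xor_cocycle F x y) k); split.
  - by rewrite /large /= /rterm -xy.
  - by move=> j /bk <-; rewrite bit.
  - by rewrite /large /= /rterm xy nxorK.
  - by move=> j /bk <-; rewrite -bit nxorK.
have [n Sn] : exists n, pr mu (S ([::], n)) = 1.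
  apply: contrapT => nS; apply: nz.
  have : {ae mu, forall x, forall n, ~ S ([::], n) x}.
    apply: ae_foralln => n; apply: ae_pr0 => //.
    by case: (S01 ([::], n)) => // Sn; case: nS; exists n.
  apply: filterS => x nSx; apply: l2_ext => k.
  apply: rterm_eq0; apply/eqP; rewrite eq_le rterm_ge0 andbT leNgt; apply/negP => r0.
  have [n _ ne] : \forall n \near \oo, n.+1%:R^-1 < rterm (xi x : l2) (xi x : l2) k.
    by apply: (near_infty_natSinv_lt (PosNum r0)).
  by apply: (nSx n); exists k; split=> //; exact: (ne n (leqnn n)).
have good : {ae mu, forall x, forall s, S (s, n) x -> pr mu (S (s, n)) = 1}.
  apply: ae_forall_count => s; case: (S01 (s, n)) => h; last exact: aeW.
  by apply: filterS (ae_pr0 (mS _) h).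
have Sn0 : 0 < pr mu (S ([::], n)) by rewrite Sn.
have [x0 [k0 [lk0 _]] Hx0] := pr_pos_ex (mS _) Sn0 good.
pose b j := F j x0 (+) nbit k0 j.
have full : {ae mu, forall x, forall N, S (mkseq b N, n) x}.
  apply: ae_foralln => N.
  have : pr mu (~` S (mkseq b N, n)) = 0.
    rewrite prC//; apply/eqP; rewrite subr_eq0; apply/eqP/esym; apply: Hx0.
    exists k0; split=> // j; rewrite size_mkseq => jN.
    by rewrite nth_mkseq.
  by move=> /(ae_pr0 (measurableC (mS _))); apply: filterS => x /contrapT.
have atoms : {ae mu, forall x, exists k, forall j, F j x = b j (+) nbit k j}.
  apply: filterS full => x Hx.
  have q0 : 0 < n.+1%:R^-1 :> R by rewrite invr_gt0.
  have [N0 HN0] := l2_finite_large (xi x : l2) q0.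
  apply: contrapT => nk.
  have /choice[j jP] : forall k, exists j, F j x (+) nbit k j <> b j.
    move=> k; apply: contrapT => nj; apply: nk; exists k => j.
    have -> : b j = F j x (+) nbit k j.
      by apply: esym; apply: contrapT => h; apply: nj; exists j.
    by rewrite addbK.
  have [k [lk bk]] := Hx (\max_(k < N0) j k).+1.
  have kN : (k < N0)%N.
    rewrite ltnNge; apply/negP => /HN0; apply/negP.
    by rewrite -leNgt ltW.
  apply: (jP k); set M := (\max_(k < N0) j k).+1 in bk.
  have jM : (j k < M)%N by rewrite ltnS (bigD1 (Ordinal kN))//= leq_maxl.
  have := bk (j k); rewrite -[(_, _).1]/(mkseq b M) size_mkseq nth_mkseq//; exact.
apply: contrapT => na.
have T0 : 0 < pr mu setT by rewrite prT.
have null : {ae mu, forall x, forall k, ~ (forall j, F j x = b j (+) nbit k j)}.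
  apply: ae_foralln => k.
  apply: (ae_pr0 (measurable_pattern (fun j => b j (+) nbit k j))).
  apply/eqP; rewrite eq_le pr_ge0 andbT leNgt; apply/negP => h; apply: na.
  by exists (fun j => b j (+) nbit k j).
have [x _ [[k Hk] nk]] := pr_pos_ex measurableT T0 (filterI atoms null).
exact: nk Hk.
Qed.

(** The image of the constant function 1 is an invariant section of norm one. *)
Lemma embedding_atom : embeds (L2_rep mu Rel) pi ->
  exists b : nat -> bool, 0 < pr mu [set x | forall k, F k x = b k].
Proof.
move=> [V [Vdi Vae Vlin Viso] Veq].
pose one : forall x, L2_rep mu Rel x := fun=> (1 : R[i]).
have N1 : L2norm_sqr one = 1%E.
  rewrite /L2norm_sqr (eq_integral (cst 1%E)) => [|x _]; last first.
    have -> // : inner (L2_rep mu Rel x) (one x) (one x) = 1.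
    by rewrite /inner /= /scalar_inner mul1r conjC1.
  rewrite (integral_cst mu measurableT 1) mul1e; exact: probability_setT.
have d1 : direct_integral one.
  by split; [exact: cmeasurable_cst|rewrite N1 ltry].
have [m1 _] := Vdi _ d1.
have L1 : Linfty mu (fun=> 1 : R[i]).
  split; first exact: cmeasurable_cst.
  by exists 1; apply: aeW => x; rewrite normr1.
apply: (invariant_section_atom m1).
  move=> g; have := Veq _ g _ L1 d1.
  have -> : Linfty_act (fun=> 1) (full_group_act g one) = one.
    by apply/funext => x; rewrite /Linfty_act scale1r.
  by apply: filterS => x ->; rewrite /Linfty_act scale1r.
move=> z; have := Viso _ d1; rewrite N1.
suff : (L2norm_sqr (V one) <= 0)%E by move=> + e; rewrite e leNgt lte01.
rewrite -(integral0 mu setT); apply: ae_le_integral => //.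
  by move=> x; rewrite lee_fin [inner _ _ _]l2_inner_self /= rip_ge0//; exact: l2_sqsum.
apply: filterS z => x ->; rewrite lee_fin [inner _ _ _]l2_inner_self /=.
by rewrite (@rip_fin _ _ 0)// big_geq.
Qed.

End NoEmbedding.

(** * Rigidity implies strong ergodicity *)

Section NotStronglyErgodic.
Context {R : realType} {d : measure_display} {X : measurableType d}.
Variables (mu : probability X R) (Rel : set (X * X)).
Hypothesis X_standard : standard_borel R X.
Hypothesis Rel_equivalence : borel_equivalence Rel.
Hypothesis Rel_discrete : discrete mu Rel.
Hypothesis Rel_pmp : measure_preserving mu Rel.
Hypothesis Rel_ergodic : ergodic mu Rel.

Lemma pr_bigU n (A : nat -> set X) : (forall i, measurable (A i)) ->
  measurable [set x | exists2 i, (i < n)%N & A i x] /\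
  pr mu [set x | exists2 i, (i < n)%N & A i x] <= \sum_(i < n) pr mu (A i).
Proof.
move=> mA; elim: n => [|n [mI IH]].
  rewrite big_ord0 (_ : [set x | _] = set0) ?pr0//.
  by apply/seteqP; split=> x // [].
have e : [set x | exists2 i, (i < n.+1)%N & A i x] =
    [set x | exists2 i, (i < n)%N & A i x] `|` A n.
  apply/seteqP; split=> x /=.
    move=> [i + Ai]; rewrite ltnS leq_eqVlt => /predU1P[e|lt].
      by right; rewrite -e.
    by left; exists i.
  move=> [[i lt Ai]|An]; last by exists n.
  by exists i => //; exact: ltnW.
rewrite e big_ord_recr/=; split; first exact: measurableU.
by apply: le_trans (pr_setU mu mI (mA n)) _; rewrite lerD2r.
Qed.

Lemma borel_cantelli (A : nat -> set X) : (forall k, measurable (A k)) ->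
  forall i, (forall k, (i <= k)%N -> pr mu (A k) <= 2 ^- k) ->
  {ae mu, forall x, exists N, forall k, (N <= k)%N -> ~ A k x}.
Proof.
move=> mA i Ai.
pose L n := [set x | exists k, ([set x | (n <= k)%N] `&` A k) x].
have m_cst (P : Prop) : measurable [set x : X | P].
  by have [p|p] := pselect P; [rewrite (_ : [set x | _] = setT)|
    rewrite (_ : [set x | _] = set0)]; rewrite ?measurableT//; apply/seteqP; split.
have mL n : measurable (L n).
  by apply: measurable_exists => k; apply: measurableI.
have tail n : (i <= n)%N -> pr mu (L n) <= 2 * 2 ^- n.
  move=> ni; rewrite leNgt; apply/negP => lt.
  pose P m := [set x | exists2 j, (j < m)%N & A (n + j)%N x].
  have mP m : measurable (P m) by case: (pr_bigU m (fun j => mA (n + j)%N)).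
  have Pb m : pr mu (P m) <= 2 * 2 ^- n.
    case: (pr_bigU m (fun j => mA (n + j)%N)) => _ /le_trans; apply.
    apply: (@le_trans _ _ (\sum_(j < m) 2 ^- (n + j)%N)).
      by apply: ler_sum => j _; apply: Ai; rewrite (leq_trans ni)// leq_addr.
    suff -> : \sum_(j < m) 2 ^- (n + j)%N = 2 * 2 ^- n - 2 * 2 ^- (n + m)%N :> R.
      by rewrite gerBl mulr_ge0// invr_ge0 exprn_ge0.
    elim: m => [|m IH]; first by rewrite big_ord0 addn0 subrr.
    rewrite big_ord_recr/= IH addnS exprS invfM.
    by move: (2 ^+ (n + m))^-1 => t; lra.
  have : mu \o P @ \oo --> mu (\bigcup_m P m).
    apply: nondecreasing_cvg_mu => //; first exact: bigcupT_measurable.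
    by move=> a b ab; apply/subsetPset => x [j ja Aj]; exists j => //; exact: leq_trans ab.
  have -> : \bigcup_m P m = L n.
    apply/seteqP; split=> [x [m _ [j jm Aj]]|x [k [nk Ak]]].
      by exists (n + j)%N; split=> //=; rewrite leq_addr.
    by exists (k - n).+1 => //; exists (k - n)%N => //; rewrite subnKC.
  rewrite (prE mu (mL n)) => /fine_cvgP[_] cv.
  suff : pr mu (L n) <= 2 * 2 ^- n by rewrite leNgt lt.
  apply: (closed_cvg (fun t : R => t <= 2 * 2 ^- n) _ _ _ cv); first exact: closed_le.
  by apply: nearW => m; exact: Pb.
pose Z := [set x | forall n, L n x].
have mZ : measurable Z by exact: measurable_forall.
have Z0 : pr mu Z = 0.
  apply/eqP; rewrite eq_le pr_ge0 andbT; apply/ler_addgt0Pr => e e0; rewrite add0r.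
  have e2 : 0 < e / 2 by rewrite divr_gt0.
  have : (fun n => 2 ^- n) @ \oo --> (0 : R).
    under eq_fun do rewrite -exprVn.
    by apply: cvg_expr; rewrite ger0_norm ?invf_lt1 ?invr_ge0// ltr1n.
  move=> /cvgrPdist_lt/(_ _ e2)[N _ HN]; pose n := maxn N i.
  have := HN n (leq_maxl _ _); rewrite /= sub0r normrN gtr0_norm ?invr_gt0 ?exprn_gt0// => h.
  apply: (@le_trans _ _ (pr mu (L n))); first by apply: pr_le => // x; apply.
  apply: le_trans (tail n (leq_maxr _ _)) _; lra.
apply: filterS (ae_pr0 mZ Z0) => x nZ; apply: contrapT => H; apply: nZ => n.
apply: contrapT => nL; apply: H; exists n => k nk Ak; apply: nL.
by exists k.
Qed.

(** The saturation of a set of positive measure is everything, and finitely many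
    elements of the full group already carry the set almost everywhere. *)
Lemma translates_cover (g : nat -> full_group mu Rel) (A : set X) :
  (forall i x, Rel (x, g i x)) ->
  {ae mu, forall x, forall y, Rel (x, y) -> exists i, g i x = y} ->
  measurable A -> 0 < pr mu A -> forall e : R, 0 < e ->
  exists n, 1 - e < pr mu [set x | exists2 i, (i < n)%N & A (g i x)].
Proof.
move=> gR gP mA A0 e e0.
pose P n := [set x | exists2 i, (i < n)%N & A (g i x)].
have mgA i : measurable [set x | A (g i x)] by exact: fg_preim_measurable.
have mP n : measurable (P n) by case: (pr_bigU n mgA).
have mU : measurable (\bigcup_n P n) by exact: bigcupT_measurable.
have sat : {ae mu, forall x, (\bigcup_n P n) x <-> exists2 y, Rel (x, y) & A y}.
  apply: filterS gP => x gx; split=> [[n _ [i _ Ai]]|[y Rxy Ay]].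
    by exists (g i x).
  by have [i gi] := gx y Rxy; exists i.+1 => //; exists i => //; rewrite gi.
have U1 : pr mu (\bigcup_n P n) = 1.
  have [h| |//] := ergodic_ae Rel_ergodic mU; last first.
    move=> U0; suff : pr mu A = 0 by move=> e'; rewrite e' ltxx in A0.
    apply: pr_ae0 => //; apply: filterS2 sat (ae_pr0 mU U0) => x sx nU Ax; apply: nU.
    by apply/sx; exists x => //; exact: (Rel_refl Rel_equivalence).
  have ri := fg_inv_rel X_standard Rel_equivalence Rel_pmp h.
  have si := ae_fg_inv X_standard Rel_equivalence Rel_pmp h sat.
  apply: filterS2 sat (filterI ri si) => x sx [Rx sy].
  have Ry := Rel_sym Rel_equivalence Rx.
  split=> [/sx[y Rxy Ay]|/sy[y Ryy Ay]].
    by apply/sy; exists y => //; exact: (Rel_trans Rel_equivalence Ry Rxy).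
  by apply/sx; exists y => //; exact: (Rel_trans Rel_equivalence Rx Ryy).
have : mu \o P @ \oo --> mu (\bigcup_m P m).
  apply: nondecreasing_cvg_mu => //.
  by move=> a b ab; apply/subsetPset => x [j ja Aj]; exists j => //; exact: leq_trans ab.
rewrite (prE mu mU) U1 => /fine_cvgP[_] /cvgrPdist_lt/(_ _ e0)[N _ HN].
exists N; have := HN N (leqnn N); rewrite /= => h.
have := le_lt_trans (ler_norm _) h; rewrite -/(pr mu (P N)) -/(P N); lra.
Qed.

Lemma moved_sym (g : X -> X) (S : set X) x : ~ moved g S x -> S x <-> S (g x).
Proof.
by move=> H; split=> h; apply: contrapT => h'; apply: H; [right|left].
Qed.

Lemma rigid_strongly_ergodic :
  (forall pi : unitary_rep mu Rel,
    weakly_equivalent (L2_rep mu Rel) pi -> embeds (L2_rep mu Rel) pi) ->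
  strongly_ergodic mu Rel.
Proof.
move=> rigid E mE Einv.
pose a n := pr mu (E n) * (1 - pr mu (E n)).
have aE n : (mu (E n) * (1 - mu (E n)) = (a n)%:E)%E.
  by rewrite (prE mu (mE n)) EFinM EFinB.
rewrite (eq_cvg _ _ aE); apply/fine_cvgP; split; first by apply: nearW.
have a0 n : 0 <= a n.
  by rewrite mulr_ge0 ?pr_ge0// subr_ge0; exact: pr_le1.
apply: contrapT => na.
have [c c0 Hc] : exists2 c : R, 0 < c & forall N, exists2 n, (N <= n)%N & c <= a n.
  apply: contrapT => nc; apply: na; apply/cvgrPdist_lt => e e0.
  apply: contrapT => nN; apply: nc; exists e => // N; apply: contrapT => nn.
  apply: nN; exists N => // n Nn /=; rewrite sub0r normrN ger0_norm//.
  by rewrite ltNge; apply/negP => en; apply: nn; exists n.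
have [g [gR _] gP] := full_group_cover X_standard Rel_equivalence Rel_discrete Rel_pmp.
have mM i n : measurable (moved (g i) (E n)) by exact: measurable_moved.
(* The first [k] maps move the [k]-th set of the subsequence by at most [2 ^- k],
   so that Borel-Cantelli applies to each map. *)
have /choice[n nP] : forall k, exists n, c <= a n /\
    forall i, (i < k.+1)%N -> pr mu (moved (g i) (E n)) <= 2 ^- k.
  move=> k; have k0 : 0 < 2 ^- k :> R by rewrite invr_gt0 exprn_gt0.
  have [N HN] : exists N, forall m, (N <= m)%N -> forall i, (i < k.+1)%N ->
      pr mu (moved (g i) (E m)) <= 2 ^- k.
    elim: k.+1 => [|j [N IH]]; first by exists 0%N.
    have := Einv (g j); move=> /fine_cvgP[_] /cvgrPdist_lt/(_ _ k0)[M _ HM].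
    exists (maxn N M) => m; rewrite geq_max => /andP[Nm Mm] i.
    rewrite ltnS leq_eqVlt => /predU1P[->|/(IH m Nm)//].
    have := HM m Mm; rewrite /= sub0r normrN => /(le_lt_trans (ler_norm _)).
    by rewrite -/(pr mu _) pr_moved// => /ltW.
  have [m Nm cm] := Hc N; exists m; split=> //; exact: HN.
pose F k x : bool := `[< E (n k) x >].
have mF k : measurable [set x | F k x].
  rewrite (_ : [set x | _] = E (n k)); first exact: mE.
  by apply/seteqP; split=> x /= /asboolP.
have F_tail : {ae mu, forall x, forall y, Rel (x, y) ->
    exists N, forall k, (N <= k)%N -> F k x = F k y}.
  have tl : {ae mu, forall x, forall i, exists N, forall k, (N <= k)%N ->
      ~ moved (g i) (E (n k)) x}.
    apply: ae_foralln => i; apply: (@borel_cantelli _ _ i) => // k ik.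
    by have [_] := nP k; apply.
  apply: filterS2 gP tl => x gx tx y /gx[i <-]; have [N HN] := tx i.
  exists N => k Nk; apply: asbool_equiv_eq; exact: (moved_sym (HN k Nk)).
have weq : weakly_equivalent (L2_rep mu Rel) (xor_rep mF F_tail).
  split; first exact: L2_contained_xor.
  exact: xor_contained_L2.
have [b b0] := embedding_atom X_standard Rel_equivalence Rel_pmp Rel_ergodic (rigid _ weq).
set A := [set x | _] in b0.
have mA : measurable A by exact: measurable_pattern.
have c4 : 0 < c / 4 by rewrite divr_gt0.
have [I HI] := translates_cover gR gP mA b0 c4.
set T := [set x | _] in HI.
have mgA i : measurable [set x | A (g i x)] by exact: fg_preim_measurable.
have mT : measurable T by case: (pr_bigU I mgA).
have [k [Ik kc]] : exists k, (I <= k)%N /\ I%:R * 2 ^- k < c / 4 :> R.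
  have : (fun k => I%:R * 2 ^- k) @ \oo --> (I%:R * 0 : R).
    apply: cvgMr; under eq_fun do rewrite -exprVn.
    by apply: cvg_expr; rewrite ger0_norm ?invf_lt1 ?invr_ge0// ltr1n.
  rewrite mulr0 => /cvgrPdist_lt/(_ _ c4)[N _ HN]; exists (maxn N I).
  split; first exact: leq_maxr.
  have := HN (maxn N I) (leq_maxl _ _); rewrite /= sub0r normrN.
  by move=> /(le_lt_trans (ler_norm _)).
pose M := [set x | exists2 i, (i < I)%N & moved (g i) (E (n k)) x].
have [mMM prM] := pr_bigU I (fun i => mM i (n k)); rewrite -/M in mMM prM.
have prM' : pr mu M < c / 4.
  apply: le_lt_trans kc; apply: (le_trans prM).
  apply: (@le_trans _ _ (\sum_(i < I) 2 ^- k)).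
    apply: ler_sum => i _; have [_] := nP k; apply.
    by rewrite ltnS; apply: leq_trans (ltnW (ltn_ord i)) Ik.
  by rewrite sumr_const card_ord mulr_natl.
have mTC := measurableC mT.
have bound B : measurable B -> (forall x, T x -> ~ M x -> B x) -> 1 - c / 2 < pr mu B.
  move=> mB TB.
  have mBC := measurableC mB.
  have : pr mu (~` B) <= pr mu (~` T `|` M).
    apply: pr_le => //; first exact: measurableU.
    move=> x nB; have [Tx|] := pselect (T x); last by left.
    by right; apply: contrapT => nM; exact: nB (TB x Tx nM).
  move=> /le_trans/(_ (pr_setU mu mTC mMM)); rewrite !prC//.
  lra.
have [ca _] := nP k; rewrite /a in ca.
have p1 := pr_le1 mu (mE (n k)); have p0 := pr_ge0 mu (E (n k)).
case bk: (b k).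
  have := bound _ (mE (n k)) => h.
  have {}h : 1 - c / 2 < pr mu (E (n k)).
    apply: h => x [i iI Ax] nMx; have nm : ~ moved (g i) (E (n k)) x.
      by move=> mx; apply: nMx; exists i.
    by apply/(moved_sym nm); have := Ax k; rewrite bk => /asboolP.
  nra.
have {}h : 1 - c / 2 < pr mu (~` E (n k)).
  apply: bound; first exact: measurableC.
  move=> x [i iI Ax] nMx; have nm : ~ moved (g i) (E (n k)) x.
    by move=> mx; apply: nMx; exists i.
  by move=> /(moved_sym nm) Ex; have := Ax k; rewrite bk => /asboolP.
rewrite prC// in h; nra.
Qed.

End NotStronglyErgodic.

(** * Real inner products and convergence in Hilbert spaces *)

Section HilbertKit.
Variables (R : realType) (H : hilbert R).
Implicit Types (u v w : H) (c : nat -> H).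

(** The real part suffices for convergence and correlations, and is real valued. *)
Definition hip u v : R := complex.Re (inner H u v).

Lemma innerC u v : inner H u v = Num.conj (inner H v u).
Proof. by rewrite (hermC (inner H)) expr0 mul1r. Qed.

Lemma hipC u v : hip u v = hip v u.
Proof. by rewrite /hip innerC; case: (inner H v u). Qed.

Lemma hipDl u v w : hip (u + v) w = hip u w + hip v w.
Proof. by rewrite /hip linearDl raddfD. Qed.

Lemma hipDr u v w : hip w (u + v) = hip w u + hip w v.
Proof. by rewrite hipC hipDl !(hipC _ w). Qed.

Lemma innerZl (a : R[i]) u v : inner H (a *: u) v = a * inner H u v.
Proof. by rewrite linearZl_LR. Qed.

Lemma innerZr (a : R[i]) u v : inner H u (a *: v) = Num.conj a * inner H u v.
Proof. by rewrite linearZr_LR. Qed.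

Lemma hipZl (a : R) u v : hip (a%:C *: u) v = a * hip u v.
Proof.
rewrite /hip innerZl; case: (inner H u v) => x y /=; ring.
Qed.

Lemma hipZr (a : R) u v : hip u (a%:C *: v) = a * hip u v.
Proof. by rewrite hipC hipZl hipC. Qed.

Lemma hipNl u v : hip (- u) v = - hip u v.
Proof.
have -> : - u = (-1 : R)%:C *: u by rewrite rmorphN1 scaleN1r.
by rewrite hipZl mulN1r.
Qed.

Lemma hipNr u v : hip u (- v) = - hip u v.
Proof. by rewrite hipC hipNl hipC. Qed.

Lemma hip0l v : hip 0 v = 0.
Proof. by have := hipDl 0 0 v; rewrite addr0 => h; lra. Qed.

Lemma hip0r v : hip v 0 = 0. Proof. by rewrite hipC hip0l. Qed.

Lemma hip_ge0 u : 0 <= hip u u.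
Proof.
rewrite /hip; have := dnorm_ge0 (inner H) u.
by case: (inner H u u) => a b; rewrite lecE /= => /andP[].
Qed.

Lemma inner_self u : inner H u u = (hip u u)%:C.
Proof.
rewrite /hip; have := dnorm_ge0 (inner H) u.
by case: (inner H u u) => a b; rewrite lecE /= => /andP[/eqP ->].
Qed.

Lemma hip_eq0 u : hip u u = 0 -> u = 0.
Proof.
move=> u0; apply/eqP; rewrite -(dnorm_eq0 (inner H)) inner_self u0.
by rewrite eqxx.
Qed.

Lemma normE u : `|u| = (Num.sqrt (hip u u))%:C.
Proof.
have : `|u| ^+ 2 = (Num.sqrt (hip u u))%:C ^+ 2.
  by rewrite inner_norm inner_self -rmorphXn /= sqr_sqrtr// hip_ge0.
move=> /eqP; rewrite eqrXn2//; first by move/eqP.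
by rewrite lecR sqrtr_ge0.
Qed.

Lemma hip_subD u v : hip (u - v) (u - v) = hip u u + hip v v - 2 * hip u v.
Proof.
by rewrite hipDl !hipDr !hipNl !hipNr (hipC v u); ring.
Qed.

Lemma hip_addD u v : hip (u + v) (u + v) = hip u u + hip v v + 2 * hip u v.
Proof. by rewrite hipDl !hipDr (hipC v u); ring. Qed.

Lemma hip_le_mean u v (t : R) : 0 < t -> 2 * hip u v <= t * hip u u + t^-1 * hip v v.
Proof.
move=> t0; have := hip_ge0 (t%:C *: u - v).
rewrite hip_subD hipZl hipZr hipZl => h.
have : 0 <= t^-1 * (t * (t * hip u u) + hip v v - 2 * (t * hip u v)).
  by rewrite mulr_ge0// invr_ge0 ltW.
have -> : t^-1 * (t * (t * hip u u) + hip v v - 2 * (t * hip u v)) =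
    t * hip u u + t^-1 * hip v v - 2 * hip u v.
  by field; rewrite gt_eqF.
by rewrite subr_ge0.
Qed.

Lemma hip_abs_le u v : `|2 * hip u v| <= hip u u + hip v v.
Proof.
have h1 := hip_ge0 (u - v); have h2 := hip_ge0 (u + v).
rewrite hip_subD in h1; rewrite hip_addD in h2.
by rewrite ler_norml; apply/andP; split; lra.
Qed.

Lemma hip_add_le u v : hip (u + v) (u + v) <= 2 * hip u u + 2 * hip v v.
Proof. by have := hip_ge0 (u - v); rewrite hip_subD hip_addD => h; lra. Qed.

(** Convergence in norm, stated with real squared norms. *)
Definition hlim c u := forall e : R, 0 < e ->
  exists N, forall n, (N <= n)%N -> hip (u - c n) (u - c n) <= e.

Lemma hlim_hip c u v : hlim c u -> forall e : R, 0 < e ->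
  exists N, forall n, (N <= n)%N -> `|hip v u - hip v (c n)| <= e.
Proof.
move=> cu e e0.
pose m := hip v v + 1.
have m0 : 0 < m by rewrite ltr_wpDl ?hip_ge0.
have [|N HN] := cu (e * (e / m)); first by rewrite mulr_gt0// divr_gt0.
exists N => n Nn; have {HN} := HN n Nn; set w := u - c n => hw.
have -> : hip v u - hip v (c n) = hip v w by rewrite /w hipDr hipNr.
have em : 0 < e / m by rewrite divr_gt0.
have me : 0 < m / e by rewrite divr_gt0.
have bound v' : hip v' v' = hip v v -> hip v' w <= e.
  move=> v'v; have := hip_le_mean v' w em; rewrite v'v invf_div => h.
  have h1 : e / m * hip v v <= e.
    by rewrite -mulrA ler_piMr ?ltW// mulrC ltr_pdivrMr// mul1r /m ltrDl.
  have h2 : m / e * hip w w <= e.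
    apply: le_trans (ler_wpM2l (ltW me) hw) _.
    by rewrite le_eqVlt; apply/orP; left; apply/eqP; field; rewrite !gt_eqF.
  lra.
rewrite ler_norml bound// andbT.
have := bound (- v); rewrite hipNl hipNr hipNl opprK => /(_ erefl).
by rewrite lerNl.
Qed.

Lemma hlimB c c' u u' : hlim c u -> hlim c' u' -> hlim (fun n => c n - c' n) (u - u').
Proof.
move=> cu cu' e e0; have e4 : 0 < e / 4 by rewrite divr_gt0.
have [N HN] := cu _ e4; have [M HM] := cu' _ e4.
exists (maxn N M) => n; rewrite geq_max => /andP[/HN h1 /HM h2].
have -> : u - u' - (c n - c' n) = (u - c n) + - (u' - c' n).
  by rewrite !opprB [c' n - c n]addrC addrACA [- u' + _]addrC.
apply: le_trans (hip_add_le _ _) _; rewrite hipNl hipNr opprK; lra.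
Qed.

Lemma hlim_le c u (M : R) : hlim c u -> (forall n, hip (c n) (c n) <= M) ->
  hip u u <= M.
Proof.
move=> cu cM.
have M0 : 0 <= M by apply: le_trans (cM 0%N); exact: hip_ge0.
apply/ler_addgt0Pr => e e0.
have e2 : 0 < e / 2 by rewrite divr_gt0.
have [N HN] := hlim_hip u cu e2; have h1 := HN N (leqnn N).
have [K HK] := cu _ e2; have h2 := HK (maxn N K) (leq_maxr _ _).
have h3 := HN (maxn N K) (leq_maxl _ _).
set w := c (maxn N K) in h2 h3; have h4 : hip w w <= M by exact: cM.
move: h3; rewrite ler_norml => /andP[_ h3].
have h5 := hip_ge0 (u - w).
have h6 : 2 * hip u w <= hip u u + hip w w.
  by have := hip_abs_le u w; rewrite ler_norml => /andP[].
lra.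
Qed.

(** Completeness for geometrically decaying increments, whose norms are at most
    [2 ^- n]. *)
Lemma hlim_exists c : (exists N, forall n, (N <= n)%N ->
    hip (c n.+1 - c n) (c n.+1 - c n) <= (4 ^- n : R)) -> exists u, hlim c u.
Proof.
move=> [N HN].
have step n : (N <= n)%N -> `|c n.+1 - c n| <= (2 ^- n : R)%:C.
  move=> /HN h; rewrite normE lecR.
  rewrite -[leRHS]ger0_norm ?invr_ge0 ?exprn_ge0// -sqrtr_sqr ler_wsqrtr//.
  apply: le_trans h _.
  by rewrite -exprVn -exprVn -exprM mulnC exprM expr2 -invfM -natrM.
have tele n k : (N <= n)%N -> `|c (n + k)%N - c n| <= (2 * 2 ^- n - 2 * 2 ^- (n + k) : R)%:C.
  move=> Nn; elim: k => [|k IH]; first by rewrite addn0 !subrr normr0.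
  rewrite addnS -(subrKA (c (n + k)%N)); apply: le_trans (ler_normD _ _) _.
  apply: le_trans (lerD (step _ _) IH) _; first by rewrite (leq_trans Nn)// leq_addr.
  rewrite -rmorphD lecR exprS invfM.
  by move: (2 ^- (n + k)) (2 ^- n) => s t; lra.
have small (e : R) : 0 < e -> exists M, (N <= M)%N /\ 2 * 2 ^- M < e.
  move=> e0; have e2 : 0 < e / 2 by rewrite divr_gt0.
  have : (fun n => 2 ^- n) @ \oo --> (0 : R).
    under eq_fun do rewrite -exprVn.
    by apply: cvg_expr; rewrite ger0_norm ?invf_lt1 ?invr_ge0// ltr1n.
  move=> /cvgrPdist_lt/(_ _ e2)[M _ HM]; exists (maxn N M); rewrite leq_maxl; split=> //.
  have := HM _ (leq_maxr N M); rewrite /= sub0r normrN gtr0_norm ?invr_gt0 ?exprn_gt0// => h.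
  by move: h; lra.
have bound n m : (N <= n)%N -> (n <= m)%N -> `|c m - c n| <= (2 * 2 ^- n : R)%:C.
  move=> Nn nm; rewrite -(subnKC nm); apply: le_trans (tele _ _ Nn) _.
  by rewrite lecR gerBl mulr_ge0// invr_ge0 exprn_ge0.
have cv : cvg (c @ \oo).
  apply: cauchy_cvg; apply: cauchy_exP => e /gt0C[e0 ->].
  have [M [NM He]] := small _ e0; exists (c M); exists M => // m /= Mm.
  rewrite -ball_normE /= distrC; apply: le_lt_trans (bound _ _ NM Mm) _.
  by rewrite ltcR.
exists (lim (c @ \oo)) => e e0.
have se : 0 < Num.sqrt e by rewrite sqrtr_gt0.
have seC : 0 < (Num.sqrt e)%:C by rewrite ltcR.
have /cvgrPdist_le/(_ _ seC)[M _ HM] := cv.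
exists M => n Mn; have := HM n Mn; rewrite /= normE lecR => h.
by rewrite -(sqr_sqrtr (ltW e0)) -[leLHS]sqr_sqrtr ?hip_ge0// ler_sqr ?nnegrE ?sqrtr_ge0.
Qed.

End HilbertKit.

Section UnitaryKit.
Variables (R : realType) (H K : hilbert R) (U : H -> K).
Hypothesis uU : unitary U.

Lemma unitary_hip u v : hip (U u) (U v) = hip u v.
Proof. by case: uU => _ h _; rewrite /hip h. Qed.

Lemma unitaryP (a : R[i]) u v : U (a *: u + v) = a *: U u + U v.
Proof. by case: uU => h _ _; rewrite h. Qed.

Lemma unitary0 : U 0 = 0.
Proof.
have := unitaryP (-1) 0 0; rewrite scaler0 addr0 scaleN1r addrC subrr; exact.
Qed.

Lemma unitaryZ (a : R[i]) u : U (a *: u) = a *: U u.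
Proof. by have := unitaryP a u 0; rewrite unitary0 !addr0. Qed.

Lemma unitaryD u v : U (u + v) = U u + U v.
Proof. by have := unitaryP 1 u v; rewrite !scale1r. Qed.

Lemma unitaryB u v : U (u - v) = U u - U v.
Proof. by rewrite unitaryD -scaleN1r unitaryZ scaleN1r. Qed.

Lemma unitary_hlim c u : hlim c u -> hlim (fun n => U (c n)) (U u).
Proof.
by move=> cu e /cu[N HN]; exists N => n /HN; rewrite -unitaryB unitary_hip.
Qed.

End UnitaryKit.

(** * Means of bounded measurable functions *)

Section Mean.
Context {R : realType} {d : measure_display} {X : measurableType d}.
Variable mu : probability X R.
Implicit Types (f g : X -> R).

(** The algebra on which means are total and linear. *)
Definition bounded_measurable f :=
  measurable_fun setT f /\ exists M, forall x, `|f x| <= M.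
Local Notation bm := bounded_measurable.

Definition mean f : R := (\int[mu]_x f x)%R.

Lemma bm_cst c : bm (fun=> c).
Proof. by split; [exact: measurable_cst|exists `|c|]. Qed.

Lemma bmD f g : bm f -> bm g -> bm (fun x => f x + g x).
Proof.
move=> [mf [M fM]] [mg [N gN]]; split; first exact: measurable_funD.
by exists (M + N) => x; rewrite (le_trans (ler_normD _ _))// lerD.
Qed.

Lemma bmM f g : bm f -> bm g -> bm (fun x => f x * g x).
Proof.
move=> [mf [M fM]] [mg [N gN]]; split; first exact: measurable_funM.
by exists (M * N) => x; rewrite normrM ler_pM.
Qed.

Lemma bmZ c f : bm f -> bm (fun x => c * f x).
Proof. by move=> bf; apply: bmM => //; exact: bm_cst. Qed.

Lemma bmN f : bm f -> bm (fun x => - f x).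
Proof. by move=> bf; under eq_fun do rewrite -mulN1r; exact: bmZ. Qed.

Lemma bmB f g : bm f -> bm g -> bm (fun x => f x - g x).
Proof. by move=> bf bg; apply: bmD => //; exact: bmN. Qed.

Lemma bmX n f : bm f -> bm (fun x => f x ^+ n).
Proof.
move=> bf; elim: n => [|n IH]; first by under eq_fun do rewrite expr0; exact: bm_cst.
by under eq_fun do rewrite exprS; exact: bmM.
Qed.

Lemma bm_sum (I : Type) (s : seq I) (F : I -> X -> R) : (forall i, bm (F i)) ->
  bm (fun x => \sum_(i <- s) F i x).
Proof.
move=> bF; elim: s => [|i s IH].
  by under eq_fun do rewrite big_nil; exact: bm_cst.
by under eq_fun do rewrite big_cons; exact: bmD.
Qed.

Lemma bm_comp f (p : X -> X) : bm f -> measurable_fun setT p -> bm (fun x => f (p x)).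
Proof.
move=> [mf [M fM]] mp; split; first exact: (measurableT_comp mf mp).
by exists M.
Qed.

Lemma bm_indic A : measurable A -> bm (\1_A : X -> R).
Proof.
move=> mA; split; first exact: measurable_indic.
by exists 1 => x; rewrite indicE; case: (_ \in _); rewrite /= ?normr1 ?normr0.
Qed.

Lemma bm_integrable f : bm f -> mu.-integrable setT (EFin \o f).
Proof.
move=> [mf [M fM]]; apply: measurable_bounded_integrable => //.
  by rewrite (le_lt_trans (probability_le1 _ _))// ltry.
exists M; split; first exact: num_real.
by move=> K MK x _; exact: le_trans (fM x) (ltW MK).
Qed.

Lemma meanE f : bm f -> (\int[mu]_x (f x)%:E)%E = (mean f)%:E.
Proof.
move=> bf; rewrite /mean /Rintegral fineK//.
exact: integrable_fin_num (bm_integrable bf).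
Qed.

Lemma mean_cst c : mean (fun=> c) = c.
Proof. by rewrite /mean Rintegral_cst// -[fine _]/(pr mu setT) prT mulr1. Qed.

Lemma meanD f g : bm f -> bm g -> mean (fun x => f x + g x) = mean f + mean g.
Proof. by move=> bf bg; rewrite /mean RintegralD//; exact: bm_integrable. Qed.

Lemma meanZ c f : bm f -> mean (fun x => c * f x) = c * mean f.
Proof. by move=> bf; rewrite /mean RintegralZl//; exact: bm_integrable. Qed.

Lemma meanN f : bm f -> mean (fun x => - f x) = - mean f.
Proof. by move=> bf; under eq_fun do rewrite -mulN1r; rewrite meanZ// mulN1r. Qed.

Lemma meanB f g : bm f -> bm g -> mean (fun x => f x - g x) = mean f - mean g.
Proof. by move=> bf bg; rewrite meanD ?meanN//; exact: bmN. Qed.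

Lemma mean_sum (I : Type) (s : seq I) (F : I -> X -> R) : (forall i, bm (F i)) ->
  mean (fun x => \sum_(i <- s) F i x) = \sum_(i <- s) mean (F i).
Proof.
move=> bF; elim: s => [|i s IH].
  by under eq_fun do rewrite big_nil; rewrite mean_cst big_nil.
under eq_fun do rewrite big_cons.
by rewrite meanD// ?IH ?big_cons//; exact: bm_sum.
Qed.

Lemma mean_le f g : bm f -> bm g -> (forall x, f x <= g x) -> mean f <= mean g.
Proof.
by move=> bf bg fg; apply: le_Rintegral => //; exact: bm_integrable.
Qed.

Lemma mean_ge0 f : (forall x, 0 <= f x) -> 0 <= mean f.
Proof. by move=> f0; apply: Rintegral_ge0. Qed.

Lemma mean_ae_eq f g : bm f -> bm g -> {ae mu, forall x, f x = g x} -> mean f = mean g.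
Proof.
move=> [mf _] [mg _] fg; rewrite /mean /Rintegral; congr fine.
apply: ae_eq_integral => //; [exact/measurable_EFinP|exact/measurable_EFinP|].
by apply: filterS fg => x fgx _; rewrite fgx.
Qed.

Lemma mean_indic A : measurable A -> mean (\1_A) = pr mu A.
Proof. by move=> mA; rewrite /mean /Rintegral integral_indic// setIT. Qed.

Lemma mean_eq0 f : bm f -> (forall x, 0 <= f x) -> mean f = 0 -> {ae mu, forall x, f x = 0}.
Proof.
move=> bf f0 mf0.
have h : (\int[mu]_x `|(f x)%:E| = 0)%E.
  by rewrite -[RHS]/(0%:E) -mf0 -meanE//; apply: eq_integral => x _; rewrite abse_EFin ger0_norm.
have := (ae_eq_integral_abs mu measurableT (f := EFin \o f) _).1.
move=> /(_ _ h) []; first by apply/measurable_EFinP; exact: bf.1.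
move=> N [mN N0 hN]; exists N; split=> // x /= fx; apply: hN => /= /(_ I) [].
exact: fx.
Qed.

Lemma markov_pr f t : bm f -> (forall x, 0 <= f x) -> 0 < t ->
  measurable [set x | t < f x] /\ pr mu [set x | t < f x] <= mean f / t.
Proof.
move=> bf f0 t0.
have mA : measurable [set x | t < f x].
  have := (bf.1 : measurable_fun setT f) measurableT _ (measurable_itv `]t, +oo[).
  rewrite setTI; congr measurable; apply/seteqP; split=> x /=.
    by rewrite in_itv /= andbT.
  by rewrite in_itv /= andbT.
have bA : bm (\1_[set x | t < f x] : X -> R) by exact: bm_indic.
split=> //; rewrite ler_pdivlMr// mulrC -mean_indic// -meanZ//.
apply: mean_le => //; first exact: bmZ.
move=> x; rewrite indicE; case: (boolP (x \in _)) => /=; last by rewrite mulr0.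
by rewrite inE /= mulr1 => /ltW.
Qed.

(** Bounded convergence. *)
Lemma mean_cvg (F : nat -> X -> R) f (M : R) : (forall n, bm (F n)) -> bm f ->
  (forall n x, `|F n x| <= M) ->
  {ae mu, forall x, F n x @[n --> \oo] --> f x} ->
  mean (F n) @[n --> \oo] --> mean f.
Proof.
move=> bF bf FM Ff.
have [|||||_ _] := @dominated_convergence _ _ _ mu setT measurableT
  (fun n => EFin \o F n) (EFin \o f) (cst M%:E).
- by move=> n; apply/measurable_EFinP; exact: (bF n).1.
- by apply/measurable_EFinP; exact: bf.1.
- apply: filterS Ff => x Fx _; apply/fine_cvgP; split; [exact: nearW|exact: Fx].
- exact: bm_integrable (bm_cst M).
- by apply: aeW => x n _ /=; rewrite lee_fin.
rewrite /= meanE//.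
rewrite (_ : (fun n => _) = (fun n => (mean (F n))%:E)).
  by move=> /fine_cvgP[_].
by apply/funext => n; rewrite -meanE.
Qed.

End Mean.
Notation bm := bounded_measurable.

Section MeanInvariance.
Context {R : realType} {d : measure_display} {X : measurableType d}
  (mu : probability X R) (Rel : set (X * X)).
Hypotheses (X_standard : standard_borel R X) (Rel_equivalence : borel_equivalence Rel)
  (Rel_pmp : measure_preserving mu Rel).

Lemma mean_preserving (p : X -> X) : measurable_fun setT p ->
  (forall A, measurable A -> mu (p @^-1` A) = mu A) ->
  forall f, bm f -> mean mu (fun x => f (p x)) = mean mu f.
Proof.
move=> mp pp f bf; rewrite /mean /Rintegral; congr fine.
have h := integral_pushforward mp (mu := mu) (D := setT) (f := EFin \o f).
rewrite -[LHS]h//.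
- apply: eq_measure_integral => A mA _; exact: pp.
- by apply/measurable_EFinP; exact: bf.1.
- exact: bm_integrable (bm_comp bf mp).
Qed.

Lemma mean_fg (g : full_group mu Rel) f : bm f -> mean mu (fun x => f (g x)) = mean mu f.
Proof.
apply: mean_preserving; first exact: fg_fun_measurable.
by move=> A mA; exact: (fg_preserving X_standard).
Qed.

Lemma mean_fg_inv (g : full_group mu Rel) f : bm f ->
  mean mu (fun x => f (fg_inv g x)) = mean mu f.
Proof. exact: (mean_fg (fg_opp X_standard Rel_equivalence Rel_pmp g)). Qed.

End MeanInvariance.

(** * Bounded sections and their translates *)

Section Sections.
Context {R : realType} {d : measure_display} {X : measurableType d}
  {mu : probability X R} (F : measurable_field mu).
Implicit Types (xi eta : forall x, F x) (a : X -> R[i]) (f : X -> R).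

Lemma measZ a xi : cmeasurable setT a -> meas xi -> meas (fun x => a x *: xi x).
Proof.
move=> ma mxi; apply: meas_max => eta meta.
under eq_fun do rewrite innerZr mulrC.
exact: cmeasurable_mul_conj (meas_inner meta mxi) ma.
Qed.

Lemma cmeasurable_real f : measurable_fun setT f -> cmeasurable setT (fun x => (f x)%:C).
Proof. by move=> mf; split=> //=; exact: measurable_cst. Qed.

Lemma measZr f xi : measurable_fun setT f -> meas xi ->
  meas (fun x => (f x)%:C *: xi x).
Proof. by move=> mf; apply: measZ; exact: cmeasurable_real. Qed.

Lemma meas_hip xi eta : meas xi -> meas eta ->
  measurable_fun setT (fun x => hip (xi x) (eta x)).
Proof. by move=> mxi meta; case: (meas_inner mxi meta). Qed.

(** Maximality of the family of measurable sections needs only real parts, since the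
    imaginary part is the real part against a rotated section. *)
Lemma meas_by_hip xi :
  (forall eta, meas eta -> measurable_fun setT (fun x => hip (eta x) (xi x))) ->
  meas xi.
Proof.
move=> h; apply: meas_max => eta meta; split; first exact: h.
have mi : meas (fun x => - 'i *: eta x).
  by apply: measZ => //; split; exact: measurable_cst.
have := h _ mi; congr measurable_fun; apply/funext => x.
by rewrite /hip innerZl; case: (inner (F x) (eta x) (xi x)) => b c /=; ring.
Qed.

Lemma measD xi eta : meas xi -> meas eta -> meas (fun x => xi x + eta x).
Proof.
move=> mxi meta; apply: meas_by_hip => zeta mz.
under eq_fun do rewrite hipDr.
by apply: measurable_funD; exact: meas_hip.
Qed.

Lemma meas_if (A : set X) xi : measurable A -> meas xi ->
  meas (fun x => if `[<A x>] then xi x else 0).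
Proof.
move=> mA mxi.
rewrite (_ : (fun x => _) = (fun x => (\1_A x : R)%:C *: xi x)).
  by apply: measZr => //; exact: measurable_indic.
apply/functional_extensionality_dep => x; rewrite indicE.
case: asboolP => Ax; first by rewrite mem_set// scale1r.
by rewrite memNset// scale0r.
Qed.

Lemma meas_hlim (u : nat -> forall x, F x) xi : (forall n, meas (u n)) ->
  (forall x, hlim (fun n => u n x) (xi x)) -> meas xi.
Proof.
move=> mu_ ux; apply: meas_by_hip => eta meta.
apply: (@measurable_fun_cvg _ _ _ _ (fun n x => hip (eta x) (u n x))
    (fun x => hip (eta x) (xi x))).
  by move=> n; exact: meas_hip.
move=> x _; apply/cvgrPdist_le => e e0.
have [N HN] := hlim_hip (eta x) (ux x) e0; exists N => // n /= Nn; exact: HN.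
Qed.

Definition bounded_section xi :=
  meas xi /\ exists M, forall x, hip (xi x) (xi x) <= M.

Lemma bm_hip xi eta : bounded_section xi -> bounded_section eta ->
  bm (fun x => hip (xi x) (eta x)).
Proof.
move=> [mxi [M xM]] [meta [N eN]]; split; first exact: meas_hip.
exists (M + N) => x; apply: le_trans (lerD (xM x) (eN x)).
apply: le_trans (hip_abs_le _ _); rewrite normrM ler_peMl// ger0_norm//.
by rewrite ler1n.
Qed.

Lemma bsD xi eta : bounded_section xi -> bounded_section eta ->
  bounded_section (fun x => xi x + eta x).
Proof.
move=> [mxi [M xM]] [meta [N eN]]; split; first exact: measD.
exists (2 * M + 2 * N) => x; apply: le_trans (hip_add_le _ _) _.
by apply: lerD; rewrite ler_pM2l.
Qed.

Lemma bsZ (c : R) xi : bounded_section xi -> bounded_section (fun x => c%:C *: xi x).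
Proof.
move=> [mxi [M xM]]; split; first by apply: measZr.
exists (c ^+ 2 * M) => x; rewrite hipZl hipZr mulrA -expr2.
by rewrite ler_wpM2l// sqr_ge0.
Qed.

Lemma bsB xi eta : bounded_section xi -> bounded_section eta ->
  bounded_section (fun x => xi x - eta x).
Proof.
move=> bx be; have := bsD bx (bsZ (-1) be); congr bounded_section.
by apply/functional_extensionality_dep => x; rewrite rmorphN1 scaleN1r.
Qed.

End Sections.

Section TruncatedAction.
Context {R : realType} {d : measure_display} {X : measurableType d}
  {mu : probability X R} {Rel : set (X * X)}.
Hypotheses (X_standard : standard_borel R X) (Rel_equivalence : borel_equivalence Rel)
  (Rel_pmp : measure_preserving mu Rel).
Variable pi : unitary_rep mu Rel.
Implicit Types (xi eta : forall x, pi x) (g h : full_group mu Rel).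

(** The action of the full group, set to zero on the null set where the
    representation is not constrained: measurability is then preserved everywhere,
    and not only almost everywhere. *)
Definition actT g xi : forall x, pi x := fun x =>
  if `[<Rel (x, fg_inv g x)>] then full_group_act g xi x else 0.

Lemma measurable_fg_domain g : measurable [set x | Rel (x, fg_inv g x)].
Proof.
exact: measurable_preim2 (@measurable_id _ _ _) (fg_inv_measurable g) Rel_equivalence.1.
Qed.

Lemma measurable_graph_pair g : measurable_fun setT (fun x => (x, fg_inv g x)).
Proof. by apply: measurable_fun_pair => //; exact: fg_inv_measurable. Qed.

Lemma meas_actT g xi : meas xi -> meas (actT g xi).
Proof.
move=> mxi; apply: meas_by_hip => eta meta.
have mD := measurable_fg_domain g.
have [mf _] := rep_measurable mxi meta.
rewrite (_ : (fun x => _) = ((fun p : X * X => complex.Re (inner (pi p.1)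
    (rep_map p.1 (xi p.2)) (eta p.1))) \o (fun x => (x, fg_inv g x)))
    \_ [set x | Rel (x, fg_inv g x)]); last first.
  apply/funext => x; rewrite patchE /actT.
  case: asboolP => Dx; first by rewrite mem_set// hipC.
  by rewrite memNset// hip0r.
apply: (measurable_restrictT _ mD).1.
apply: (measurable_comp (F := Rel) _ _ mf).
- exact: Rel_equivalence.1.
- by move=> _ [x Dx <-].
- by apply: measurable_funTS; exact: measurable_graph_pair.
Qed.

Lemma actT_hip g xi x : hip (actT g xi x) (actT g xi x) =
  if `[<Rel (x, fg_inv g x)>] then hip (xi (fg_inv g x)) (xi (fg_inv g x)) else 0.
Proof.
rewrite /actT; case: asboolP => Dx; last by rewrite hip0r.
exact: unitary_hip (rep_unitary pi Dx) _ _.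
Qed.

Lemma actT_le g xi M : (forall x, hip (xi x) (xi x) <= M) ->
  forall x, hip (actT g xi x) (actT g xi x) <= M.
Proof.
move=> xM x; rewrite actT_hip; case: asboolP => // _.
exact: le_trans (hip_ge0 _) (xM x).
Qed.

Lemma bs_actT g xi : bounded_section xi -> bounded_section (actT g xi).
Proof.
by move=> [mxi [M xM]]; split; [exact: meas_actT|exists M; exact: actT_le].
Qed.

Lemma actTD g xi eta x :
  actT g (fun x => xi x + eta x) x = actT g xi x + actT g eta x.
Proof.
rewrite /actT; case: asboolP => Dx; last by rewrite addr0.
exact: unitaryD (rep_unitary pi Dx) _ _.
Qed.

Lemma actTZ g (c : R[i]) xi x : actT g (fun x => c *: xi x) x = c *: actT g xi x.
Proof.
rewrite /actT; case: asboolP => Dx; last by rewrite scaler0.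
exact: unitaryZ (rep_unitary pi Dx) _ _.
Qed.

Lemma actT_hlim g (u : nat -> forall x, pi x) xi x :
  hlim (fun n => u n (fg_inv g x)) (xi (fg_inv g x)) ->
  hlim (fun n => actT g (u n) x) (actT g xi x).
Proof.
move=> ux; rewrite /actT; case: asboolP => Dx; first exact: (unitary_hlim (rep_unitary pi Dx)).
by move=> e e0; exists 0%N => n _; rewrite /= subrr hip0r ltW.
Qed.

Lemma actT_comp g h xi : {ae mu, forall x, actT g (actT h xi) x =
  actT (fg_comp X_standard Rel_equivalence Rel_pmp g h) xi x}.
Proof.
have h1 := fg_inv_rel X_standard Rel_equivalence Rel_pmp g.
have h2 := ae_fg_inv X_standard Rel_equivalence Rel_pmp g
  (fg_inv_rel X_standard Rel_equivalence Rel_pmp h).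
apply: filterS3 h1 h2 (rep_cocycle pi) => x r1 r2 co.
have r3 := Rel_trans Rel_equivalence r1 r2.
rewrite /actT /full_group_act /= (asboolT r1) (asboolT r2) (asboolT r3).
exact: co.
Qed.

Lemma actT_id xi : {ae mu, forall x, actT (fg_id mu Rel_equivalence) xi x = xi x}.
Proof.
apply: filterS (rep_cocycle pi) => x co.
have rx := Rel_refl Rel_equivalence x.
have := co x x rx rx (xi x).
rewrite /actT /full_group_act /= (asboolT rx).
set v := rep_map x (xi x) => vv.
have ux := rep_unitary pi rx.
apply/eqP; rewrite -subr_eq0; apply/eqP/hip_eq0.
by rewrite -(unitary_hip ux) (unitaryB ux) vv subrr hip0r.
Qed.

Lemma mean_actT g xi eta : bounded_section xi -> bounded_section eta ->
  mean mu (fun x => hip (actT g xi x) (actT g eta x)) =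
  mean mu (fun x => hip (xi x) (eta x)).
Proof.
move=> bx be; rewrite -(mean_fg_inv X_standard Rel_equivalence Rel_pmp g (bm_hip bx be)).
apply: mean_ae_eq.
- by apply: bm_hip; exact: bs_actT.
- by apply: bm_comp (bm_hip bx be) _; exact: fg_inv_measurable.
apply: filterS (fg_inv_rel X_standard Rel_equivalence Rel_pmp g) => x Dx.
by rewrite /actT asboolT//; exact: unitary_hip (rep_unitary pi Dx) _ _.
Qed.

End TruncatedAction.

(** * Averaging a correlated family *)

Section SectionLimits.
Context {R : realType} {d : measure_display} {X : measurableType d}
  {mu : probability X R} (F : measurable_field mu).

Lemma hlim_sqr_cvg (H : hilbert R) (c : nat -> H) (u : H) : hlim c u ->
  hip (c n) (c n) @[n --> \oo] --> hip u u.
Proof.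
move=> cu; apply/cvgrPdist_le => e e0.
have e2 : 0 < e / 3 by rewrite divr_gt0.
have [N HN] := hlim_hip u cu e2; have [M HM] := cu _ e2.
exists (maxn N M) => // n /=; rewrite geq_max => /andP[/HN h1 /HM].
have := hip_ge0 (u - c n); rewrite hip_subD => h0 h2.
by move: h1; rewrite !ler_norml => /andP[h3 h4]; apply/andP; split; lra.
Qed.

Lemma hlim_hip_cvg (H : hilbert R) (c : nat -> H) (u v : H) : hlim c u ->
  hip (c n) v @[n --> \oo] --> hip u v.
Proof.
move=> cu; apply/cvgrPdist_le => e e0.
have [N HN] := hlim_hip v cu e0; exists N => // n /= /HN.
by rewrite !(hipC v).
Qed.

Lemma cvg_fsum (I : Type) (s : seq I) (u : I -> nat -> R) (a : I -> R) :
  (forall i, u i n @[n --> \oo] --> a i) ->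
  \sum_(i <- s) u i n @[n --> \oo] --> \sum_(i <- s) a i.
Proof.
move=> ua; elim: s => [|i s IH].
  by rewrite big_nil; under eq_fun do rewrite big_nil; exact: cvg_cst.
by rewrite big_cons; under eq_fun do rewrite big_cons; exact: cvgD.
Qed.

(** A quick Riesz-Fischer theorem: geometric decay of the increments in mean
    square forces pointwise convergence almost everywhere. *)
Lemma section_limit (u : nat -> forall x, F x) (M : R) :
  (forall n, meas (u n)) -> (forall n x, hip (u n x) (u n x) <= M) ->
  (forall n, mean mu (fun x => hip (u n.+1 x - u n x) (u n.+1 x - u n x)) <= 8 ^- n) ->
  exists2 xi : forall x, F x, bounded_section xi &
    {ae mu, forall x, hlim (fun n => u n x) (xi x)}.
Proof.
move=> mu_ uM ud.
have bu n : bounded_section (u n) by split=> //; exists M.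
pose p n x := hip (u n.+1 x - u n x) (u n.+1 x - u n x).
have bp n : bm (p n) by apply: bm_hip; exact: bsB.
have p0 n x : 0 <= p n x by exact: hip_ge0.
have t0 n : 0 < 4 ^- n :> R by rewrite invr_gt0 exprn_gt0.
have mA n : measurable [set x | 4 ^- n < p n x] := (markov_pr mu (bp n) (p0 n) (t0 n)).1.
have pA n : pr mu [set x | 4 ^- n < p n x] <= 2 ^- n.
  apply: le_trans (markov_pr mu (bp n) (p0 n) (t0 n)).2 _.
  rewrite ler_pdivrMr//; apply: le_trans (ud n) _.
  by rewrite -invfM -exprMn -natrM.
pose C := [set x | exists N, forall n, ~ ((N <= n)%N /\ 4 ^- n < p n x)].
have mC : measurable C.
  apply: measurable_exists => N; apply: measurable_forall => n.
  have mNn : measurable [set x | (N <= n)%N /\ 4 ^- n < p n x].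
    case: (leqP N n) => Nn.
      by have := mA n; congr measurable; apply/seteqP; split=> x //= [].
    by rewrite (_ : [set x | _] = set0)//; apply/seteqP; split=> x //= [].
  exact: measurableC mNn.
have aC : {ae mu, forall x, C x}.
  apply: filterS (borel_cantelli mA (i := 0%N) (fun k _ => pA k)) => x [N HN].
  by exists N => n [Nn]; exact: HN.
have lC x : C x -> exists v, hlim (fun n => u n x) v.
  move=> [N HN]; apply: hlim_exists; exists N => n Nn.
  by rewrite leNgt; apply/negP => h; apply: (HN n); split.
pose xi x : F x := if pselect (C x) is left h then projT1 (cid (lC x h)) else 0.
have xiP x : C x -> hlim (fun n => u n x) (xi x).
  by rewrite /xi; case: pselect => // h _; case: cid.
exists xi; last by apply: filterS aC => x; exact: xiP.
split; last first.
  exists (Num.max M 0) => x; rewrite le_max; case: (pselect (C x)) => Cx.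
    by rewrite (hlim_le (xiP x Cx))//.
  by rewrite /xi; case: pselect => // _; rewrite hip0r lexx orbT.
apply: (meas_hlim (u := fun n x => if `[<C x>] then u n x else 0)).
  by move=> n; exact: meas_if.
move=> x; case: asboolP => Cx; first exact: xiP.
rewrite /xi; case: pselect => // _ e e0; exists 0%N => n _.
by rewrite /= subrr hip0r ltW.
Qed.

End SectionLimits.

Section Averaging.
Context {R : realType} {d : measure_display} {X : measurableType d}
  {mu : probability X R} {Rel : set (X * X)}.
Hypotheses (X_standard : standard_borel R X) (Rel_equivalence : borel_equivalence Rel)
  (Rel_pmp : measure_preserving mu Rel).
Variable pi : unitary_rep mu Rel.
Implicit Types (xi eta : forall x, pi x) (g h : full_group mu Rel).

(** The dyadic convex hull of the translates of a section, as a type of formal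
    averages. One formal average acts on all sections of a family at once. *)
Inductive mixture :=
  | MixId
  | MixAct of full_group mu Rel & mixture
  | MixMid of mixture & mixture.

Fixpoint mix (a : mixture) xi : forall x, pi x :=
  match a with
  | MixId => xi
  | MixAct g b => actT g (mix b xi)
  | MixMid b c => fun x => (2^-1 : R)%:C *: (mix b xi x + mix c xi x)
  end.

Lemma mix_le a xi M : (forall x, hip (xi x) (xi x) <= M) ->
  forall x, hip (mix a xi x) (mix a xi x) <= M.
Proof.
move=> xM; elim: a => //= [g b IH|b IHb c IHc] x; first exact: actT_le.
have := hip_add_le (mix b xi x) (mix c xi x).
have := IHb x; have := IHc x; rewrite hipZl hipZr => h1 h2 h3; lra.
Qed.

Lemma bs_mix a xi : bounded_section xi -> bounded_section (mix a xi).
Proof.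
move=> bx; elim: a => //= [g b IH|b IHb c IHc]; first exact: (bs_actT Rel_equivalence).
by apply: bsZ; exact: bsD.
Qed.

Section Family.
Variables (k : nat) (z : 'I_k -> forall x, pi x).
Hypothesis bz : forall i, bounded_section (z i).

Definition energy a := \sum_(i < k) mean mu (fun x => hip (mix a (z i) x) (mix a (z i) x)).
Definition energy_dist a b := \sum_(i < k)
  mean mu (fun x => hip (mix a (z i) x - mix b (z i) x) (mix a (z i) x - mix b (z i) x)).

Lemma energy_ge0 a : 0 <= energy a.
Proof. by apply: sumr_ge0 => i _; apply: mean_ge0 => x; exact: hip_ge0. Qed.

Lemma energy_act g a : energy (MixAct g a) = energy a.
Proof.
apply: eq_bigr => i _ /=; apply: (mean_actT X_standard Rel_equivalence Rel_pmp);
  exact: bs_mix.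
Qed.

Lemma energy_parallelogram a b :
  energy_dist a b = 2 * (energy a + energy b) - 4 * energy (MixMid a b).
Proof.
rewrite /energy /energy_dist mulrDr !mulr_sumr -big_split/= -sumrB.
apply: eq_bigr => i _.
have ba := bs_mix a (bz i); have bb := bs_mix b (bz i).
have b1 := bm_hip ba ba; have b2 := bm_hip bb bb.
have bD := bsZ 2^-1 (bsD ba bb); have b3 := bm_hip bD bD.
transitivity (mean mu (fun x => 2 * (hip (mix a (z i) x) (mix a (z i) x) +
    hip (mix b (z i) x) (mix b (z i) x)) - 4 * hip (mix (MixMid a b) (z i) x)
      (mix (MixMid a b) (z i) x))).
  congr mean; apply/funext => x /=.
  by rewrite hip_subD hipZl hipZr hip_addD; field.
have bAB := bmD b1 b2.
by rewrite meanB ?meanZ ?meanD ?mulrDr//; exact: bmZ.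
Qed.

Variable kappa : R.
Hypothesis kappa0 : 0 < kappa.
Hypothesis corr : forall g,
  kappa <= \sum_(i < k) mean mu (fun x => hip (actT g (z i) x) (z i x)).

(** The lower bound on correlations passes to convex combinations by linearity. The
    translation by [g] makes the induction go through, as [g] and [h] combine to
    [g h] almost everywhere. *)
Lemma mix_corr_act a g :
  kappa <= \sum_(i < k) mean mu (fun x => hip (actT g (mix a (z i)) x) (z i x)).
Proof.
elim: a g => [//|h a IH g|a IHa b IHb g] /=.
  apply: le_trans (IH (fg_comp X_standard Rel_equivalence Rel_pmp g h)) _.
  rewrite le_eqVlt; apply/orP; left; apply/eqP; apply: eq_bigr => i _.
  apply: mean_ae_eq.
  - by apply: bm_hip => //; apply: (bs_actT Rel_equivalence); exact: bs_mix.
  - apply: bm_hip => //; apply: (bs_actT Rel_equivalence).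
    by apply: (bs_actT Rel_equivalence); exact: bs_mix.
  apply: filterS (actT_comp X_standard Rel_equivalence Rel_pmp g h (mix a (z i))) => x ->.
  by [].
have -> : \sum_(i < k) mean mu (fun x => hip (actT g (fun y => (2^-1 : R)%:C *:
      (mix a (z i) y + mix b (z i) y)) x) (z i x)) =
    2^-1 * (\sum_(i < k) mean mu (fun x => hip (actT g (mix a (z i)) x) (z i x)) +
      \sum_(i < k) mean mu (fun x => hip (actT g (mix b (z i)) x) (z i x))).
  rewrite -big_split/= mulr_sumr; apply: eq_bigr => i _.
  have ba := bs_actT Rel_equivalence g (bs_mix a (bz i)).
  have bb := bs_actT Rel_equivalence g (bs_mix b (bz i)).
  have h1 := bm_hip ba (bz i); have h2 := bm_hip bb (bz i).
  rewrite -meanD// -meanZ; last exact: bmD.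
  congr mean; apply/funext => x.
  by rewrite actTZ actTD hipZl hipDl.
by have := IHa g; have := IHb g; move: (\sum__ _) (\sum__ _) => s t; lra.
Qed.

Lemma mix_corr a : kappa <= \sum_(i < k) mean mu (fun x => hip (mix a (z i) x) (z i x)).
Proof.
apply: le_trans (mix_corr_act a (fg_id mu Rel_equivalence)) _.
rewrite le_eqVlt; apply/orP; left; apply/eqP; apply: eq_bigr => i _.
apply: mean_ae_eq.
- by apply: bm_hip => //; apply: (bs_actT Rel_equivalence); exact: bs_mix.
- by apply: bm_hip => //; exact: bs_mix.
by apply: filterS (actT_id Rel_equivalence (mix a (z i))) => x ->.
Qed.

Lemma energy_minimizing : exists a : nat -> mixture, forall n b,
  energy (a n) <= energy b + 8 ^- n / 6.
Proof.
have hI : has_inf (range energy).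
  by split; [exists (energy MixId), MixId|exists 0 => _ [a _ <-]; exact: energy_ge0].
have ex n : exists a, forall b, energy a <= energy b + 8 ^- n / 6.
  have e0 : 0 < 8 ^- n / 6 :> R by rewrite divr_gt0// invr_gt0 exprn_gt0.
  have [_ [a _ <-] ha] := inf_adherent e0 hI.
  exists a => b; apply: le_trans (ltW ha) _; rewrite lerD2r.
  by apply: ge_inf; [exact: hI.2|exists b].
by have [a ha] := choice ex; exists a.
Qed.

(** The approximate minimisers of the energy form a Cauchy sequence by the
    parallelogram law, and translating them costs no energy. *)
Lemma invariant_section : exists xi, [/\ bounded_section xi,
  forall g, {ae mu, forall x, actT g xi x = xi x} &
  ~ {ae mu, forall x, xi x = 0}].
Proof.
have [a aP] := energy_minimizing.
(* The tolerance [8 ^- n / 6] makes up for the factors of the parallelogram law. *)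
have dist n b : energy b <= energy (a n) + 8 ^- n / 6 -> energy_dist b (a n) <= 8 ^- n.
  rewrite energy_parallelogram => h.
  by have := aP n (MixMid b (a n)); move: h; move: (8 ^- n) => e; lra.
have dist' n b : energy b <= energy (a n) + 8 ^- n / 6 -> forall i,
    mean mu (fun x => hip (mix b (z i) x - mix (a n) (z i) x)
                         (mix b (z i) x - mix (a n) (z i) x)) <= 8 ^- n.
  move=> h i; apply: le_trans (dist n b h); rewrite /energy_dist (bigD1 i)//= lerDl.
  by apply: sumr_ge0 => j _; apply: mean_ge0 => x; exact: hip_ge0.
have lim i : exists2 xi : forall x, pi x, bounded_section xi &
    {ae mu, forall x, hlim (fun n => mix (a n) (z i) x) (xi x)}.
  have [mz [M zM]] := bz i.
  apply: (section_limit (M := M)); first by move=> n; case: (bs_mix (a n) (bz i)).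
    by move=> n; exact: mix_le.
  move=> n; apply: dist'; apply: le_trans (aP n.+1 (a n)) _.
  rewrite lerD2l ler_pM2r// lef_pV2 ?posrE ?exprn_gt0//.
  by rewrite exprS ler_peMl ?exprn_ge0// ler1n.
have [xi xiP] := choice (fun i => let: ex_intro2 x p q := lim i in
  ex_intro (fun x => bounded_section x /\
    {ae mu, forall y, hlim (fun n => mix (a n) (z i) y) (x y)}) x (conj p q)).
have inv i g : {ae mu, forall x, actT g (xi i) x = xi i x}.
  have bx := (xiP i).1; have bg := bs_actT Rel_equivalence g bx.
  have bxn n := bs_mix (a n) (bz i).
  have bgn n := bs_actT Rel_equivalence g (bxn n).
  pose G x := hip (actT g (xi i) x - xi i x) (actT g (xi i) x - xi i x).
  pose Gn n x := hip (actT g (mix (a n) (z i)) x - mix (a n) (z i) x)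
    (actT g (mix (a n) (z i)) x - mix (a n) (z i) x).
  have bG : bm G by apply: bm_hip; exact: bsB.
  have bGn n : bm (Gn n) by apply: bm_hip; exact: bsB.
  have small n : mean mu (Gn n) <= 8 ^- n.
    apply: (dist' n (MixAct g (a n))); rewrite energy_act lerDl.
    by rewrite divr_ge0// invr_ge0 exprn_ge0.
  have cvgG : mean mu (Gn n) @[n --> \oo] --> mean mu G.
    have [_ [M zM]] := bz i.
    apply: (mean_cvg (M := 2 * M + 2 * M)) => //.
      move=> n x; rewrite ger0_norm ?hip_ge0//; apply: le_trans (hip_add_le _ _) _.
      rewrite hipNl hipNr opprK; apply: lerD; rewrite ler_pM2l//.
        by apply: actT_le; exact: mix_le.
      exact: mix_le.
    have h1 := (xiP i).2.
    have h2 := ae_fg_inv X_standard Rel_equivalence Rel_pmp g h1.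
    apply: filterS2 h1 h2 => x hx hgx; apply: hlim_sqr_cvg.
    by apply: hlimB => //; apply: actT_hlim.
  have : {ae mu, forall x, G x = 0}.
    apply: mean_eq0 => //; first by move=> x; exact: hip_ge0.
    apply/eqP; rewrite eq_le mean_ge0 ?andbT; last by move=> x; exact: hip_ge0.
    have c8 : 8 ^- n @[n --> \oo] --> (0 : R).
      under eq_fun do rewrite -exprVn.
      by apply: cvg_expr; rewrite ger0_norm ?invf_lt1 ?invr_ge0// ltr1n.
    by apply: (ler_cvg_to cvgG c8); apply: nearW.
  by apply: filterS => x /hip_eq0/subr0_eq.
have corr_lim : kappa <= \sum_(i < k) mean mu (fun x => hip (xi i x) (z i x)).
  have c : \sum_(i < k) mean mu (fun x => hip (mix (a n) (z i) x) (z i x)) @[n --> \oo]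
      --> \sum_(i < k) mean mu (fun x => hip (xi i x) (z i x)).
    apply: cvg_fsum => i; have [_ [M zM]] := bz i.
    have bxn n := bs_mix (a n) (bz i).
    apply: (mean_cvg (M := M + M)).
    - by move=> n; exact: bm_hip.
    - by apply: bm_hip => //; exact: (xiP i).1.
    - move=> n x; apply: le_trans (lerD (mix_le (a n) zM x) (zM x)).
      apply: le_trans (hip_abs_le _ _); rewrite normrM ler_peMl// ger0_norm//.
      by rewrite ler1n.
    by apply: filterS (xiP i).2 => x hx; exact: hlim_hip_cvg.
  by apply: (ler_cvg_to (cvg_cst kappa) c); apply: nearW => n; exact: mix_corr.
suff [i i0] : exists i, ~ {ae mu, forall x, xi i x = 0}.
  by exists (xi i); split=> //; exact: (xiP i).1.
apply: contrapT => none; have all0 i : {ae mu, forall x, xi i x = 0}.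
  by apply: contrapT => h; apply: none; exists i.
have : \sum_(i < k) mean mu (fun x => hip (xi i x) (z i x)) = 0.
  rewrite big1// => i _; rewrite -(mean_cst mu 0); apply: mean_ae_eq.
  - by apply: bm_hip => //; exact: (xiP i).1.
  - exact: bm_cst.
  by apply: filterS (all0 i) => x ->; rewrite hip0l.
by move=> s0; move: corr_lim; rewrite s0 leNgt kappa0.
Qed.

End Family.
End Averaging.

(** * From an invariant section to an embedding *)

Section InvariantEmbeds.
Context {R : realType} {d : measure_display} {X : measurableType d}
  {mu : probability X R} {Rel : set (X * X)}.
Hypotheses (X_standard : standard_borel R X) (Rel_equivalence : borel_equivalence Rel)
  (Rel_pmp : measure_preserving mu Rel) (Rel_ergodic : ergodic mu Rel).
Variable pi : unitary_rep mu Rel.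

Lemma invariant_normalize (xi : forall x, pi x) : bounded_section xi ->
  (forall g, {ae mu, forall x, actT g xi x = xi x}) ->
  ~ {ae mu, forall x, xi x = 0} ->
  exists eta : forall x, pi x, [/\ meas eta,
    forall g, {ae mu, forall x, actT g eta x = eta x} &
    {ae mu, forall x, hip (eta x) (eta x) = 1}].
Proof.
move=> bx inv nz.
have [c fc] : exists c, {ae mu, forall x, hip (xi x) (xi x) = c}.
  apply: (ergodic_constant Rel_ergodic) => [|g]; first exact: (bm_hip bx bx).1.
  have h := fg_inv_rel X_standard Rel_equivalence Rel_pmp g.
  by apply: filterS2 (inv g) h => x {1 2}<- Dx; rewrite actT_hip asboolT.
have c0 : 0 < c.
  case: (ltP 0 c) => // c0; exfalso; apply: nz; apply: filterS fc => x xc.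
  by apply: hip_eq0; apply/eqP; rewrite eq_le hip_ge0 andbT xc.
exists (fun x => ((Num.sqrt c)^-1 : R)%:C *: xi x); split.
- by apply: measZr => //; exact: bx.1.
- by move=> g; apply: filterS (inv g) => x e; rewrite actTZ e.
- apply: filterS fc => x xc; rewrite hipZl hipZr mulrA xc -invfM -expr2 sqr_sqrtr ?ltW//.
  by rewrite mulVf// gt_eqF.
Qed.

(** An invariant section of norm one gives the embedding multiplying it by
    scalar functions. *)
Lemma invariant_embeds (eta : forall x, pi x) : meas eta ->
  (forall g, {ae mu, forall x, actT g eta x = eta x}) ->
  {ae mu, forall x, hip (eta x) (eta x) = 1} -> embeds (L2_rep mu Rel) pi.
Proof.
move=> meta inv eta1.
pose V (phi : forall x, L2_rep mu Rel x) : forall x, pi x :=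
  fun x => (phi x : R[i]) *: eta x.
have Vnorm phi : L2norm_sqr (V phi) = L2norm_sqr phi.
  have e : {ae mu, forall x, complex.Re (inner (pi x) (V phi x) (V phi x)) =
      complex.Re (inner (L2_rep mu Rel x) (phi x) (phi x))}.
    apply: filterS eta1 => x e1; rewrite /V innerZl innerZr inner_self e1.
    by rewrite mulr1.
  have p0 (H : measurable_field mu) (xi : forall x, H x) x :
      (0 <= (complex.Re (inner (H x) (xi x) (xi x)))%:E)%E.
    by rewrite lee_fin; exact: hip_ge0.
  by apply/eqP; rewrite eq_le; apply/andP; split; apply: ae_le_integral => //;
    apply: filterS e => x ->.
exists V.
  split=> //.
  - move=> phi [mphi fin]; split; last by rewrite Vnorm.
    exact: measZ.
  - by move=> phi psi _ _; apply: filterS => x e; rewrite /V e.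
  - move=> c phi psi _ _; apply: aeW => x; rewrite /V scalerDl scalerA.
    by [].
move=> f g phi _ _.
have h := fg_inv_rel X_standard Rel_equivalence Rel_pmp g.
apply: filterS2 (inv g) h => x e Dx.
rewrite /V /Linfty_act /full_group_act (unitaryZ (rep_unitary pi Dx)).
move: e; rewrite /actT asboolT// /full_group_act => ->.
by rewrite scalerA.
Qed.

End InvariantEmbeds.

(** * Grids, clipping and random signs *)

Section Grid.
Variable R : realType.
Implicit Types (K dl p q : R).

(** The nearest point of the interval from [- K] to [K]. *)
Definition clip K p := Num.max (- K) (Num.min p K).

(** A staircase function approximating [clip K p + K], namely [dl] times the number
    of grid points [- K + dl * j], [j < m], strictly below [p]. *)
Definition levels K dl (m : nat) p : R :=
  \sum_(j < m) dl * (- K + dl * j%:R < p)%R%:R.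

(** As long as [p + K] exceeds the grid all points are counted; afterwards the count
    is stationary and off by less than one step. *)
Lemma levelsP K dl m p : 0 < dl ->
  (dl * m%:R < p + K -> levels K dl m p = dl * m%:R) /\
  (p + K <= dl * m%:R ->
    Num.max 0 (p + K) <= levels K dl m p <= Num.max 0 (p + K) + dl).
Proof.
move=> dl0; elim: m => [|m [IH1 IH2]].
  rewrite /levels big_ord0 mulr0; split=> // h.
  by rewrite max_l// lexx add0r ltW.
have mS : dl * m.+1%:R = dl * m%:R + dl by rewrite -[m.+1]addn1 natrD; ring.
rewrite /levels big_ord_recr /= -/(levels K dl m p) mS.
have e : (- K + dl * m%:R < p) = (dl * m%:R < p + K) by apply/idP/idP => h; lra.
rewrite e; case: (ltP (dl * m%:R) (p + K)) => h; split=> h'.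
- by rewrite IH1//= mulr1.
- rewrite IH1//= mulr1 max_r; last by apply: le_trans (ltW h); rewrite mulr_ge0// ltW.
  by apply/andP; split; lra.
- by exfalso; lra.
- by rewrite /= mulr0 addr0; exact: IH2.
Qed.

Lemma levels_clip K dl m p : 0 < dl -> 0 <= K -> dl * m%:R = 2 * K ->
  clip K p + K <= levels K dl m p <= clip K p + K + dl.
Proof.
move=> dl0 K0 mK; have [] := levelsP K m p dl0; rewrite mK /clip => h1 h2.
case: (leP (p + K) (2 * K)) => h.
  have /andP[] := h2 h.
  rewrite (min_l (_ : p <= K)); last lra.
  have -> : Num.max 0 (p + K) = Num.max (- K) p + K by rewrite addr_maxl addNr.
  by move=> a b; apply/andP; split.
rewrite h1// min_r; last lra.
by rewrite max_r; last lra; apply/andP; split; lra.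
Qed.

(** A finite form of the coarea formula: the distance of two values is the number of
    thresholds between them. *)
Lemma levels_moved K dl m p q : 0 < dl ->
  dl * \sum_(j < m) ((- K + dl * j%:R < p) != (- K + dl * j%:R < q))%R%:R =
  `|levels K dl m p - levels K dl m q|.
Proof.
move=> dl0; wlog pq : p q / q <= p => [hw|].
  case: (leP q p) => h; first exact: hw.
  rewrite distrC -hw ?ltW//; congr (_ * _); apply: eq_bigr => j _.
  by rewrite eq_sym.
rewrite /levels -sumrB mulr_sumr ger0_norm.
  apply: eq_bigr => j _; rewrite -mulrBr; congr (_ * _).
  case: (ltP (- K + dl * j%:R) q) => h1; first by rewrite (lt_le_trans h1 pq) subrr.
  by case: ltP => h2; rewrite subr0.
apply: sumr_ge0 => j _; rewrite -mulrBr; apply: mulr_ge0; first exact: ltW.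
rewrite subr_ge0 ler_nat; case: (ltP (- K + dl * j%:R) q) => //= h.
by rewrite (lt_le_trans h pq).
Qed.

Lemma levels_lower K dl m p q : 0 < dl -> 0 <= K -> dl * m%:R = 2 * K ->
  `|clip K p - clip K q| - dl <= `|levels K dl m p - levels K dl m q|.
Proof.
move=> dl0 K0 mK.
have /andP[a1 a2] := levels_clip p dl0 K0 mK.
have /andP[b1 b2] := levels_clip q dl0 K0 mK.
rewrite lerBlDr ler_norml; apply/andP; split.
  by have := ler_norm (- (levels K dl m p - levels K dl m q)); rewrite normrN; lra.
by have := ler_norm (levels K dl m p - levels K dl m q); lra.
Qed.

Lemma clipP K p : 0 <= K -> [\/ p <= - K /\ clip K p = - K,
  [/\ - K <= p, p <= K & clip K p = p] | K <= p /\ clip K p = K].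
Proof.
move=> K0; rewrite /clip; case: (leP p K) => h1.
  by case: (leP (- K) p) => h2; [apply: Or32|apply: Or31]; split=> //; exact: ltW.
by apply: Or33; split; [exact: ltW|rewrite max_r//; lra].
Qed.

Lemma clip_lip K p q : 0 <= K -> `|clip K p - clip K q| <= `|p - q|.
Proof.
move=> K0; wlog pq : p q / q <= p => [hw|].
  by case: (leP q p) => h; [exact: hw|rewrite distrC [leRHS]distrC hw// ltW].
rewrite [leRHS]ger0_norm ?subr_ge0// ler_norml.
by case: (clipP p K0) => -[? ?]; try move=> ?; case: (clipP q K0) => -[? ?];
  try move=> ?; apply/andP; split; lra.
Qed.

Lemma levels_upper K dl m p q : 0 < dl -> 0 <= K -> dl * m%:R = 2 * K ->
  `|levels K dl m p - levels K dl m q| <= `|p - q| + dl.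
Proof.
move=> dl0 K0 mK; apply: le_trans (lerD (clip_lip p q K0) (lexx dl)).
have /andP[a1 a2] := levels_clip p dl0 K0 mK.
have /andP[b1 b2] := levels_clip q dl0 K0 mK.
rewrite ler_norml; apply/andP; split.
  by have := ler_norm (- (clip K p - clip K q)); rewrite normrN; lra.
by have := ler_norm (clip K p - clip K q); lra.
Qed.

(** Clipping loses little of the square of a difference, up to fourth powers:
    it acts only where one of the arguments is large. *)
Lemma clip_lower p q :
  (p - q) ^+ 2 / 40 - (p ^+ 4 + q ^+ 4) / 4000 <= `|clip 20 p - clip 20 q|.
Proof.
have big (x : R) : 20 < `|x| -> x ^+ 2 <= x ^+ 4 / 400.
  move=> hx; have h : 400 <= x ^+ 2.
    rewrite -[x ^+ 2]real_normK ?num_real// (_ : 400 = 20 ^+ 2 :> R); last by ring.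
    by rewrite ler_sqr ?nnegrE// ltW.
  have -> : x ^+ 4 = x ^+ 2 * x ^+ 2 by ring.
  by move: h; move: (x ^+ 2) => y h; nra.
have p4 (x : R) : 0 <= x ^+ 4 by rewrite exprn_even_ge0.
have dsq : (p - q) ^+ 2 <= 2 * (p ^+ 2 + q ^+ 2).
  by have := sqr_ge0 (p + q); rewrite !sqrrD sqrrN mulrN => h; lra.
wlog pq : p q dsq / `|q| <= `|p| => [hw|].
  case: (leP `|q| `|p|) => h; first exact: hw.
  rewrite distrC -[p - q]opprB sqrrN [p ^+ 4 + _]addrC; apply: hw (ltW h).
  by rewrite -[q - p]opprB sqrrN [q ^+ 2 + _]addrC.
case: (leP `|p| 20) => hp.
  have hq := le_trans pq hp.
  move: hp hq; rewrite !ler_norml => /andP[p1 p2] /andP[q1 q2].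
  have -> : clip 20 p = p by rewrite /clip min_l// max_r.
  have -> : clip 20 q = q by rewrite /clip min_l// max_r.
  have h1 : `|p - q| <= 40 by rewrite ler_norml; apply/andP; split; lra.
  have h2 : (p - q) ^+ 2 <= 40 * `|p - q|.
    by rewrite -real_normK ?num_real// expr2 ler_wpM2r.
  by have := p4 p; have := p4 q; lra.
apply: le_trans (normr_ge0 _).
have h1 := big _ hp.
have h2 : q ^+ 2 <= p ^+ 2 by rewrite -[q ^+ 2]real_normK ?num_real// -[p ^+ 2]real_normK ?num_real// ler_sqr ?nnegrE.
by have := p4 q; lra.
Qed.

End Grid.

Section Signs.
Context {R : realType} {d : measure_display} {X : measurableType d}.
Variable mu : probability X R.
Variables (n : nat) (phi : X -> X) (g : nat -> X -> X) (M : R).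
Hypotheses (mphi : measurable_fun setT phi) (mg : forall i, measurable_fun setT (g i)).
Hypothesis M0 : 0 <= M.
Implicit Types (f a : X -> R) (s : seq (X -> R)).

Definition sqdiff (p : X -> X) f s x :=
  (f (p x) - f x) ^+ 2 + \sum_(a <- s) (a (p x) - a x) ^+ 2.

Definition total_sq s x := \sum_(a <- s) a x ^+ 2.

(** The expectation of [(f + e) ^+ 4], where [e] is a random signed sum of [s]
    with Gaussian rather than Bernoulli signs. *)
Definition quartic f s x :=
  f x ^+ 4 + 6 * f x ^+ 2 * total_sq s x + 3 * total_sq s x ^+ 2.

(** The functional to be kept large: [f] together with the signed sum of [s] should
    move much under [phi], little under the [g i], and have a small fourth moment.
    The weight 1/50 matches clipping at 20 ([clip_lower]): a fourth moment enters
    with weight 2/4000, which is 1/40 of it. *)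
Definition potential f s x :=
  sqdiff phi f s x - M * (\sum_(i < n) sqdiff (g i) f s x) - quartic f s x / 50.

Lemma sqdiff_cons p f a s x : sqdiff p (fun y => f y + a y) s x +
  sqdiff p (fun y => f y - a y) s x = 2 * sqdiff p f (a :: s) x.
Proof. by rewrite /sqdiff big_cons; ring. Qed.

(** The difference of the two sides is [4 * a x ^+ 4], twice the gap between the
    fourth moments of a sign and of a Gaussian variable. *)
Lemma quartic_cons f a s x : quartic (fun y => f y + a y) s x +
  quartic (fun y => f y - a y) s x <= 2 * quartic f (a :: s) x.
Proof.
rewrite /quartic /total_sq big_cons -subr_ge0.
set A := \sum_(b <- s) _.
have -> : 2 * (f x ^+ 4 + 6 * f x ^+ 2 * (a x ^+ 2 + A) + 3 * (a x ^+ 2 + A) ^+ 2) -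
  ((f x + a x) ^+ 4 + 6 * (f x + a x) ^+ 2 * A + 3 * A ^+ 2 +
   ((f x - a x) ^+ 4 + 6 * (f x - a x) ^+ 2 * A + 3 * A ^+ 2)) = 4 * a x ^+ 4.
  by ring.
by rewrite mulr_ge0// exprn_even_ge0.
Qed.

Lemma potential_cons f a s x : 2 * potential f (a :: s) x <=
  potential (fun y => f y + a y) s x + potential (fun y => f y - a y) s x.
Proof.
rewrite /potential.
have h1 := sqdiff_cons phi f a s x; have h2 := quartic_cons f a s x.
have h3 : \sum_(i < n) sqdiff (g i) (fun y => f y + a y) s x +
    \sum_(i < n) sqdiff (g i) (fun y => f y - a y) s x =
    2 * \sum_(i < n) sqdiff (g i) f (a :: s) x.
  by rewrite -big_split mulr_sumr/=; apply: eq_bigr => i _; exact: sqdiff_cons.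
have h4 : M * (\sum_(i < n) sqdiff (g i) (fun y => f y + a y) s x) +
    M * (\sum_(i < n) sqdiff (g i) (fun y => f y - a y) s x) =
    2 * (M * \sum_(i < n) sqdiff (g i) f (a :: s) x).
  by rewrite -mulrDr h3; ring.
lra.
Qed.

Definition bm_all s := forall a, List.In a s -> bm a.

Lemma bm_sum_In s (F : (X -> R) -> X -> R) : (forall a, List.In a s -> bm (F a)) ->
  bm (fun x => \sum_(a <- s) F a x).
Proof.
elim: s => [_|a s IH h]; first by under eq_fun do rewrite big_nil; exact: bm_cst.
under eq_fun do rewrite big_cons.
by apply: bmD; [apply: h; left|apply: IH => b bs; apply: h; right].
Qed.

Lemma bm_sqdiff p f s : measurable_fun setT p -> bm f -> bm_all s -> bm (sqdiff p f s).
Proof.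
move=> mp bf bs; apply: bmD; first by apply: bmX; apply: bmB => //; exact: bm_comp.
apply: bm_sum_In => a /bs ba.
by apply: bmX; apply: bmB => //; exact: bm_comp.
Qed.

Lemma bm_total_sq s : bm_all s -> bm (total_sq s).
Proof. by move=> bs; apply: bm_sum_In => a /bs ba; exact: bmX. Qed.

Lemma bm_quartic f s : bm f -> bm_all s -> bm (quartic f s).
Proof.
move=> bf bs; have bS := bm_total_sq bs.
apply: bmD; last by apply: bmZ; exact: bmX.
by apply: bmD; [exact: bmX|apply: bmM => //; apply: bmZ; exact: bmX].
Qed.

Lemma bm_potential f s : bm f -> bm_all s -> bm (potential f s).
Proof.
move=> bf bs; apply: bmB; last first.
  by under eq_fun do rewrite mulrC; apply: bmZ; exact: bm_quartic.
apply: bmB; first exact: bm_sqdiff.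
by apply: bmZ; apply: bm_sum => i; exact: bm_sqdiff.
Qed.

(** Derandomisation: choosing the signs one after the other never decreases the
    potential. *)
Lemma sign_choice s f : bm f -> bm_all s -> exists2 f' : X -> R, bm f' &
  mean mu (potential f s) <= mean mu (potential f' [::]).
Proof.
elim: s f => [|a s IH] f bf bs; first by exists f.
have ba : bm a by apply: bs; left.
have bs' : bm_all s by move=> b hb; apply: bs; right.
have b1 := bmD bf ba; have b2 := bmB bf ba.
have h : 2 * mean mu (potential f (a :: s)) <=
    mean mu (potential (fun y => f y + a y) s) + mean mu (potential (fun y => f y - a y) s).
  rewrite -meanZ -?meanD; try exact: bm_potential.
  apply: mean_le; first by apply: bmZ; exact: bm_potential.
    by apply: bmD; exact: bm_potential.
  by move=> x; exact: potential_cons.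
have [f1 bf1 h1] := IH _ b1 bs'; have [f2 bf2 h2] := IH _ b2 bs'.
have [h12|h12] := leP (mean mu (potential f1 [::])) (mean mu (potential f2 [::])).
  by exists f2 => //; lra.
by exists f1 => //; lra.
Qed.

End Signs.

(** * Level sets of almost invariant functions *)

Section Threshold.
Context {R : realType} {d : measure_display} {X : measurableType d}.
Variable mu : probability X R.

Lemma indic_moved (p : X -> X) (A : set X) x :
  \1_(moved p A) x = ((x \in [set y | A (p y)]) != (x \in A))%:R :> R.
Proof.
rewrite indicE; case: (pselect (A (p x))) => h1; case: (pselect (A x)) => h2.
- rewrite (mem_set h2) (mem_set (h1 : [set y | A (p y)] x)) memNset//.
  by move=> [[_]|[_]]; apply.
- rewrite (memNset h2) (mem_set (h1 : [set y | A (p y)] x)) mem_set//.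
  by left; split.
- rewrite (mem_set h2) (memNset (h1 : ~ [set y | A (p y)] x)) mem_set//.
  by right; split.
- rewrite (memNset h2) (memNset (h1 : ~ [set y | A (p y)] x)) memNset//.
  by move=> [[]|[]].
Qed.

Lemma measurable_moved_map (p : X -> X) (A : set X) : measurable_fun setT p ->
  measurable A -> measurable (moved p A).
Proof.
move=> mp mA; apply: measurableU; apply: measurableD => //; exact: measurable_preim.
Qed.

Section Levels.
Variables (f : X -> R) (bf : bm f) (p : X -> X) (mp : measurable_fun setT p).
Variables (K dl : R) (m : nat) (dl0 : 0 < dl) (K0 : 0 <= K) (mK : dl * m%:R = 2 * K).

Definition level_set (j : nat) := [set x | - K + dl * j%:R < f x].

Lemma measurable_level_set j : measurable (level_set j).
Proof.
have := bf.1 measurableT _ (measurable_itv `]- K + dl * j%:R, +oo[).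
by rewrite setTI; congr measurable; apply/seteqP; split=> x /=; rewrite in_itv /= andbT.
Qed.

Let S x := levels K dl m (f x).

Lemma level_moved x : dl * \sum_(j < m) \1_(moved p (level_set j)) x = `|S (p x) - S x|.
Proof.
rewrite /S -levels_moved//; congr (_ * _); apply: eq_bigr => j _.
rewrite indic_moved; congr (nat_of_bool (_ != _))%:R.
  by apply/idP/idP; rewrite inE.
by apply/idP/idP; rewrite inE.
Qed.

Let bmi (j : 'I_m) : bm (\1_(moved p (level_set j)) : X -> R).
Proof. exact/bm_indic/measurable_moved_map/measurable_level_set. Qed.

Lemma bm_level : bm (fun x => `|S (p x) - S x|).
Proof. by under eq_fun do rewrite -level_moved; apply: bmZ; exact: bm_sum. Qed.

Lemma mean_level : mean mu (fun x => `|S (p x) - S x|) =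
  dl * \sum_(j < m) pr mu (moved p (level_set j)).
Proof.
under eq_fun do rewrite -level_moved.
rewrite meanZ; last exact: bm_sum.
rewrite mean_sum//; congr (_ * _); apply: eq_bigr => j _.
exact/mean_indic/measurable_moved_map/measurable_level_set.
Qed.

End Levels.

(** Young's inequality bounds the average motion of the level sets under the maps
    [g i] by the quadratic term of the potential; the quartic term controls what
    clipping loses under [phi]. *)
Lemma threshold (n : nat) (kappa : R) : 0 < kappa ->
  exists2 M : R, 0 <= M &
  forall (phi : X -> X) (g : nat -> X -> X) (f : X -> R),
    measurable_fun setT phi -> (forall i, measurable_fun setT (g i)) ->
    (forall h, bm h -> mean mu (fun x => h (phi x)) = mean mu h) -> bm f ->
    1 / 2 <= mean mu (potential n phi g M f [::]) ->
  exists E, [/\ measurable E, 1 / (80 * 80) <= pr mu (moved phi E) &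
    forall i, (i < n)%N -> pr mu (moved (g i) E) <= kappa].
Proof.
move=> k0.
(* By [u <= tau + u ^+ 2 / (4 * tau)] the motion under the maps [g i] is paid for
   by the quadratic term of the potential, at the extra cost [n * tau / kappa]. *)
pose nn : R := n%:R + 1.
have nn0 : 0 < nn by rewrite ltr_wpDl.
have nn1 : n%:R <= nn by rewrite lerDl.
have c320 : 0 < 320 :> R by rewrite ltr0n.
have [tau tauE] : exists t : R, t = kappa / (320 * nn) by eexists.
have tau0 : 0 < tau by rewrite tauE; exact: divr_gt0 k0 (mulr_gt0 c320 nn0).
have c10 : 0 < 10 :> R by rewrite ltr0n.
have M0 : 0 < 10 / (kappa * tau) := divr_gt0 c10 (mulr_gt0 k0 tau0).
exists (10 / (kappa * tau)); first exact: ltW.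
move=> phi g f mphi mg pphi bf hpot.
(* The mesh of the grid on [-20, 20] keeps the staircase errors below 1/320. *)
have nk0 : 0 <= 1 + n%:R / kappa by rewrite addr_ge0// divr_ge0// ltW.
pose y := 40 * (320 * (1 + n%:R / kappa)).
have c40 : 0 < 40 :> R by rewrite ltr0n.
have y0 : 0 <= y := mulr_ge0 (ltW c40) (mulr_ge0 (ltW c320) nk0).
pose m := (Num.bound y).+1.
have my : y <= m%:R by rewrite (le_trans (ltW (archi_boundP y0)))// ler_nat.
have m0 : 0 < m%:R :> R by rewrite ltr0n.
have [dl dlE] : exists t : R, t = 40 / m%:R by eexists.
have dl0 : 0 < dl by rewrite dlE; exact: divr_gt0 c40 m0.
have mK : dl * m%:R = 2 * 20 by rewrite dlE divfK ?gt_eqF//; ring.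
have dly : dl * (1 + n%:R / kappa) <= 1 / 320.
  have : dl * y <= dl * m%:R by rewrite ler_pM2l.
  by rewrite mK /y mulrCA [dl * (320 * _)]mulrCA; move: (dl * _) => z h; lra.
have K0 : 0 <= 20 :> R by [].
pose E j := level_set f 20 dl j.
pose S x := levels 20 dl m (f x).
pose Q p x := (f (p x) - f x) ^+ 2.
have bQ p : measurable_fun setT p -> bm (Q p).
  by move=> mp; apply: bmX; apply: bmB => //; exact: bm_comp.
have bf4 : bm (fun x => f x ^+ 4) by exact: bmX.
have low : mean mu (Q phi) / 40 - mean mu (fun x => f x ^+ 4) / 2000 - dl <=
    dl * \sum_(j < m) pr mu (moved phi (E j)).
  rewrite -mean_level//.
  have bf4' : bm (fun x => f (phi x) ^+ 4) by exact: (bm_comp bf4 mphi).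
  have b1 := bmZ (40^-1) (bQ _ mphi).
  have b2 := bmZ (4000^-1) (bmD bf4' bf4).
  have b3 := bmB b1 b2.
  have b4 := bmB b3 (bm_cst dl).
  have -> : mean mu (Q phi) / 40 - mean mu (fun x => f x ^+ 4) / 2000 - dl =
      mean mu (fun x => 40^-1 * Q phi x - 4000^-1 * (f (phi x) ^+ 4 + f x ^+ 4) - dl).
    rewrite (meanB mu b3 (bm_cst dl)) mean_cst (meanB mu b1 b2) (meanZ mu _ (bQ _ mphi)).
    rewrite (meanZ mu _ (bmD bf4' bf4)) (meanD mu bf4' bf4).
    by have /= -> := pphi _ bf4; field.
  apply: mean_le; [by []|exact: bm_level|].
  move=> x; apply: le_trans (levels_lower (f (phi x)) (f x) dl0 K0 mK).
  have := clip_lower (f (phi x)) (f x); rewrite /Q; move: (`| _ |) => c h; lra.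
have up i : dl * \sum_(j < m) pr mu (moved (g i) (E j)) <=
    tau + mean mu (Q (g i)) / (4 * tau) + dl.
  rewrite -mean_level//.
  have b1 := bmZ ((4 * tau)^-1) (bQ _ (mg i)).
  have b2 := bmD (bm_cst tau) b1; have b3 := bmD b2 (bm_cst dl).
  have -> : tau + mean mu (Q (g i)) / (4 * tau) + dl =
      mean mu (fun x => tau + (4 * tau)^-1 * Q (g i) x + dl).
    rewrite (meanD mu b2 (bm_cst dl)) (meanD mu (bm_cst tau) b1) !mean_cst.
    by rewrite (meanZ mu _ (bQ _ (mg i))); ring.
  apply: mean_le; [exact: bm_level|by []|].
  move=> x; apply: le_trans (levels_upper (f (g i x)) (f x) dl0 K0 mK) _.
  rewrite lerD2r /Q -[X in _ * X]real_normK ?num_real//.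
  move: (`| _ |) => c; rewrite -subr_ge0.
  have -> : tau + (4 * tau)^-1 * c ^+ 2 - c = (4 * tau)^-1 * (c - 2 * tau) ^+ 2.
    by field; rewrite gt_eqF.
  by rewrite mulr_ge0 ?sqr_ge0// invr_ge0 mulr_ge0// ltW.
have potE : mean mu (potential n phi g (10 / (kappa * tau)) f [::]) =
    mean mu (Q phi) - 10 / (kappa * tau) * \sum_(i < n) mean mu (Q (g i)) -
    mean mu (fun x => f x ^+ 4) / 50.
  have b0 : bm (fun x => \sum_(i < n) Q (g i) x) by apply: bm_sum => i; exact: bQ.
  have b1 := bmZ (10 / (kappa * tau)) b0; have b2 := bmB (bQ _ mphi) b1.
  have b3 := bmZ (50^-1) bf4.
  rewrite (_ : potential _ _ _ _ _ _ = fun x => Q phi x -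
      10 / (kappa * tau) * (\sum_(i < n) Q (g i) x) - 50^-1 * f x ^+ 4).
    rewrite (meanB mu b2 b3) (meanB mu (bQ _ mphi) b1) (meanZ mu _ b0) (meanZ mu _ bf4).
    by rewrite (mean_sum mu _ (fun i : 'I_n => bQ _ (mg i))) [_ / 50]mulrC.
  apply/funext => x; rewrite /potential /sqdiff /quartic /total_sq !big_nil addr0.
  rewrite (eq_bigr (fun i : 'I_n => Q (g i) x)); first by rewrite /Q; ring.
  by move=> i _; rewrite big_nil addr0.
pose w j := pr mu (moved phi (E j)) - kappa^-1 * \sum_(i < n) pr mu (moved (g i) (E j)).
have wsum : 1 / 160 <= dl * \sum_(j < m) w j.
  have -> : dl * \sum_(j < m) w j = dl * \sum_(j < m) pr mu (moved phi (E j)) -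
      kappa^-1 * \sum_(i < n) (dl * \sum_(j < m) pr mu (moved (g i) (E j))).
    rewrite /w sumrB mulrBr -mulr_sumr mulrCA exchange_big /= -mulr_sumr.
    by congr (_ - _ * _).
  have s1 : \sum_(i < n) (dl * \sum_(j < m) pr mu (moved (g i) (E j))) <=
      \sum_(i < n) (tau + mean mu (Q (g i)) / (4 * tau) + dl).
    by apply: ler_sum => i _; exact: up.
  have s2 : \sum_(i < n) (tau + mean mu (Q (g i)) / (4 * tau) + dl) =
      n%:R * (tau + dl) + (\sum_(i < n) mean mu (Q (g i))) / (4 * tau).
    rewrite !big_split /= -mulr_suml !sumr_const card_ord -[tau *+ n]mulr_natl -[dl *+ n]mulr_natl.
    by move: (\sum_(i < n) _) => q; ring.
  have s3 : kappa^-1 * \sum_(i < n) (dl * \sum_(j < m) pr mu (moved (g i) (E j))) <=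
      kappa^-1 * (n%:R * (tau + dl) + (\sum_(i < n) mean mu (Q (g i))) / (4 * tau)).
    by rewrite -s2 ler_pM2l ?invr_gt0.
  have s4 : kappa^-1 * (n%:R * (tau + dl) + (\sum_(i < n) mean mu (Q (g i))) / (4 * tau)) =
      kappa^-1 * n%:R * tau + dl * (n%:R / kappa) +
      (10 / (kappa * tau) * \sum_(i < n) mean mu (Q (g i))) / 40.
    by field; rewrite !gt_eqF.
  have s5 : kappa^-1 * n%:R * tau <= 1 / 320.
    rewrite tauE (_ : _ * _ = (n%:R / nn) / 320); last by field; rewrite !gt_eqF.
    by rewrite ler_pM2r ?invr_gt0// ler_pdivrMr// mul1r.
  move: hpot low s3; rewrite s4 potE.
  have := dly; rewrite mulrDr mulr1.
  by move: (_ * \sum_(i < n) mean mu (Q (g i))) (dl * (n%:R / kappa))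
    (kappa^-1 * n%:R * tau) s5 => a b c; lra.
have [j jw] : exists j : 'I_m, 1 / (80 * 80) <= w j.
  apply: contrapT => none.
  have : dl * \sum_(j < m) w j < dl * \sum_(j < m) (1 / (80 * 80)).
    rewrite ltr_pM2l//; apply: ltr_sum.
      by apply/hasP; exists ord0 => //; rewrite mem_index_enum.
    by move=> j _; rewrite ltNge; apply/negP => h; apply: none; exists j.
  rewrite sumr_const card_ord -[_ *+ _]mulr_natr mulrCA mK => h; lra.
have sg0 : 0 <= \sum_(i < n) pr mu (moved (g i) (E j)).
  by apply: sumr_ge0 => i _; exact: pr_ge0.
have mE : measurable (E j) by exact: measurable_level_set.
exists (E j); split=> //.
  apply: le_trans jw _; rewrite /w lerBlDr lerDl mulr_ge0//.
  by rewrite invr_ge0 ltW.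
move=> i ni; have p1 : pr mu (moved phi (E j)) <= 1.
  by apply: pr_le1; exact: measurable_moved_map.
have : kappa^-1 * \sum_(i < n) pr mu (moved (g i) (E j)) <= 1.
  by move: jw; rewrite /w; move: (kappa^-1 * _) => a; lra.
rewrite mulrC ler_pdivrMr// mul1r; apply: le_trans.
rewrite (bigD1 (Ordinal ni))//= lerDl.
by apply: sumr_ge0 => l _; exact: pr_ge0.
Qed.

End Threshold.

(** * Weak containment along finitely many graphs *)

Section WeakContainmentAlong.
Context {R : realType} {d : measure_display} {X : measurableType d}
  {mu : probability X R} {Rel : set (X * X)}.
Hypotheses (X_standard : standard_borel R X) (Rel_equivalence : borel_equivalence Rel)
  (Rel_discrete : discrete mu Rel) (Rel_pmp : measure_preserving mu Rel).
Variables (n : nat) (G : nat -> full_group mu Rel).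

Definition graph_piece i : set (X * X) :=
  [set p | Rel (p.1, fg_inv (G i) p.1) /\ p.2 = fg_inv (G i) p.1].

Lemma measurable_graph_piece i : measurable (graph_piece i).
Proof.
exact: (measurable_graph_on X_standard (measurable_fg_domain Rel_equivalence (G i))
  (fg_inv_measurable (G i))).
Qed.

Lemma graph_piece_Rel i : graph_piece i `<=` Rel.
Proof. by move=> [x y] [/= h e]; rewrite e. Qed.

Lemma graph_union_finite m : [/\ measurable [set p | exists2 i, (i < m)%N & graph_piece i p],
  [set p | exists2 i, (i < m)%N & graph_piece i p] `<=` Rel &
  (mu_rel mu [set p | exists2 i, (i < m)%N & graph_piece i p] < +oo)%E].
Proof.
elim: m => [|m [mU UR Ufin]].
  rewrite (_ : [set p | _] = set0); last by apply/seteqP; split=> // p [].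
  split=> //; rewrite /mu_rel (eq_integral (fun=> 0%E)) ?integral0 ?ltry//.
  by move=> x _; rewrite (_ : xsection _ _ = set0) ?counting_set0//; exact: xsection0.
have e : [set p | exists2 i, (i < m.+1)%N & graph_piece i p] =
    [set p | exists2 i, (i < m)%N & graph_piece i p] `|` graph_piece m.
  apply/seteqP; split=> p /=.
    move=> [i im h]; move: im; rewrite ltnS leq_eqVlt => /orP[/eqP <-|im]; first by right.
    by left; exists i.
  case=> [[i im h]|h]; last by exists m.
  by exists i => //; exact: ltnW.
have mm := measurable_graph_piece m; have mR := @graph_piece_Rel m.
rewrite e; split; first exact: measurableU.
  by move=> p [/UR|/mR].
apply: le_lt_trans (mu_relU X_standard Rel_equivalence Rel_discrete Rel_pmp mU mm UR mR) _.
rewrite lte_add_pinfty//.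
rewrite /graph_piece (mu_rel_graph mu (A := [set x | Rel (x, fg_inv (G m) x)])).
  by rewrite (le_lt_trans (probability_le1 _ _)) ?ltry//; exact: measurable_fg_domain.
exact: measurable_fg_domain.
Qed.

(** Weak containment, tested on the union of finitely many graphs, which has finite
    measure. The bad pairs over each graph project injectively to [X], so they
    become a small set of points. *)
Lemma weakly_contained_along (pi rho : unitary_rep mu Rel) (xi : forall x, pi x) (e : R) :
  weakly_contained pi rho -> meas xi -> 0 < e ->
  exists k (zeta : 'I_k -> forall x, rho x) N, [/\ forall i, meas (zeta i),
    measurable N, pr mu N <= e &
    forall x, ~ N x -> forall i, (i < n)%N ->
      `|hip (actT (G i) xi x) (xi x) -
        \sum_(j < k) hip (actT (G i) (zeta j) x) (zeta j x)| <= e].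
Proof.
move=> wc mxi e0; pose e' := e / n.+1%:R.
have e'0 : 0 < e' by rewrite divr_gt0.
have e'e : e' <= e by rewrite ler_pdivrMr// ler_peMr ?ler1n// ltW.
have [mQ QR Qfin] := graph_union_finite n.
have [k [zeta [mz hz]]] := wc _ mQ QR Qfin xi mxi e' e'0.
pose f i x := hip (actT (G i) xi x) (xi x) -
  \sum_(j < k) hip (actT (G i) (zeta j) x) (zeta j x).
have mf i : measurable_fun setT (f i).
  apply: measurable_funB; first by apply: meas_hip => //; exact: meas_actT.
  by apply: measurable_sum => j; apply: meas_hip => //; exact: meas_actT.
pose A i := [set x | e' < `|f i x|].
have mA i : measurable (A i).
  have h : measurable_fun setT (fun x => `|f i x|) by exact: measurableT_comp.
  have := h measurableT _ (measurable_itv `]e', +oo[).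
  by rewrite setTI; congr measurable; apply/seteqP; split=> x /=; rewrite in_itv /= andbT.
have pA i : (i < n)%N -> pr mu (A i) <= e'.
  move=> ni; rewrite -lee_fin -prE//.
  rewrite -(mu_rel_graph mu (fg_inv (G i)) (mA i)); apply/ltW.
  apply: le_lt_trans (mu_rel_le mu _) hz => -[x y] [/= Ax yE].
  rewrite {y}yE.
  have Dx : Rel (x, fg_inv (G i) x).
    apply: contrapT => Dx; move: Ax; rewrite /A/= /f /actT asboolF// hip0l.
    rewrite big1 ?subr0 ?normr0; first by rewrite ltNge ltW.
    by move=> j _; rewrite hip0l.
  split; first by exists i.
  apply: lt_le_trans (ReC_le _); rewrite ltcR raddfB raddf_sum /=.
  move: Ax; rewrite /A/= /f /actT asboolT//.
have [mN pN] := pr_bigU mu n mA.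
exists k, zeta, [set x | exists2 i, (i < n)%N & A i x]; split=> //.
  have pA' : \sum_(i < n) pr mu (A i) <= \sum_(i < n) e'.
    by apply: ler_sum => i _; exact: pA.
  apply: le_trans pN _; apply: le_trans pA' _.
  rewrite sumr_const card_ord -[_ *+ _]mulr_natr /e' -mulrA ler_piMr ?ltW//.
  by rewrite mulrC ltr_pdivrMr// mul1r ltr_nat.
move=> x Nx i ni; apply: le_trans e'e; rewrite leNgt; apply/negP => h.
by apply: Nx; exists i.
Qed.

Lemma In_cat (T : Type) (a : T) (s t : seq T) :
  List.In a (s ++ t) -> List.In a s \/ List.In a t.
Proof.
elim: s => [|b s IH] /=; first by right.
by case=> [->|/IH[h|h]]; [left; left|left; right|right].
Qed.

Lemma In_map (I T : Type) (F : I -> T) (a : T) (s : seq I) :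
  List.In a [seq F i | i <- s] -> exists i, a = F i.
Proof. by elim: s => [|b s IH] //= [<-|/IH//]; exists b. Qed.

(** Coefficients of the trivial representation are products of complex functions; the
    real part of such a product is the sum over real and imaginary parts. *)
Lemma real_functions_along (pi : unitary_rep mu Rel) (xi : forall x, pi x) (e : R) :
  weakly_contained pi (L2_rep mu Rel) -> meas xi -> 0 < e ->
  exists (s : seq (X -> R)) N, [/\ forall a, List.In a s -> measurable_fun setT a,
    measurable N, pr mu N <= e &
    forall x, ~ N x -> forall i, (i < n)%N -> Rel (x, fg_inv (G i) x) ->
      `|hip (actT (G i) xi x) (xi x) - \sum_(a <- s) a (fg_inv (G i) x) * a x| <= e].
Proof.
move=> wc mxi e0.
have [k [zeta [N [mz mN pN hN]]]] := weakly_contained_along wc mxi e0.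
exists ([seq (fun x => complex.Re (zeta j x : R[i])) | j <- index_enum {: 'I_k}] ++
        [seq (fun x => complex.Im (zeta j x : R[i])) | j <- index_enum {: 'I_k}]), N; split=> //.
  by move=> a ha; have [h|h] := In_cat ha; have [j ->] := In_map h; have [] := mz j.
move=> x Nx i ni Dx; have := hN x Nx i ni.
have coefE j : hip (actT (G i) (zeta j) x) (zeta j x) =
    complex.Re (zeta j (fg_inv (G i) x) : R[i]) * complex.Re (zeta j x : R[i]) +
    complex.Im (zeta j (fg_inv (G i) x) : R[i]) * complex.Im (zeta j x : R[i]).
  rewrite /actT asboolT// /full_group_act /hip /inner /= /scalar_inner.
  by case: (zeta j x) (zeta j (fg_inv (G i) x)) => [a b] [a' b'] /=; ring.
rewrite (eq_bigr _ (fun j _ => coefE j)).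
by rewrite big_cat !big_map /= -big_split.
Qed.

Lemma real_functions_along_sum (pi : unitary_rep mu Rel) (I : Type)
    (xi : I -> forall x, pi x) (r : seq I) (e : R) :
  weakly_contained pi (L2_rep mu Rel) -> (forall j, meas (xi j)) -> 0 < e ->
  exists (s : seq (X -> R)) N, [/\ forall a, List.In a s -> measurable_fun setT a,
    measurable N, pr mu N <= e &
    forall x, ~ N x -> forall i, (i < n)%N -> Rel (x, fg_inv (G i) x) ->
      `|\sum_(j <- r) hip (actT (G i) (xi j) x) (xi j x) -
        \sum_(a <- s) a (fg_inv (G i) x) * a x| <= e].
Proof.
move=> wc mxi; elim: r e => [|j r IH] e e0.
  exists [::], set0; split=> //; first by rewrite pr0 ltW.
  by move=> x _ i _ _; rewrite !big_nil subrr normr0 ltW.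
have e2 : 0 < e / 2 by rewrite divr_gt0.
have [s1 [N1 [m1 mN1 p1 h1]]] := IH _ e2.
have [s2 [N2 [m2 mN2 p2 h2]]] := real_functions_along wc (mxi j) e2.
exists (s2 ++ s1), (N2 `|` N1); split.
- by move=> a ha; have [/m2|/m1] := In_cat ha.
- exact: measurableU.
- by apply: le_trans (pr_setU _ mN2 mN1) _; lra.
move=> x Nx i ni Dx; rewrite big_cons big_cat /= opprD addrACA.
apply: le_trans (ler_normD _ _) _; rewrite [e]splitr; apply: lerD.
  by apply: h2 => // N2x; apply: Nx; left.
by apply: h1 => // N1x; apply: Nx; right.
Qed.

End WeakContainmentAlong.

(** * Almost invariant families *)

Section PotentialBounds.
Context {R : realType} {d : measure_display} {X : measurableType d}.
Variables (n : nat) (phi : X -> X) (g : nat -> X -> X) (M : R).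
Hypothesis M0 : 0 <= M.
Implicit Types (s : seq (X -> R)).
Let zero : X -> R := fun=> 0.

Lemma sqdiff0 p s x : sqdiff p zero s x =
  total_sq s (p x) + total_sq s x - 2 * \sum_(a <- s) a (p x) * a x.
Proof.
rewrite /sqdiff /zero subrr expr0n /= add0r /total_sq mulr_sumr -big_split -sumrB /=.
by apply: eq_bigr => a _; ring.
Qed.

(** Almost invariance with total square near 1 makes the [g i]-terms negligible, and
    the [phi]-term is twice the defect of the correlation [h]. The constant 33/500 is
    the bound 33/10 on the quartic term, times 1/50. *)
Lemma potential_lower s x (h e : R) : 0 < e -> 100 * e <= 1 ->
  `|total_sq s (phi x) - 1| <= 2 * e -> `|total_sq s x - 1| <= 2 * e ->
  (forall i, (i < n)%N -> `|total_sq s (g i x) - 1| <= 2 * e /\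
    `|\sum_(a <- s) a (g i x) * a x - 1| <= 2 * e) ->
  `|\sum_(a <- s) a (phi x) * a x - h| <= e ->
  2 - 2 * h - (6 + 8 * (M * n%:R)) * e - 33 / 500 <= potential n phi g M zero s x.
Proof.
move=> e0 e1 hp hx hg hph.
have s1 : \sum_(i < n) sqdiff (g i) zero s x <= 8 * n%:R * e.
  have -> : 8 * n%:R * e = \sum_(i < n) 8 * e.
    by rewrite sumr_const card_ord -[_ *+ n]mulr_natl; ring.
  apply: ler_sum => i _; rewrite sqdiff0.
  have [h1 h2] := hg i (ltn_ord i).
  by move: hx h1 h2; rewrite !ler_norml => /andP[? ?] /andP[? ?] /andP[? ?]; lra.
have s2 : M * (\sum_(i < n) sqdiff (g i) zero s x) <= 8 * (M * n%:R) * e.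
  apply: le_trans (ler_wpM2l M0 s1) _.
  by rewrite le_eqVlt; apply/orP; left; apply/eqP; ring.
have s3 : sqdiff phi zero s x >= 2 - 2 * h - 6 * e.
  rewrite sqdiff0; move: hp hx hph; rewrite !ler_norml.
  by move=> /andP[? ?] /andP[? ?] /andP[? ?]; lra.
have A0 : 0 <= total_sq s x by apply: sumr_ge0 => a _; exact: sqr_ge0.
have s4 : quartic zero s x <= 33 / 10.
  rewrite /quartic /zero !expr0n /= mulr0 mul0r !add0r.
  move: hx A0; rewrite ler_norml; move: (total_sq s x) => A /andP[? ?] A0.
  have : A <= 51 / 50 by lra.
  by move=> ?; nra.
rewrite /potential; have -> : (6 + 8 * (M * n%:R)) * e = 6 * e + 8 * (M * n%:R) * e by ring.
by move: (M * (\sum_(i < n) _)) (8 * _ * e) s2 => a b; lra.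
Qed.

(** The crude bound used on the small exceptional set: it only exploits that the
    total square is bounded. *)
Lemma potential_lower_trivial s x : (forall y, total_sq s y <= 3) ->
  - (12 * (M * n%:R)) - 27 / 50 <= potential n phi g M zero s x.
Proof.
move=> s3.
have s1 : \sum_(i < n) sqdiff (g i) zero s x <= 12 * n%:R.
  have -> : 12 * n%:R = \sum_(i < n) 12 :> R.
    by rewrite sumr_const card_ord -[_ *+ n]mulr_natl; ring.
  apply: ler_sum => i _; rewrite /sqdiff /zero subrr expr0n /= add0r.
  have : \sum_(a <- s) (a (g i x) - a x) ^+ 2 <= 2 * total_sq s (g i x) + 2 * total_sq s x.
    rewrite /total_sq !mulr_sumr -big_split; apply: ler_sum => a _ /=.
    by have := sqr_ge0 (a (g i x) + a x); rewrite !sqrrD sqrrN mulrN => ?; lra.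
  by have := s3 x; have := s3 (g i x); move=> ? ? ?; lra.
have s2 : M * (\sum_(i < n) sqdiff (g i) zero s x) <= 12 * (M * n%:R).
  apply: le_trans (ler_wpM2l M0 s1) _.
  by rewrite le_eqVlt; apply/orP; left; apply/eqP; ring.
have s4 : 0 <= sqdiff phi zero s x.
  by apply: addr_ge0; [exact: sqr_ge0|apply: sumr_ge0 => a _; exact: sqr_ge0].
have A0 : 0 <= total_sq s x by apply: sumr_ge0 => a _; exact: sqr_ge0.
have s5 : quartic zero s x <= 27.
  rewrite /quartic /zero !expr0n /= mulr0 mul0r !add0r.
  by have := s3 x; move: (total_sq s x) A0 => A A0 A3; nra.
rewrite /potential.
by move: (M * (\sum_(i < n) _)) (12 * _) s2 => a b; lra.
Qed.

End PotentialBounds.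

Section AlmostInvariantFamily.
Context {R : realType} {d : measure_display} {X : measurableType d}
  {mu : probability X R} {Rel : set (X * X)}.
Hypotheses (X_standard : standard_borel R X) (Rel_equivalence : borel_equivalence Rel)
  (Rel_discrete : discrete mu Rel) (Rel_pmp : measure_preserving mu Rel).
Variable pi : unitary_rep mu Rel.
Variables (n : nat) (G : nat -> full_group mu Rel).
Hypotheses (n0 : (0 < n)%N) (G0 : G 0 = fg_id mu Rel_equivalence).
Hypothesis GRel : forall i x, Rel (x, fg_inv (G i) x).

Definition corr k (z : 'I_k -> forall x, pi x) (g : full_group mu Rel) x : R :=
  \sum_(j < k) hip (actT g (z j) x) (z j x).

(** Approximate the constant function 1 along the graphs. Among them is the diagonal,
    so the total square norm is near 1 off a small set; cutting the sections off
    where it exceeds 2 makes the family bounded and changes nothing at the good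
    points. *)
Lemma almost_invariant_family (e : R) : weakly_contained (L2_rep mu Rel) pi ->
  0 < e -> e <= 1 -> exists k (z : 'I_k -> forall x, pi x) N,
  [/\ forall j, bounded_section (z j), measurable N, pr mu N <= e,
      forall x, \sum_(j < k) hip (z j x) (z j x) <= 2 &
      forall x i, (i < n)%N -> ~ N x -> ~ N (fg_inv (G i) x) ->
        `|1 - corr z (G i) x| <= e].
Proof.
move=> wc e0 e1.
pose one : forall x, L2_rep mu Rel x := fun x => (1 : R[i]).
have mone : meas one by split; exact: measurable_cst.
have [k [zeta [N0 [mz mN0 pN0 hN0]]]] := weakly_contained_along X_standard Rel_equivalence
  Rel_discrete Rel_pmp n G wc mone e0.
have one1 i x : hip (actT (G i) one x) (one x) = 1.
  rewrite /actT asboolT// /full_group_act /hip /inner /= /scalar_inner /one.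
  by rewrite /=; ring.
have [N1 [mN1 pN1 hN1]] : exists N1, [/\ measurable N1, pr mu N1 = 0 &
    forall x, ~ N1 x -> forall j, actT (G 0) (zeta j) x = zeta j x].
  apply: ae_set; apply: ae_forall_count => j; rewrite G0; exact: actT_id.
pose A x := \sum_(j < k) hip (zeta j x) (zeta j x).
have mA : measurable_fun setT A by apply: measurable_sum => j; exact: meas_hip.
pose T := [set x | A x <= 2].
have mT : measurable T.
  have := mA measurableT _ (measurable_itv `]-oo, 2]).
  by rewrite setTI; congr measurable; apply/seteqP; split=> x /=; rewrite in_itv.
pose N := N0 `|` N1.
have TN x : ~ N x -> T x.
  move=> Nx; have := hN0 x (fun h => Nx (or_introl h)) 0%N n0.
  rewrite one1 (eq_bigr (fun j => hip (zeta j x) (zeta j x))); last first.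
    by move=> j _; rewrite (hN1 x (fun h => Nx (or_intror h))).
  by rewrite /T/= /A ler_norml => /andP[? ?]; lra.
exists k, (fun j x => if `[<T x>] then zeta j x else 0), N; split.
- move=> j; split; first exact: meas_if.
  exists 2 => x; case: asboolP => Tx; last by rewrite hip0r.
  apply: le_trans Tx; rewrite /A (bigD1 j)//= lerDl.
  by apply: sumr_ge0 => l _; exact: hip_ge0.
- exact: measurableU.
- by apply: le_trans (pr_setU _ mN0 mN1) _; rewrite pN1 addr0.
- move=> x; case: asboolP => Tx //.
  by rewrite big1 // => j _; rewrite hip0r.
move=> x i ni Nx Ngx; have := hN0 x (fun h => Nx (or_introl h)) i ni.
have zE j : hip (actT (G i) (fun y => if `[<T y>] then zeta j y else 0) x)
    (if `[<T x>] then zeta j x else 0) = hip (actT (G i) (zeta j) x) (zeta j x).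
  rewrite (asboolT (TN x Nx)) /actT asboolT// /full_group_act.
  by rewrite (asboolT (TN _ Ngx)).
by rewrite one1 /corr (eq_bigr _ (fun j _ => zE j)).
Qed.

Lemma corr_ge k (z : 'I_k -> forall x, pi x) g x :
  (forall y, \sum_(j < k) hip (z j y) (z j y) <= 2) -> - 2 <= corr z g x.
Proof.
move=> z2.
have h1 : \sum_(j < k) hip (actT g (z j) x) (actT g (z j) x) <= 2.
  under eq_bigr do rewrite actT_hip.
  by case: asboolP => _ //; rewrite big1.
have h2 := z2 x.
have : - (\sum_(j < k) hip (actT g (z j) x) (actT g (z j) x) +
    \sum_(j < k) hip (z j x) (z j x)) <= 2 * corr z g x.
  rewrite -big_split /corr mulr_sumr -sumrN; apply: ler_sum => j _ /=.
  by have := hip_abs_le (actT g (z j) x) (z j x); rewrite ler_norml => /andP[].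
lra.
Qed.

Lemma bm_corr k (z : 'I_k -> forall x, pi x) g : (forall j, bounded_section (z j)) ->
  bm (corr z g).
Proof.
move=> bz; apply: bm_sum => j; apply: bm_hip => //; exact: (bs_actT Rel_equivalence).
Qed.

End AlmostInvariantFamily.

(** * Correlated families or almost invariant sets *)

Section Stage.
Context {R : realType} {d : measure_display} {X : measurableType d}
  {mu : probability X R} {Rel : set (X * X)}.
Hypotheses (X_standard : standard_borel R X) (Rel_equivalence : borel_equivalence Rel)
  (Rel_discrete : discrete mu Rel) (Rel_pmp : measure_preserving mu Rel).
Variable pi : unitary_rep mu Rel.

Definition correlated := exists k (z : 'I_k -> forall x, pi x),
  (forall j, bounded_section (z j)) /\
  forall g : full_group mu Rel,
    1 / 4 <= \sum_(j < k) mean mu (fun x => hip (actT g (z j) x) (z j x)).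

Lemma le_total_sq (s : seq (X -> R)) a x : List.In a s -> a x ^+ 2 <= total_sq s x.
Proof.
rewrite /total_sq; elim: s => //= b s IH; rewrite big_cons => -[->|/IH h].
  by rewrite lerDl; apply: sumr_ge0 => c _; exact: sqr_ge0.
by apply: le_trans h _; rewrite lerDr sqr_ge0.
Qed.

(** The bound 3 leaves room above the total squares near 1 of the good points, where
    nothing changes. *)
Definition truncated (s : seq (X -> R)) : seq (X -> R) :=
  [seq (fun x => \1_[set y | total_sq s y <= 3] x * a x) | a <- s].

Lemma measurable_total_sq (s : seq (X -> R)) :
  (forall a, List.In a s -> measurable_fun setT a) -> measurable_fun setT (total_sq s).
Proof.
rewrite /total_sq; elim: s => [_|a s IH h].
  by under eq_fun do rewrite big_nil; exact: measurable_cst.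
under eq_fun do rewrite big_cons.
apply: measurable_funD; first by apply: measurable_funX; apply: h; left.
by apply: IH => b bs; apply: h; right.
Qed.

Lemma bm_truncated s : (forall a, List.In a s -> measurable_fun setT a) ->
  bm_all (truncated s).
Proof.
move=> ms.
have mT : measurable [set y | total_sq s y <= 3].
  have := measurable_total_sq ms measurableT (measurable_itv `]-oo, 3]).
  by rewrite setTI; congr measurable; apply/seteqP; split=> x /=; rewrite in_itv.
suff h t : (forall a, List.In a t -> List.In a s) ->
    bm_all [seq (fun x => \1_[set y | total_sq s y <= 3] x * a x) | a <- t].
  exact: h.
elim: t => [_ a []|a t IH ts b /= [<-|bt]].
- have as_ : List.In a s by apply: ts; left.
  split; first by apply: measurable_funM; [exact: measurable_indic|exact: ms].
  exists 2 => x; rewrite indicE; case: (boolP (x \in _)) => [|_]; last first.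
    by rewrite mul0r normr0.
  rewrite inE /= mul1r => hx; have := le_trans (le_total_sq x as_) hx.
  by rewrite -real_normK ?num_real//; have := normr_ge0 (a x); move: `|a x| => y; nra.
- by apply: IH => // c ct; apply: ts; right.
Qed.

Lemma total_sq_truncated s y : total_sq (truncated s) y <= 3.
Proof.
rewrite /total_sq /truncated big_map; under eq_bigr do rewrite exprMn.
rewrite -mulr_sumr indicE; case: (boolP (y \in _)) => [|_].
  by rewrite inE expr1n mul1r.
by rewrite expr0n mul0r.
Qed.

Lemma sum_truncated s x y : total_sq s x <= 3 -> total_sq s y <= 3 ->
  \sum_(a <- truncated s) a x * a y = \sum_(a <- s) a x * a y.
Proof.
move=> hx hy; rewrite /truncated big_map; apply: eq_bigr => a _.
by rewrite !indicE !mem_set// !mul1r.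
Qed.

Lemma total_sqE (s : seq (X -> R)) x : total_sq s x = \sum_(a <- s) a x * a x.
Proof. by apply: eq_bigr => a _; rewrite expr2. Qed.

(** If some [g] makes the correlation of the almost invariant family small, the real
    functions with the same correlations have a large potential, whose mean is at
    least [2 - 2 / 4] up to small errors. Signs and thresholds then produce the
    set [E]. *)
Lemma dichotomy n (G : nat -> full_group mu Rel) (kappa : R) : (0 < n)%N ->
  G 0 = fg_id mu Rel_equivalence -> (forall i x, Rel (x, fg_inv (G i) x)) ->
  0 < kappa -> weakly_equivalent (L2_rep mu Rel) pi ->
  correlated \/ exists (g : full_group mu Rel) E,
    [/\ measurable E, 1 / (80 * 80) <= pr mu (moved (fg_inv g) E) &
        forall i, (i < n)%N -> pr mu (moved (fg_inv (G i)) E) <= kappa].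
Proof.
move=> n0 G0 GRel k0 [wc1 wc2].
have [M M0 hM] := threshold mu n k0.
pose Mn := M * n%:R.
have Mn0 : 0 <= Mn by rewrite mulr_ge0.
(* [m * e] will bound the exceptional set: it is a union of [n.+1] preimages of a
   set of measure at most [2 * e]. *)
pose m : R := 2 * n.+1%:R.
have m0 : 0 <= m by rewrite mulr_ge0.
have W0 : 0 <= 6 + 8 * Mn + (12 * Mn + 7) * m.
  apply: addr_ge0; first lra.
  by apply: mulr_ge0 => //; lra.
have [e e0 [e1 eW]] : exists2 e : R, 0 < e & 100 * e <= 1 /\
    (6 + 8 * Mn) * e + m * e * (12 * Mn + 7) <= 9 / 10.
  move: W0; set W := 6 + _ + _ => W0.
  have W9 : 0 < 10 * (W + 90) by lra.
  have c9 : 0 < 9 :> R by rewrite ltr0n.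
  exists (9 / (10 * (W + 90))); first exact: divr_gt0 c9 W9.
  split.
    by rewrite mulrA ler_pdivrMr// mul1r; lra.
  have -> : (6 + 8 * Mn) * (9 / (10 * (W + 90))) +
      m * (9 / (10 * (W + 90))) * (12 * Mn + 7) = (9 * W) / (10 * (W + 90)).
    by rewrite /W; ring.
  by rewrite ler_pdivrMr//; lra.
have e2 : e <= 1 by lra.
have [k [z [N [bz mN pN z2 hN]]]] := almost_invariant_family X_standard
  Rel_discrete Rel_pmp n0 G0 GRel wc1 e0 e2.
case: (pselect (forall g, 1 / 4 <=
    \sum_(j < k) mean mu (fun x => hip (actT g (z j) x) (z j x)))) => [hA|].
  by left; exists k, z.
move=> /existsNP[g /negP]; rewrite -ltNge => hg; right.
have bh j : bm (fun x => hip (actT g (z j) x) (z j x)).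
  by apply: bm_hip => //; exact: (bs_actT Rel_equivalence).
have bc := bm_corr Rel_equivalence g bz.
have mc : mean mu (corr z g) < 1 / 4 by rewrite /corr mean_sum.
pose Gm i := if (i < n)%N then G i else g.
have Gmn : Gm n = g by rewrite /Gm ltnn.
have Gmi i : (i < n)%N -> Gm i = G i by rewrite /Gm => ->.
have [s0 [N' [ms0 mN' pN' hN']]] := real_functions_along_sum X_standard Rel_equivalence
  Rel_discrete Rel_pmp n.+1 Gm (index_enum _) wc2 (fun j => (bz j).1) e0.
have [N1 [mN1 pN1 hN1]] := ae_set (fg_inv_rel X_standard Rel_equivalence Rel_pmp g).
pose N2 := N `|` N' `|` N1.
have mN2 : measurable N2 by apply: measurableU => //; exact: measurableU.
have pN2 : pr mu N2 <= 2 * e.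
  apply: le_trans (pr_setU _ _ mN1) _; first exact: measurableU.
  by rewrite pN1 addr0; apply: le_trans (pr_setU _ mN mN') _; lra.
pose A i := [set x | N2 (fg_inv (Gm i) x)].
have mA i : measurable (A i) by apply: measurable_preim mN2; exact: fg_inv_measurable.
have pA i : pr mu (A i) = pr mu N2.
  exact: (pr_fg X_standard Rel_equivalence Rel_pmp
    (fg_opp X_standard Rel_equivalence Rel_pmp (Gm i)) mN2).
pose bad := [set x | exists2 i, (i < n.+1)%N & A i x].
have [mbad pbad] := pr_bigU mu n.+1 mA; rewrite -/bad in mbad pbad.
have {}pbad : pr mu bad <= m * e.
  apply: le_trans pbad _; under eq_bigr do rewrite pA.
  rewrite sumr_const card_ord -[_ *+ n.+1]mulr_natl.
  have -> : m * e = n.+1%:R * (2 * e) by rewrite /m; ring.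
  by rewrite ler_wpM2l.
have G0x x : fg_inv (G 0) x = x by rewrite G0.
have RelGm x i : (i < n)%N -> Rel (x, fg_inv (Gm i) x) by move=> /Gmi ->.
have notN y : ~ N2 y -> [/\ ~ N y, ~ N' y & ~ N1 y].
  by move=> h; split=> h'; apply: h; [left; left|left; right|right].
(* The diagonal is the graph of [G 0]. *)
have one_y y : ~ N2 y -> `|total_sq s0 y - 1| <= 2 * e.
  move=> /notN[Ny N'y _].
  have h1 : `|1 - corr z (G 0) y| <= e by apply: hN => //; rewrite G0x.
  have h2 := hN' y N'y 0%N isT (RelGm y 0%N n0).
  move: h1 h2; rewrite (Gmi _ n0) G0x total_sqE -/(corr z (G 0) y) !ler_norml.
  by move=> /andP[? ?] /andP[? ?]; apply/andP; split; lra.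
have three_y y : ~ N2 y -> total_sq s0 y <= 3.
  by move=> /one_y; rewrite ler_norml => /andP[? ?]; lra.
pose s := truncated s0.
have bs : bm_all s by exact: bm_truncated.
have s_one y : ~ N2 y -> `|total_sq s y - 1| <= 2 * e.
  by move=> hy; rewrite total_sqE sum_truncated ?three_y// -total_sqE; exact: one_y.
pose phi := fg_inv g.
pose gg i := fg_inv (G i).
have good x : ~ bad x ->
    2 - 2 * corr z g x - (6 + 8 * Mn) * e - 33 / 500 <= potential n phi gg M (fun=> 0) s x.
  move=> bx; have hA i : (i < n.+1)%N -> ~ N2 (fg_inv (Gm i) x).
    by move=> ni h; apply: bx; exists i.
  have hx : ~ N2 x by have := hA 0%N isT; rewrite (Gmi _ n0) G0x.
  have hphi : ~ N2 (phi x) by have := hA n (leqnn _); rewrite Gmn.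
  have [Nx N'x N1x] := notN _ hx.
  apply: potential_lower => //; [exact: s_one|exact: s_one| |].
    move=> i ni; have hgx : ~ N2 (gg i x) by have := hA i (ltnW ni); rewrite Gmi.
    split; first exact: s_one.
    have [Ngx _ _] := notN _ hgx.
    have h1 := hN x i ni Nx Ngx.
    have h2 := hN' x N'x i (ltnW ni) (RelGm x i ni).
    rewrite sum_truncated ?three_y//; move: h1 h2.
    rewrite Gmi// -/(corr z (G i) x) -/(gg i x) !ler_norml.
    by move=> /andP[? ?] /andP[? ?]; apply/andP; split; lra.
  rewrite sum_truncated ?three_y// distrC.
  have := hN' x N'x n (leqnn _); rewrite Gmn; apply.
  exact: hN1.
have all x : 2 - 2 * corr z g x - ((6 + 8 * Mn) * e + 33 / 500) -
    (12 * Mn + 7) * \1_bad x <= potential n phi gg M (fun=> 0) s x.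
  rewrite indicE; case: (boolP (x \in bad)) => [_|]; last first.
    by rewrite notin_setE => /good h; rewrite mulr0 subr0; lra.
  have h1 := potential_lower_trivial n phi gg M0 x (total_sq_truncated s0).
  have h2 := corr_ge g x z2; rewrite -/s -/Mn in h1.
  have h3 : 0 <= (6 + 8 * Mn) * e by apply: mulr_ge0; lra.
  by rewrite mulr1; lra.
have bpot : bm (potential n phi gg M (fun=> 0) s).
  apply: bm_potential => //; [exact: fg_inv_measurable|move=> i; exact: fg_inv_measurable|].
  exact: bm_cst.
have mphi : measurable_fun setT phi by exact: fg_inv_measurable.
have mgg i : measurable_fun setT (gg i) by exact: fg_inv_measurable.
have big : 1 / 2 <= mean mu (potential n phi gg M (fun=> 0) s).
  have b1 := bmB (bm_cst 2) (bmZ 2 bc).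
  have b2 := bmB b1 (bm_cst ((6 + 8 * Mn) * e + 33 / 500)).
  have b3 := bmZ (12 * Mn + 7) (bm_indic (R := R) mbad).
  apply: le_trans (mean_le mu (bmB b2 b3) bpot all).
  rewrite (meanB mu b2 b3) (meanB mu b1 (bm_cst _)) (meanB mu (bm_cst 2) (bmZ 2 bc)).
  rewrite (meanZ mu _ bc) (meanZ mu _ (bm_indic mbad)) !mean_cst mean_indic//.
  have h : (12 * Mn + 7) * pr mu bad <= m * e * (12 * Mn + 7).
    by rewrite mulrC ler_wpM2r//; lra.
  move: eW h; move: ((6 + 8 * Mn) * e) (m * e * (12 * Mn + 7)) ((12 * Mn + 7) * pr mu bad).
  by move=> a b c; lra.
have [f bf hf] := sign_choice mu n M mphi mgg (bm_cst 0) bs.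
have [E [mE pE hE]] := hM phi gg f mphi mgg
  (fun h => @mean_fg_inv _ _ _ _ _ X_standard Rel_equivalence Rel_pmp g h) bf (le_trans big hf).
by exists g, E.
Qed.

End Stage.

(** * Strong ergodicity implies rigidity *)

Section Rigidity.
Context {R : realType} {d : measure_display} {X : measurableType d}
  {mu : probability X R} {Rel : set (X * X)}.
Hypotheses (X_standard : standard_borel R X) (Rel_equivalence : borel_equivalence Rel)
  (Rel_discrete : discrete mu Rel) (Rel_pmp : measure_preserving mu Rel)
  (Rel_ergodic : ergodic mu Rel).

Lemma correlated_embeds (pi : unitary_rep mu Rel) :
  correlated pi -> embeds (L2_rep mu Rel) pi.
Proof.
move=> [k [z [bz hz]]].
have c4 : 0 < 1 / 4 :> R by rewrite divr_gt0.
have [xi [bx inv nz]] := invariant_section X_standard Rel_equivalence Rel_pmp bz c4 hz.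
have [eta [meta einv e1]] := invariant_normalize X_standard Rel_equivalence Rel_pmp
  Rel_ergodic bx inv nz.
exact: (invariant_embeds X_standard Rel_equivalence Rel_pmp meta einv e1).
Qed.

(** Both parts of the moved set lie in [E] or its translate, and both lie in one of
    the two complements. *)
Lemma pr_moved_le (g : full_group mu Rel) E : measurable E ->
  pr mu (moved (fg_inv g) E) <= 2 * pr mu E /\
  pr mu (moved (fg_inv g) E) <= 2 * (1 - pr mu E).
Proof.
move=> mE; pose E' := [set x | E (fg_inv g x)].
have mE' : measurable E' by apply: measurable_preim mE; exact: fg_inv_measurable.
have pE' : pr mu E' = pr mu E.
  exact: (pr_fg X_standard Rel_equivalence Rel_pmp
    (fg_opp X_standard Rel_equivalence Rel_pmp g) mE).
have m1 : measurable (E' `\` E) by exact: measurableD.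
have m2 : measurable (E `\` E') by exact: measurableD.
have pm : pr mu (moved (fg_inv g) E) <= pr mu (E' `\` E) + pr mu (E `\` E').
  exact: pr_setU.
have h1 : pr mu (E' `\` E) <= pr mu E' by apply: pr_le => // x [].
have h2 : pr mu (E `\` E') <= pr mu E by apply: pr_le => // x [].
have h3 : pr mu (E' `\` E) <= pr mu (~` E).
  by apply: pr_le; [|exact: measurableC|move=> x []].
have h4 : pr mu (E `\` E') <= pr mu (~` E').
  by apply: pr_le; [|exact: measurableC|move=> x []].
rewrite !prC// pE' in h1 h2 h3 h4.
by split; lra.
Qed.

(** By the covering of [Rel] it is enough to move the sets little under the
    countably many maps [g i]. *)
Lemma almost_invariant_all (g : nat -> full_group mu Rel) (E : nat -> set X) :
  {ae mu, forall x, forall y, Rel (x, y) -> exists i, g i x = y} ->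
  (forall m, measurable (E m)) ->
  (forall m i, (i <= m)%N -> pr mu (moved (g i) (E m)) <= m.+1%:R^-1) ->
  forall h : full_group mu Rel, pr mu (moved h (E m)) @[m --> \oo] --> 0.
Proof.
move=> cov mE gE h.
pose B k := [set x | forall i, (i < k)%N -> g i x <> h x].
have mB k : measurable (B k).
  apply: measurable_forall => i.
  have mi : measurable [set x | g i x = h x].
    by apply: (measurable_graph X_standard); exact: fg_fun_measurable.
  case: (ltnP i k) => ik.
    have := measurableC mi; congr measurable.
    by apply/seteqP; split=> x /= hx; [move=> _|apply: hx].
  by have := @measurableT _ X; congr measurable; apply/seteqP; split.
have B0 : pr mu (B k) @[k --> \oo] --> 0.
  rewrite -(mean_cst mu 0).
  have -> : (fun k => pr mu (B k)) = (fun k => mean mu (\1_(B k))).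
    by apply/funext => k; rewrite mean_indic.
  apply: (mean_cvg (M := 1)) => [k||k x|].
  - exact: bm_indic.
  - exact: bm_cst.
  - by rewrite indicE; case: (_ \in _); rewrite /= ?normr1 ?normr0.
  apply: filterS2 cov (fg_rel h) => x cx /cx[i ix].
  apply/cvgrPdist_le => e e0; exists i.+1 => // k /= ik.
  rewrite indicE memNset ?subr0 ?normr0 ?ltW//.
  by move=> Bx; exact: (Bx i ik).
apply/cvgrPdist_le => e e0.
have e2 : 0 < e / 2 by rewrite divr_gt0.
have /cvgrPdist_le/(_ _ e2)[k _ hk] := B0.
have {hk} : pr mu (B k) <= e / 2.
  by have := hk k (leqnn k); rewrite sub0r normrN ger0_norm// pr_ge0.
have ek : 0 < e / 2 / k.+1%:R by rewrite divr_gt0.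
have [m0 _ hm0] := near_infty_natSinv_lt (PosNum ek).
move=> pB; exists (maxn k m0) => // m /=; rewrite geq_max => /andP[km /hm0 /= hm].
rewrite sub0r normrN ger0_norm ?pr_ge0//.
pose A i := moved (g i) (E m).
have mA i : measurable (A i) by exact: measurable_moved.
have [mU pU] := pr_bigU mu k mA.
have sub : moved h (E m) `<=` B k `|` [set x | exists2 i, (i < k)%N & A i x].
  move=> x hx; case: (pselect (B k x)) => [|nB]; [by left|right].
  move/existsNP: nB => [i /not_implyP[ik /contrapT gx]]; exists i => //.
  by move: hx; rewrite /A /moved /setD /setU /= gx.
have mh : measurable (moved h (E m)) by exact: measurable_moved.
apply: le_trans (pr_le mu mh (measurableU _ _ (mB k) mU) sub) _.
apply: le_trans (pr_setU _ (mB k) mU) _; rewrite [e]splitr; apply: lerD => //.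
apply: le_trans pU _.
have : \sum_(i < k) pr mu (A i) <= \sum_(i < k) (e / 2 / k.+1%:R).
  apply: ler_sum => i _; apply: le_trans (ltW hm); apply: gE.
  by apply: leq_trans km; exact: ltnW.
move/le_trans; apply; rewrite sumr_const card_ord -[_ *+ k]mulr_natr.
by rewrite -mulrA ler_piMr ?ltW// mulrC ltr_pdivrMr// mul1r ltr_nat.
Qed.

(** A failure of correlation for every finite family would produce asymptotically
    invariant sets, each of them moved by a fixed amount by some element of the full
    group, hence of measure away from 0 and 1. *)
Lemma strongly_ergodic_rigid : strongly_ergodic mu Rel ->
  forall pi : unitary_rep mu Rel,
    weakly_equivalent (L2_rep mu Rel) pi -> embeds (L2_rep mu Rel) pi.
Proof.
move=> se pi we; apply: correlated_embeds; apply: contrapT => nc.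
have [g [gRel _] cov] := full_group_cover X_standard Rel_equivalence Rel_discrete Rel_pmp.
pose G i := if i is j.+1 then fg_opp X_standard Rel_equivalence Rel_pmp (g j)
  else fg_id mu Rel_equivalence.
have GRel i x : Rel (x, fg_inv (G i) x).
  by case: i => [|j]; [exact: Rel_refl|exact: gRel].
have ex m : exists E : set X, [/\ measurable E,
    forall i, (i <= m)%N -> pr mu (moved (g i) E) <= m.+1%:R^-1 &
    exists h : full_group mu Rel, 1 / (80 * 80) <= pr mu (moved (fg_inv h) E)].
  have k0 : 0 < m.+1%:R^-1 :> R by rewrite invr_gt0.
  have [//|[h [E [mE pE hE]]]] := dichotomy X_standard Rel_discrete Rel_pmp
    (ltn0Sn m.+1) (erefl : G 0 = _) GRel k0 we.
  exists E; split=> //; last by exists h.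
  by move=> i im; apply: (hE i.+1).
have [E hE] := choice ex.
have mE m : measurable (E m) by case: (hE m).
have inv h := almost_invariant_all cov mE (fun m => let: And3 _ p _ := hE m in p) h.
have movedE (h : full_group mu Rel) m : mu ((h @` E m) `+` E m) = (pr mu (moved h (E m)))%:E.
  rewrite -(pr_moved X_standard Rel_equivalence Rel_pmp)// prE//.
  by apply: measurableU; apply: measurableD => //; exact: fg_image_measurable.
have {movedE} lim : (mu (E m) * (1 - mu (E m)) @[m --> \oo] --> 0)%E.
  apply: (se E mE) => h; rewrite (eq_cvg _ _ (movedE h)).
  by apply/fine_cvgP; split; [exact: nearW|exact: inv].
have prodE m : (mu (E m) * (1 - mu (E m)) = (pr mu (E m) * (1 - pr mu (E m)))%R%:E)%E.
  by rewrite prE// -EFinB -EFinM.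
move: lim; rewrite (eq_cvg _ _ prodE) => /fine_cvgP[_].
have [c c0 hc] : exists2 c : R, 0 < c & forall m, c <= pr mu (E m) /\ c <= 1 - pr mu (E m).
  have c80 : 0 < 80 :> R by rewrite ltr0n.
  exists (1 / (80 * 80) / 2).
    by apply: divr_gt0 => //; exact: divr_gt0 ltr01 (mulr_gt0 c80 c80).
  move=> m; case: (hE m) => _ _ [h hh]; have [h1 h2] := pr_moved_le h (mE m).
  by move: hh h1 h2; move: (1 / (80 * 80)) => c ? ? ?; split; lra.
have cc : 0 < c * c by exact: mulr_gt0.
move=> /cvgrPdist_lt/(_ _ cc)[m _ /(_ m (leqnn m))] /=; have [h1 h2] := hc m.
have h3 : c * c <= pr mu (E m) * (1 - pr mu (E m)) by apply: ler_pM => //; exact: ltW.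
by rewrite sub0r normrN ger0_norm ?ltNge ?h3//; apply: le_trans h3; exact: ltW.
Qed.

End Rigidity.

Theorem corollary4p10 (R : realType) (d : measure_display)
    (X : measurableType d) (mu : probability X R) (Rel : set (X * X))
    (X_standard : standard_borel R X)
    (Rel_equivalence : borel_equivalence Rel)
    (Rel_discrete : discrete mu Rel)
    (Rel_pmp : measure_preserving mu Rel)
    (Rel_ergodic : ergodic mu Rel) :
  strongly_ergodic mu Rel <->
  (forall pi : unitary_rep mu Rel,
    weakly_equivalent (L2_rep mu Rel) pi -> embeds (L2_rep mu Rel) pi).
Proof.
split; first exact: strongly_ergodic_rigid.
exact: rigid_strongly_ergodic.
Qed.
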